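(* Let $A$ be a unital, simple, nonelementary $C^*$-algebra. Then every positive functional $\varphi\colon A\to\mathbb{C}$ admits a Haar unitary, that is, there exists a unitary $u\in A$ such that $\varphi(u^k)=0$ for every $k\in\mathbb{Z}\setminus\{0\}$.
   Context: A $C^*$-algebra is elementary if it is isomorphic to the algebra of compact operators on some Hilbert space (so a unital, simple $C^*$-algebra is nonelementary if and only if it is infinite-dimensional). A positive functional on $A$ is a positive linear map $A\to\mathbb{C}$; it is not assumed to be tracial. *)

(* Defs.v *)
From HB Require Import structures.
From mathcomp Require Import all_boot all_order all_algebra.
From mathcomp Require Import all_classical all_reals all_analysis.
From mathcomp Require Import complex.

Set Implicit Arguments.
Unset Strict Implicit.
Unset Printing Implicit Defensive.

Import Order.TTheory GRing.Theory Num.Theory numFieldNormedType.Exports.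

Local Open Scope classical_set_scope.
Local Open Scope ring_scope.
Local Open Scope complex_scope.

(* The complex numbers are R[i] for R : realType.  Norms over R[i] take their *)
(* values in R[i]; these values are real and nonnegative.                     *)

(* A unital C*-algebra is a complex Banach space with a bilinear associative  *)
(* unital product whose norm is submultiplicative, and a conjugate-linear     *)
(* antimultiplicative involution satisfying the C*-identity.  The algebra is  *)
(* nonzero.  Ring and topology are not joined by an HB structure because the  *)
(* hierarchy only allows a normed ring type to be a numDomainType; instead    *)
(* both sets of instances are declared below on the carrier.                  *)
Record unitalCStarAlg (R : realType) := UnitalCStarAlg {
  cstar_banach : completeNormedModType R[i] ;
  cstar_one : cstar_banach ;
  cstar_mul : cstar_banach -> cstar_banach -> cstar_banach ;
  cstar_star : cstar_banach -> cstar_banach ;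
  cstar_mulA : associative cstar_mul ;
  cstar_mul1l : left_id cstar_one cstar_mul ;
  cstar_mul1r : right_id cstar_one cstar_mul ;
  cstar_mulDl : left_distributive cstar_mul +%R ;
  cstar_mulDr : right_distributive cstar_mul +%R ;
  cstar_one_neq0 : cstar_one != 0 ;
  cstar_scaleAl : forall (z : R[i]) a b,
    z *: cstar_mul a b = cstar_mul (z *: a) b ;
  cstar_scaleAr : forall (z : R[i]) a b,
    z *: cstar_mul a b = cstar_mul a (z *: b) ;
  cstar_starD : {morph cstar_star : a b / a + b} ;
  cstar_starZ : forall (z : R[i]) a,
    cstar_star (z *: a) = Num.conj z *: cstar_star a ;
  cstar_starM : forall a b,
    cstar_star (cstar_mul a b) = cstar_mul (cstar_star b) (cstar_star a) ;
  cstar_starK : involutive cstar_star ;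
  cstar_normM : forall a b, `|cstar_mul a b| <= `|a| * `|b| ;
  cstar_identity : forall a, `|cstar_mul (cstar_star a) a| = `|a| ^+ 2
}.

Definition cstar_carrier (R : realType) (A : unitalCStarAlg R) : Type :=
  cstar_banach A.
Coercion cstar_carrier : unitalCStarAlg >-> Sortclass.

Section CStarAlgebraInstances.
Variables (R : realType) (A : unitalCStarAlg R).

HB.instance Definition _ :=
  CompleteNormedModule.copy (cstar_carrier A) (cstar_banach A).

HB.instance Definition _ := GRing.Zmodule_isNzRing.Build (cstar_carrier A)
  (@cstar_mulA R A) (@cstar_mul1l R A) (@cstar_mul1r R A)
  (@cstar_mulDl R A) (@cstar_mulDr R A) (@cstar_one_neq0 R A).

HB.instance Definition _ :=
  GRing.Lmodule_isLalgebra.Build R[i] (cstar_carrier A) (@cstar_scaleAl R A).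

HB.instance Definition _ :=
  GRing.Lalgebra_isAlgebra.Build R[i] (cstar_carrier A) (@cstar_scaleAr R A).

(* The unit ring structure, which provides u ^ k for k : int, is obtained     *)
(* classically: units are the two-sided invertible elements.                  *)
Definition cstar_invertible (a : cstar_carrier A) : Prop :=
  exists b, b * a = 1 /\ a * b = 1.

Definition cstar_inv (a : cstar_carrier A) : cstar_carrier A :=
  if pselect (cstar_invertible a) is left h then projT1 (cid h) else a.

Definition cstar_unit : pred (cstar_carrier A) :=
  fun a => `[< cstar_invertible a >].

Let inverseP a : cstar_invertible a -> cstar_inv a * a = 1 /\ a * cstar_inv a = 1.
Proof. by move=> h; rewrite /cstar_inv; case: pselect => // ?; case: cid. Qed.

Let mulVr : {in cstar_unit, left_inverse 1 cstar_inv *%R}.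
Proof. by move=> a /asboolP/inverseP[]. Qed.

Let divrr : {in cstar_unit, right_inverse 1 cstar_inv *%R}.
Proof. by move=> a /asboolP/inverseP[]. Qed.

Let unitrP (a b : cstar_carrier A) :
  b * a = 1 /\ a * b = 1 -> cstar_unit a.
Proof. by move=> ab; apply/asboolP; exists b. Qed.

Let invr_out : {in [predC cstar_unit], cstar_inv =1 id}.
Proof.
by move=> a /asboolP na; rewrite /cstar_inv; case: pselect.
Qed.

HB.instance Definition _ := GRing.NzRing_hasMulInverse.Build (cstar_carrier A)
  mulVr divrr unitrP invr_out.

End CStarAlgebraInstances.

Section CStarAlgebra.
Variables (R : realType) (A : unitalCStarAlg R).

Definition star (a : A) : A := cstar_star a.

Record closed_ideal (I : set A) : Prop := ClosedIdeal {
  closed_ideal_closed : closed I ;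
  closed_ideal0 : I 0 ;
  closed_idealD : forall a b : A, I a -> I b -> I (a + b) ;
  closed_idealZ : forall (z : R[i]) (a : A), I a -> I (z *: a) ;
  closed_idealMl : forall a b : A, I b -> I (a * b) ;
  closed_idealMr : forall a b : A, I a -> I (a * b)
}.

Definition simple_cstar : Prop :=
  forall I : set A, closed_ideal I -> I = [set 0] \/ I = setT.

Definition unitary (u : A) : Prop := star u * u = 1 /\ u * star u = 1.

Definition positive_elt (a : A) : Prop := exists b : A, a = star b * b.

(* In R[i], 0 <= z means that z is real and nonnegative.                      *)
Definition positive_functional (phi : {scalar A}) : Prop :=
  forall a : A, positive_elt a -> 0 <= phi a.

Definition haar_unitary (phi : {scalar A}) (u : A) : Prop :=
  unitary u /\ forall k : int, k != 0 -> phi (u ^ k) = 0.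

End CStarAlgebra.

Definition compact_operator (K : numFieldType) (V : normedModType K)
    (T : V -> V) : Prop :=
  linear T /\ compact (closure (T @` [set x | `|x| <= 1])).

(* The Banach space H is a Hilbert space with inner product dot, linear in    *)
(* the first argument, when dot induces the norm of H.                        *)
Definition hilbert_dot (R : realType) (H : completeNormedModType R[i])
    (dot : {dot H for Num.conj}) : Prop :=
  forall x : H, dot x x = `|x| ^+ 2.

(* pi is a *-isomorphism onto the algebra of compact operators on H, whose    *)
(* product is composition and whose involution is the Hilbert space adjoint.  *)
Definition elementary (R : realType) (A : unitalCStarAlg R) : Prop :=
  exists (H : completeNormedModType R[i]) (dot : {dot H for Num.conj})
         (pi : {linear A -> (H -> H)}),
    [/\ hilbert_dot dot,
        set_bij setT [set T : H -> H | compact_operator T] pi,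
        forall a b : A, pi (a * b) = pi a \o pi b
      & forall (a : A) (x y : H), dot (pi a x) y = dot x (pi (star a) y)].

(* Main.v *)
Require Import Defs.
From HB Require Import structures.
From mathcomp Require Import all_boot all_order all_algebra.
From mathcomp Require Import all_classical all_reals all_analysis.
From mathcomp Require Import complex.
From mathcomp Require Import ring lra.

Set Implicit Arguments.
Unset Strict Implicit.
Unset Printing Implicit Defensive.

Import Order.TTheory GRing.Theory Num.Theory numFieldNormedType.Exports.

Local Open Scope classical_set_scope.
Local Open Scope ring_scope.
Local Open Scope complex_scope.

(* For a self-adjoint a, the functional f |-> phi (f a) on C(sp a) is a       *)
(* measure. If it has no atoms, its distribution function F is continuous, F  *)
(* a is uniformly distributed on [0, 1], and exp (2 i pi F a) is a Haar       *)
(* unitary.                                                                   *)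
(* By Baire's theorem for the self-adjoint elements, some a is in the         *)
(* interior or the exterior of each of the open sets O(W, q), where O(W, q)   *)
(* consists of the elements whose mass in the window W contains two separated *)
(* parts of mass more than q. If such an a has an atom of mass m at t, then   *)
(* it is exterior to O(W, q) for a small window W around t. This is           *)
(* contradicted by flattening a near t and adding a small multiple of h,      *)
(* provided that there are c > q and, in the hereditary subalgebra of every   *)
(* bump f_n a around t, a self-adjoint h with phi h_+ >= c and phi h_- >= c.  *)
(* If there is no such c, then phi is nearly multiplicative on these          *)
(* subalgebras. Take v <> 0 in the subalgebra of f_n a, orthogonal to f_k a   *)
(* for large k. By simplicity some z = v b keeps phi (f_k a z^* z f_k a) away *)
(* from 0, and near multiplicativity allows one to truncate z (f_k a) to a    *)
(* contraction of square zero, u, such that phi (u^* u) is comparable to m.   *)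
(* Then u + u^* , rotated to have mean 0, splits phi. Such a v exists unless  *)
(* f_n a is eventually a projection p. In this case the same argument applies *)
(* inside p A p unless p A p = C p, and then A, being simple and unital, is   *)
(* the algebra of all operators on the finite-dimensional Hilbert space A p.  *)

(** * The real-valued norm *)

(** The distribution of a self-adjoint [a] under [phi] is a measure on the real line, and everything
    reduces to finding an [a] for which it has no atoms ([exists_diffuse]). For such an [a] the
    normalised distribution function [F = dfun phi a] is continuous and carries the measure to a
    multiple of Lebesgue measure on the unit interval ([dfun_integral]). Hence the cosine and sine
    of [2 pi k F(a)] have mean zero for [k > 0], and [haar_of_diffuse] assembles them into the
    powers of one unitary.

    Atoms are destroyed by small perturbations. Once every bump around [t] dominates an element
    splitting [phi] with a uniform constant, [split_perturb] separates the mass near [t] into two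
    pieces; being split is an open condition, so [baire_sa] treats all windows at once. The uniform
    constant comes from [split_atom], whose engine is [core]. If [phi] hardly splits below the
    bumps, it behaves there like a point evaluation. Simplicity ([simple_push]) then links an
    orthogonal [v] to the bumps with some mass, and the failure to split forces a truncated link to
    carry most of the mass. This link has square zero, and such elements always split
    ([splits_nilpotent]).

    The remaining obstruction is a projection [p] of positive mass with [p A p] one-dimensional. By
    [span_one], [1] is then a finite sum of products [a p b], so [A p] is a finite-dimensional
    Hilbert space on which [A] acts as all linear maps ([elementary_of_minimal]).

    The functional calculus avoids the spectrum: functions live on intervals containing
    [[- nrm a, nrm a]], and the norm bound on polynomials rests on the positivity of Bernstein
    polynomials ([nrm_pev01]). *)

Section Norm.
Variables (R : realType) (V : normedModType R[i]).
Implicit Types x y : V.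

Definition nrm x : R := complex.Re `|x|.

Lemma nrmE x : `|x| = (nrm x)%:C.
Proof. by apply/esym/RRe_real/ger0_real. Qed.

Lemma nrm_ge0 x : 0 <= nrm x.
Proof. by have := normr_ge0 x; rewrite nrmE ler0c. Qed.

Lemma nrmD x y : nrm (x + y) <= nrm x + nrm y.
Proof. by have := ler_normD x y; rewrite !nrmE -rmorphD /= lecR. Qed.

Lemma nrmN x : nrm (- x) = nrm x.
Proof. by rewrite /nrm normrN. Qed.

Lemma nrmB x y : nrm (x - y) <= nrm x + nrm y.
Proof. by rewrite -(nrmN y) nrmD. Qed.

Lemma nrmBC x y : nrm (x - y) = nrm (y - x).
Proof. by rewrite -nrmN opprB. Qed.

Lemma nrm0 : nrm (0 : V) = 0.
Proof. by rewrite /nrm normr0. Qed.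

Lemma nrm0_eq0 x : nrm x = 0 -> x = 0.
Proof. by move=> x0; apply/eqP; rewrite -normr_eq0 nrmE x0. Qed.

Lemma nrmZ (r : R) x : nrm (r%:C *: x) = `|r| * nrm x.
Proof.
have := normrZ r%:C x; rewrite !nrmE normc_def /= expr0n /= addr0 sqrtr_sqr.
by rewrite -rmorphM /= => /complexI.
Qed.

Lemma nrm_triangle x y z : nrm (x - z) <= nrm (x - y) + nrm (y - z).
Proof. by rewrite -{1}[x](subrK y) -addrA; exact: nrmD. Qed.

Lemma nrm_small_eq0 x : (forall e, 0 < e -> nrm x <= e) -> x = 0.
Proof.
move=> h; apply/nrm0_eq0/eqP; rewrite eq_le nrm_ge0 andbT.
by apply/ler_addgt0Pl => e /h; rewrite addr0.
Qed.

Lemma nrm_ball x (e : R[i]) y : 0 < e -> ball x e y <-> nrm (x - y) < complex.Re e.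
Proof.
move=> e0; rewrite -ball_normE /= nrmE.
by rewrite -{1}(RRe_real (gtr0_real e0)) ltcR.
Qed.

End Norm.

Section Complete.
Variables (R : realType) (V : completeNormedModType R[i]).

Lemma nrm_complete (y : nat -> V) :
  (forall e : R, 0 < e -> exists N, forall m n, (N <= m)%N -> (N <= n)%N ->
     nrm (y m - y n) < e) ->
  exists l, forall e : R, 0 < e -> exists N, forall n, (N <= n)%N -> nrm (y n - l) < e.
Proof.
move=> cy.
have : cvgn y.
  apply/cauchy_cvgP/cauchy_ballP => e e0.
  have e0' : 0 < complex.Re e by rewrite -ltcR (RRe_real (gtr0_real e0)).
  have [N yN] := cy _ e0'.
  exists (y @` [set n | (N <= n)%N], y @` [set n | (N <= n)%N]) => /=.
    by split; exists N => // n /= Nn; exists n.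
  by move=> [_ _] [/= [m Nm <-] [n Nn <-]]; apply/nrm_ball => //; apply: yN.
move=> /cvg_ex[l yl]; exists l => e e0.
have e0C : 0 < e%:C by rewrite ltcR.
have /cvg_ballP/(_ _ e0C)[N _ yN] := yl.
exists N => n Nn; have /nrm_ball := yN n Nn.
by rewrite nrmBC => /(_ e0C).
Qed.

End Complete.

(** * Self-adjoint elements *)

Section Basics.
Variables (R : realType) (A : unitalCStarAlg R).
Implicit Types x y z : A.

Lemma starD x y : star (x + y) = star x + star y.
Proof. exact: cstar_starD. Qed.

Lemma starZ (c : R[i]) x : star (c *: x) = Num.conj c *: star x.
Proof. exact: cstar_starZ. Qed.

Lemma starM x y : star (x * y) = star y * star x.
Proof. exact: cstar_starM. Qed.

Lemma starK x : star (star x) = x.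
Proof. exact: cstar_starK. Qed.

Lemma starN x : star (- x) = - star x.
Proof. by rewrite -scaleN1r starZ rmorphN rmorph1 scaleN1r. Qed.

Lemma starB x y : star (x - y) = star x - star y.
Proof. by rewrite starD starN. Qed.

Lemma star0 : star (0 : A) = 0.
Proof. by have := starB 0 0; rewrite !subrr. Qed.

Lemma star1 : star (1 : A) = 1.
Proof. by rewrite -[LHS]mulr1 -{2}(starK 1) -starM mulr1 starK. Qed.

Lemma starZr (r : R) x : star (r%:C *: x) = r%:C *: star x.
Proof. by rewrite starZ conj_Creal //; apply/complex_realP; exists r. Qed.

Lemma nrmM x y : nrm (x * y) <= nrm x * nrm y.
Proof. by have := cstar_normM x y; rewrite !nrmE -rmorphM /= lecR. Qed.

Lemma nrm_cstar x : nrm (star x * x) = nrm x ^+ 2.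
Proof. by have := cstar_identity x; rewrite !nrmE -rmorphXn /= => /complexI. Qed.

Lemma nrm_star x : nrm (star x) = nrm x.
Proof.
have le y : nrm y <= nrm (star y).
  have [->|] := eqVneq (nrm y) 0; first exact: nrm_ge0.
  move=> y0; have y0' : 0 < nrm y by rewrite lt0r y0 nrm_ge0.
  by rewrite -(ler_pM2r y0') -expr2 -nrm_cstar nrmM.
by apply/eqP; rewrite eq_le le -{2}(starK x) le.
Qed.

Lemma nrm1 : nrm (1 : A) = 1.
Proof.
have := nrm_cstar 1; rewrite star1 mulr1 => h.
have n0 : nrm (1 : A) != 0.
  by apply/eqP => /nrm0_eq0/eqP; rewrite oner_eq0.
by apply: (mulfI n0); rewrite -expr2 -h mulr1.
Qed.

Definition sa x := star x = x.

Lemma sa0 : sa 0. Proof. exact: star0. Qed.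
Lemma sa1 : sa 1. Proof. exact: star1. Qed.

Lemma saD x y : sa x -> sa y -> sa (x + y).
Proof. by rewrite /sa starD => -> ->. Qed.

Lemma saN x : sa x -> sa (- x).
Proof. by rewrite /sa starN => ->. Qed.

Lemma saB x y : sa x -> sa y -> sa (x - y).
Proof. by move=> ? ?; apply/saD/saN. Qed.

Lemma saZ (r : R) x : sa x -> sa (r%:C *: x).
Proof. by rewrite /sa starZr => ->. Qed.

Lemma saM x y : x * y = y * x -> sa x -> sa y -> sa (x * y).
Proof. by rewrite /sa starM => -> -> ->. Qed.

Lemma saJ x y : sa x -> sa (star y * x * y).
Proof. by rewrite /sa !starM starK mulrA => ->. Qed.

Lemma sa_cstar x : sa (star x * x).
Proof. by rewrite /sa starM starK. Qed.

Lemma nrm_sqr x : sa x -> nrm (x * x) = nrm x ^+ 2.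
Proof. by move=> sx; rewrite -nrm_cstar sx. Qed.

(* Arens and Kelley: [y ^+ 2 + z ^+ 2 = w^* w] for [w = y + iz], and [y] is   *)
(* the mean of [w] and [w^*].                                                 *)
Lemma nrm_sqr_le y z : sa y -> sa z -> y * z = z * y ->
  nrm (y * y) <= nrm (y * y + z * z).
Proof.
move=> sy sz yz; pose w := y + 'i *: z.
have sw : star w = y - 'i *: z by rewrite starD starZ sy sz conjCi scaleNr.
have -> : y * y + z * z = star w * w.
  rewrite sw mulrDl !mulrDr !mulNr -!scalerAl -!scalerAr scalerA -[_ * 'i]expr2.
  rewrite sqrCi.  by rewrite scaleN1r opprK yz addrA addrK.
rewrite nrm_cstar nrm_sqr // ler_sqr ?nnegrE ?nrm_ge0 //.
have : nrm (y + y) <= nrm w + nrm w.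
  rewrite -{2}(nrm_star w) sw (_ : y + y = w + (y - 'i *: z)) ?nrmD //.
  by rewrite addrACA subrr addr0.
have -> : y + y = (2 : R)%:C *: y by rewrite rmorphMn rmorph1 scaler_nat mulr2n.
rewrite nrmZ ger0_norm //; lra.
Qed.

Definition tends (y : nat -> A) l :=
  forall e : R, 0 < e -> exists N, forall n, (N <= n)%N -> nrm (y n - l) < e.

Lemma tends_unique (y : nat -> A) l1 l2 : tends y l1 -> tends y l2 -> l1 = l2.
Proof.
move=> h1 h2; apply/eqP; rewrite -subr_eq0; apply/eqP/nrm_small_eq0 => e e0.
have e2 : 0 < e / 2 by rewrite divr_gt0.
have [N1 H1] := h1 _ e2; have [N2 H2] := h2 _ e2.
have := H1 _ (leq_maxl N1 N2); have := H2 _ (leq_maxr N1 N2).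
rewrite nrmBC [nrm (y _ - l1)]nrmBC nrmBC => {}H2 {}H1.
apply: ltW; apply: le_lt_trans (nrm_triangle _ (y (maxn N1 N2)) _) _.
rewrite (splitr e); apply: ltrD => //; exact: H2.
Qed.

Lemma tends_cst x : tends (fun=> x) x.
Proof. by move=> e e0; exists 0 => n _; rewrite subrr nrm0. Qed.

Lemma tendsS (y : nat -> A) l : tends y l -> tends (fun n => y n.+1) l.
Proof. by move=> h e /h[N H]; exists N => n Nn; apply/H/leqW. Qed.

Lemma tendsD (y1 y2 : nat -> A) l1 l2 : tends y1 l1 -> tends y2 l2 ->
  tends (fun n => y1 n + y2 n) (l1 + l2).
Proof.
move=> h1 h2 e e0.
have e2 : 0 < e / 2 by rewrite divr_gt0.
have [N1 H1] := h1 _ e2; have [N2 H2] := h2 _ e2.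
exists (maxn N1 N2) => n; rewrite geq_max => /andP[/H1 {}H1 /H2 {}H2].
rewrite opprD addrACA; have := nrmD (y1 n - l1) (y2 n - l2); lra.
Qed.

Lemma tends_lin (f : A -> A) (C : R) (y : nat -> A) l :
  (forall x z, nrm (f x - f z) <= C * nrm (x - z)) ->
  tends y l -> tends (fun n => f (y n)) (f l).
Proof.
move=> fC h e e0; have C0 : 0 < `|C| + 1 by rewrite ltr_wpDl.
have [|N H] := h (e / (`|C| + 1)); first by rewrite divr_gt0.
exists N => n /H; rewrite ltr_pdivlMr // => H1; apply: le_lt_trans (fC _ _) _.
apply: le_lt_trans H1; rewrite mulrC ler_wpM2l ?nrm_ge0 //.
by rewrite (le_trans (ler_norm _)) // lerDl.
Qed.

Lemma tendsZ (r : R) (y : nat -> A) l : tends y l ->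
  tends (fun n => r%:C *: y n) (r%:C *: l).
Proof. by apply: (tends_lin (C := `|r|)) => x z; rewrite -scalerBr nrmZ. Qed.

Lemma tends_star (y : nat -> A) l : tends y l ->
  tends (fun n => star (y n)) (star l).
Proof. by apply: (tends_lin (C := 1)) => x z; rewrite -starB nrm_star mul1r. Qed.

Lemma tendsMl c (y : nat -> A) l : tends y l -> tends (fun n => c * y n) (c * l).
Proof. by apply: (tends_lin (C := nrm c)) => x z; rewrite -mulrBr nrmM. Qed.

Lemma tendsMr c (y : nat -> A) l : tends y l -> tends (fun n => y n * c) (l * c).
Proof.
apply: (tends_lin (f := fun x => x * c) (C := nrm c)) => x z.
by rewrite -mulrBl mulrC nrmM.
Qed.

Lemma tends_bounded (y : nat -> A) l : tends y l ->
  exists2 C : R, 0 <= C & exists N, forall n, (N <= n)%N -> nrm (y n) <= C.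
Proof.
move=> /(_ 1 ltr01)[N H]; exists (1 + nrm l).
  by rewrite addr_ge0 ?nrm_ge0.
exists N => n /H/ltW Hn; have := nrm_triangle (y n) l 0; rewrite !subr0.
by move=> h; apply: (le_trans h); rewrite lerD2r.
Qed.

Lemma tendsM (y1 y2 : nat -> A) l1 l2 : tends y1 l1 -> tends y2 l2 ->
  tends (fun n => y1 n * y2 n) (l1 * l2).
Proof.
move=> h1 h2 e e0; have [C C0 [N0 H0]] := tends_bounded h2.
have n1 := nrm_ge0 l1.
have e1 : 0 < e / 2 / (C + 1) by rewrite !divr_gt0 // ltr_wpDl.
have e2 : 0 < e / 2 / (nrm l1 + 1) by rewrite !divr_gt0 // ltr_wpDl.
have [N1 H1] := h1 _ e1; have [N2 H2] := h2 _ e2.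
exists (maxn N0 (maxn N1 N2)) => n; rewrite !geq_max => /and3P[/H0 {}H0 /H1 {}H1 /H2 {}H2].
have -> : y1 n * y2 n - l1 * l2 = (y1 n - l1) * y2 n + l1 * (y2 n - l2).
  by rewrite mulrBl mulrBr addrA subrK.
apply: le_lt_trans (nrmD _ _) _.
move: H1 H2; rewrite !ltr_pdivlMr ?ltr_wpDl // => H1 H2.
have := nrmM (y1 n - l1) (y2 n); have := nrmM l1 (y2 n - l2).
have := nrm_ge0 (y1 n - l1); have := nrm_ge0 (y2 n - l2).
move: H1 H2 H0; set a := nrm (_ - _); set b := nrm (_ - _); set c := nrm (y2 n).
move: (nrm _) (nrm _) => p q; nra.
Qed.

End Basics.

(** * Square roots and positive elements *)

Section SquareRoot.
Variables (R : realType) (A : unitalCStarAlg R).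
Implicit Types x y z : A.

(** The scalar model of [sqrt_seq], for [x = 1]. It increases inside [[0, 1]], hence is Cauchy, and
    its increments dominate those of [sqrt_seq]; this covers the boundary case of norm one, where no
    geometric rate is available. *)
Fixpoint eta n : R := if n is m.+1 then (1 + eta m ^+ 2) / 2 else 0.

Lemma eta01 n : 0 <= eta n <= 1.
Proof. by elim: n => [|n /andP[h0 h1]] /=; [lra|nra]. Qed.

Lemma eta_nd : nondecreasing_seq eta.
Proof.
apply/nondecreasing_seqP => n /=; have := sqr_ge0 (1 - eta n); lra.
Qed.

Lemma eta_cauchy (e : R) : 0 < e ->
  exists N, forall m n, (N <= m)%N -> (N <= n)%N -> eta m - eta n < e.
Proof.
move=> e0; have hs : has_sup (range eta).
  split; first by exists (eta 0), 0.
  by exists 1 => _ [n _ <-]; case/andP: (eta01 n).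
have [_ [N _ <-] hN] := sup_adherent e0 hs.
exists N => m n Nm Nn.
have h1 : eta m <= sup (range eta) by apply: ub_le_sup; [case: hs|exists m].
have h2 := eta_nd Nn; lra.
Qed.

(** A limit [l] satisfies [2 l = x + l ^ 2], that is [(1 - l) ^ 2 = 1 - x]. *)
Fixpoint sqrt_seq x n : A :=
  if n is m.+1 then (2^-1)%:C *: (x + sqrt_seq x m * sqrt_seq x m) else 0.

Lemma sqrt_seq_comm x c n : c * x = x * c -> c * sqrt_seq x n = sqrt_seq x n * c.
Proof.
move=> cx; elim: n => [|n IH] /=; first by rewrite mulr0 mul0r.
rewrite -scalerAr -scalerAl mulrDr mulrDl cx mulrA IH -!mulrA.
by rewrite IH.
Qed.

Lemma nrm_sqrt_seq x n : nrm x <= 1 -> nrm (sqrt_seq x n) <= eta n.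
Proof.
move=> x1; elim: n => [|n IH] /=; first by rewrite nrm0.
rewrite nrmZ ger0_norm ?invr_ge0 // mulrC ler_pM2r //.
have := nrmD x (sqrt_seq x n * sqrt_seq x n).
have := nrmM (sqrt_seq x n) (sqrt_seq x n); have := nrm_ge0 (sqrt_seq x n).
move: IH; case/andP: (eta01 n); nra.
Qed.

(** The iterates commute, so each increment is half the previous increment times the sum of the two
    iterates involved; [eta] obeys the same identity. *)
Lemma nrm_sqrt_seqS x n : nrm x <= 1 ->
  nrm (sqrt_seq x n.+1 - sqrt_seq x n) <= eta n.+1 - eta n.
Proof.
move=> x1; elim: n => [|n IH].
  rewrite /= mulr0 addr0 subr0 nrmZ expr0n addr0 subr0 ger0_norm ?invr_ge0 //.
  lra.
have E : sqrt_seq x n.+2 - sqrt_seq x n.+1 = (2^-1)%:C *: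
    ((sqrt_seq x n.+1 + sqrt_seq x n) * (sqrt_seq x n.+1 - sqrt_seq x n)).
  rewrite -[sqrt_seq x n.+2]/((2^-1)%:C *: (x + sqrt_seq x n.+1 * sqrt_seq x n.+1)).
  rewrite -[X in _ - X]/((2^-1)%:C *: (x + sqrt_seq x n * sqrt_seq x n)).
  have c : sqrt_seq x n * sqrt_seq x n.+1 = sqrt_seq x n.+1 * sqrt_seq x n.
    by apply: sqrt_seq_comm; rewrite -sqrt_seq_comm.
  rewrite -scalerBr opprD addrACA subrr add0r mulrDl !mulrBr c.
  by rewrite addrA subrK.
rewrite E nrmZ ger0_norm ?invr_ge0 //.
have := nrmM (sqrt_seq x n.+1 + sqrt_seq x n) (sqrt_seq x n.+1 - sqrt_seq x n).
have := nrmD (sqrt_seq x n.+1) (sqrt_seq x n).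
have := nrm_sqrt_seq n x1; have := nrm_sqrt_seq n.+1 x1.
have := nrm_ge0 (sqrt_seq x n.+1 + sqrt_seq x n); move: IH.
have := nrm_ge0 (sqrt_seq x n.+1 - sqrt_seq x n).
have /andP[] := eta01 n; have /andP[] := eta01 n.+1.
rewrite -[eta n.+2]/((1 + eta n.+1 ^+ 2) / 2).
have -> : (1 + eta n.+1 ^+ 2) / 2 - eta n.+1 =
   2^-1 * ((eta n.+1 + eta n) * (eta n.+1 - eta n)).
  by rewrite /=; field.
set r := nrm ((_ : A) * _); set q := nrm (_ - _); set p := nrm (_ + _).
move: (eta n.+1) (eta n) r q p => a b r q p.
move=> a0 a1 b0 b1 q0 qab p0 na nb pD rM; rewrite ler_pM2l ?invr_gt0 //.
by apply: le_trans rM _; apply: ler_pM => //; lra.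
Qed.

Lemma nrm_sqrt_seqB x m n : nrm x <= 1 -> (n <= m)%N ->
  nrm (sqrt_seq x m - sqrt_seq x n) <= eta m - eta n.
Proof.
move=> x1; elim: m => [|m IH].
  by rewrite leqn0 => /eqP ->; rewrite !subrr nrm0.
rewrite leq_eqVlt ltnS => /orP[/eqP ->|/IH h]; first by rewrite !subrr nrm0.
have := nrm_triangle (sqrt_seq x m.+1) (sqrt_seq x m) (sqrt_seq x n).
have := nrm_sqrt_seqS m x1; lra.
Qed.

Lemma sqrt_exists x : sa x -> nrm x <= 1 ->
  exists y, [/\ sa y, y * y = 1 - x & forall c, c * x = x * c -> c * y = y * c].
Proof.
move=> sx x1; have [|l yl] := @nrm_complete R A (sqrt_seq x).
  move=> e /eta_cauchy[N hN]; exists N => m n Nm Nn.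
  have [mn|nm] := leqP m n.
    by rewrite nrmBC (le_lt_trans (nrm_sqrt_seqB x1 mn)) ?hN.
  by rewrite (le_lt_trans (nrm_sqrt_seqB x1 (ltnW nm))) ?hN.
have {}yl : tends (sqrt_seq x) l by [].
have sl : sa l.
  apply: tends_unique (tends_star yl) _.
  rewrite (_ : (fun n => _) = sqrt_seq x) //; apply/funext => n.
  elim: n => [|n IH] /=; first exact: star0.
  by rewrite starZr starD starM IH sx.
have ll : l = (2^-1)%:C *: (x + l * l).
  apply: tends_unique (tendsS yl) _; apply: tendsZ; apply: tendsD.
    exact: tends_cst.
  exact: tendsM.
exists (1 - l); split.
- exact: saB (sa1 A) sl.
- have {ll} : l + l = x + l * l.
    rewrite {1 2}ll -scalerDl -rmorphD /= (_ : _ + _ = 1) ?scale1r //.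
    lra.
  move=> h; rewrite mulrBl mul1r mulrBr mulr1 opprB addrA.
  by rewrite [X in X - l]addrAC -[LHS]addrA -opprD h opprD addrACA subrr addr0.
- move=> c cx; rewrite mulrBl mulrBr mul1r mulr1; congr (_ - _).
  apply: tends_unique (tendsMl c yl) _.
  rewrite (_ : (fun n => _) = (fun n => sqrt_seq x n * c)); first exact: tendsMr.
  by apply/funext => n; rewrite sqrt_seq_comm.
Qed.

(* Equivalent to being the square of a self-adjoint element ([pos_sqrt] and   *)
(* [pos_sqr]); in this form the positive elements visibly are a convex cone.  *)
Definition pos x := sa x /\ exists t : R, 0 <= t /\ nrm (t%:C%:A - x) <= t.

Lemma nrm_scalar (t : R) : nrm (t%:C%:A : A) = `|t|.
Proof. by rewrite nrmZ nrm1 mulr1. Qed.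

Lemma sa_scalar (t : R) : sa (t%:C%:A : A).
Proof. exact/saZ/sa1. Qed.

Lemma pos0 : pos 0.
Proof. by split; [exact: sa0|exists 0; rewrite lexx subr0 nrm_scalar normr0]. Qed.

Lemma posD x y : pos x -> pos y -> pos (x + y).
Proof.
move=> [sx [t [t0 ht]]] [sy [u [u0 hu]]]; split; first exact: saD.
exists (t + u); split; first exact: addr_ge0.
rewrite rmorphD scalerDl opprD addrACA; apply: le_trans (nrmD _ _) _.
exact: lerD.
Qed.

Lemma posZ (r : R) x : 0 <= r -> pos x -> pos (r%:C *: x).
Proof.
move=> r0 [sx [t [t0 ht]]]; split; first exact: saZ.
exists (r * t); split; first exact: mulr_ge0.
by rewrite rmorphM /= -scalerA -scalerBr nrmZ ger0_norm // ler_wpM2l.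
Qed.

Lemma pos_sum (I : Type) (s : seq I) (P : pred I) (F : I -> A) :
  (forall i, P i -> pos (F i)) -> pos (\sum_(i <- s | P i) F i).
Proof. by move=> h; elim/big_ind: _ => //; [exact: pos0|exact: posD]. Qed.

Lemma pos_scalarB (t : R) x : sa x -> nrm x <= t -> pos (t%:C%:A - x).
Proof.
move=> sx xt; split; first exact: saB (sa_scalar t) sx.
exists t; split; first exact: le_trans (nrm_ge0 _) xt.
by rewrite opprB addrC subrK.
Qed.

(** With [t > 0] the radius provided by [pos x], the element [z = 1 - x / t] is a contraction and
    [x = t (1 - z)], which [sqrt_exists] handles. *)
Lemma pos_sqrt x : pos x ->
  exists y, [/\ sa y, y * y = x & forall c, c * x = x * c -> c * y = y * c].
Proof.
move=> [sx [t [t0 ht]]]; have [t00|tn0] := eqVneq t 0.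
  move: ht; rewrite t00 scale0r sub0r nrmN => x0.
  have /nrm0_eq0 -> : nrm x = 0 by apply/eqP; rewrite eq_le x0 nrm_ge0.
  by exists 0; split; [exact: sa0|rewrite mul0r|move=> c; rewrite mulr0 mul0r].
have tp : 0 < t by rewrite lt0r tn0.
pose z := (t^-1)%:C *: (t%:C%:A - x).
have [||y [sy yy yc]] := @sqrt_exists z.
- exact/saZ/saB/sx/sa_scalar.
- by rewrite nrmZ ger0_norm ?invr_ge0 // mulrC ler_pdivrMr // mul1r.
exists ((Num.sqrt t)%:C *: y); split; first exact: saZ.
- rewrite -scalerAl -scalerAr scalerA -rmorphM /= -expr2 sqr_sqrtr // yy /z.
  rewrite scalerBr [in X in _ - X]scalerA -rmorphM /= mulfV // scale1r.
  by rewrite opprB addrC subrK.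
move=> c cx; rewrite -scalerAr -scalerAl yc // /z.
rewrite -scalerAr -scalerAl mulrBl mulrBr -scalerAl -scalerAr mul1r mulr1.
by rewrite cx.
Qed.

(** After scaling to a contraction [u], [1 - u ^ 2 = z ^ 2] with [z] commuting with [u], and
    [nrm_sqr_le] bounds this by the norm of [z ^ 2 + u ^ 2 = 1]. *)
Lemma pos_sqr y : sa y -> pos (y * y).
Proof.
move=> sy; have sy2 : sa (y * y) by apply: saM.
have step (u : A) : sa u -> nrm u <= 1 -> nrm (1 - u * u) <= 1.
  move=> su u1; have suu : sa (u * u) by apply: saM.
  have [||z [sz zz zc]] := @sqrt_exists (u * u) => //.
    by rewrite nrm_sqr // exprn_ile1 ?nrm_ge0.
  have uz : z * u = u * z by rewrite zc // mulrA.
  rewrite -zz; apply: le_trans (nrm_sqr_le sz su uz) _.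
  by rewrite zz subrK nrm1.
have r0 : 0 < nrm y + 1 by rewrite ltr_wpDl ?nrm_ge0.
set r := nrm y + 1 in r0.
have -> : y * y = (r ^+ 2)%:C *: (((r^-1)%:C *: y) * ((r^-1)%:C *: y)).
  rewrite -scalerAl -scalerAr !scalerA -!rmorphM /=.
  rewrite [X in _ = X%:C *: _](_ : _ = 1) ?scale1r //.
  by field; rewrite gt_eqF.
apply: posZ; first exact: sqr_ge0.
split; first by apply: saM => //; apply: saZ.
exists 1; rewrite ler01 scale1r; split=> //; apply: step; first exact: saZ.
rewrite nrmZ ger0_norm ?invr_ge0 ?(ltW r0) // mulrC ler_pdivrMr // mul1r /r.
by rewrite lerDl.
Qed.

Lemma posM x y : x * y = y * x -> pos x -> pos y -> pos (x * y).
Proof.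
move=> xy /pos_sqrt[u [su uu uc]] /pos_sqrt[v [sv vv vc]].
have uv : u * v = v * u by apply: vc; rewrite -uc.
have -> : x * y = (u * v) * (u * v).
  by rewrite -uu -vv -!mulrA; congr (_ * _); rewrite !mulrA uv.
by apply: pos_sqr; apply: saM.
Qed.

Lemma posX x n : pos x -> pos (x ^+ n).
Proof.
move=> px; elim: n => [|n IH]; last first.
  by rewrite exprS; apply: posM => //; rewrite -exprSr -exprS.
by rewrite expr0 -[1]mulr1; apply/pos_sqr/sa1.
Qed.

(** If [u ^ 2 = t - x] and [v ^ 2 = t + x] with everything commuting, then
    [x ^ 2 + (u v) ^ 2 = t ^ 2], and [nrm_sqr_le] applies. *)
Lemma nrm_le_pos (t : R) x : 0 <= t -> sa x ->
  pos (t%:C%:A - x) -> pos (t%:C%:A + x) -> nrm x <= t.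
Proof.
move=> t0 sx /pos_sqrt[u [su uu uc]] /pos_sqrt[v [sv vv vc]].
have tx (s : R) : s%:C%:A * x = x * s%:C%:A.
  by rewrite -scalerAl -scalerAr mul1r mulr1.
have uv : u * v = v * u.
  apply: vc; rewrite mulrDr mulrDl -scalerAl -scalerAr mul1r mulr1.
  by congr (_ + _); apply/esym/uc; rewrite mulrBl mulrBr tx.
rewrite -ler_sqr ?nnegrE ?nrm_ge0 // -nrm_sqr //.
apply: le_trans (nrm_sqr_le (z := u * v) sx _ _) _.
- exact: saM.
- rewrite mulrA; have -> : x * u = u * x by apply: uc; rewrite mulrBl mulrBr tx.
  by rewrite -!mulrA; congr (_ * _); apply: vc; rewrite mulrDl mulrDr tx.
have -> : x * x + u * v * (u * v) = (t ^+ 2)%:C%:A.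
  rewrite mulrA -[u * v * u]mulrA -uv mulrA uu -mulrA vv mulrBl !mulrDr.
  rewrite -!scalerAl -!scalerAr !mul1r !mulr1 scalerA -rmorphM /= -expr2.
  by rewrite opprD [X in _ + X]addrA addrK addrCA subrr addr0.
by rewrite nrm_scalar ger0_norm ?sqr_ge0.
Qed.

End SquareRoot.

(** * Bernstein polynomials *)

Lemma ffactD n i j : (n ^_ (i + j) = n ^_ j * (n - j) ^_ i)%N.
Proof.
elim: i => [|i IH]; first by rewrite ffactn0 muln1.
by rewrite addSn !ffactnSr IH subnDA subnAC mulnA.
Qed.

Section Bernstein.
Variable R : realType.
Implicit Types (p q : {poly R}) (x : R).

Definition bern n k : {poly R} := 'X^k * (1 - 'X) ^+ (n - k) *+ 'C(n, k).

(* Read at a point of [[0, 1]]: the [j]-th factorial moment of the binomial    *)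
(* distribution.                                                              *)
Lemma bern_ffact n j :
  \sum_(k < n.+1) (k ^_ j)%:R *: bern n k = (n ^_ j)%:R *: 'X^j :> {poly R}.
Proof.
have [jn|nj] := leqP j n; last first.
  rewrite (ffact_small nj) scale0r big1 // => k _.
  by rewrite ffact_small ?scale0r // (leq_ltn_trans _ nj) // -ltnS.
rewrite -(big_mkord xpredT (fun k => (k ^_ j)%:R *: bern n k)) /=.
rewrite (big_cat_nat _ (n := j)) //=; last exact: leqW.
rewrite big_nat_cond big1 ?add0r; last first.
  by move=> k /andP[/andP[_ kj] _]; rewrite ffact_small ?scale0r.
rewrite -{1}[j]add0n big_addn subSn // big_mkord.
have E : (('X + (1 - 'X)) ^+ (n - j) : {poly R}) = 1.
  by rewrite addrC subrK expr1n.
rewrite -[in RHS](mulr1 'X^j) -E addrC exprDn mulr_sumr scaler_sumr.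
apply: eq_bigr => i _; rewrite /bern !scaler_nat mulrnAr -!mulrnA.
rewrite [X in _ *+ X](_ : _ = 'C(n - j, i) * n ^_ j)%N; last first.
  apply/eqP; rewrite -(eqn_pmul2r (fact_gt0 i)) -!mulnA.
  rewrite [(n ^_ j * _)%N]mulnC [X in _ == X]mulnA bin_ffact.
  by have := ffact_fact (leq_addl i j); rewrite addnK => ->; rewrite bin_ffact ffactD mulnC.
by rewrite [(i + j)%N]addnC subnDA exprD -mulrA [(_ * 'X^i)]mulrC.
Qed.

(** By [bern_ffact] the first ratio is the [k]-th coefficient of ['X^j] in the Bernstein basis of
    degree [n]; it approaches the value of the monomial at [k / n] uniformly in [k], because
    [(k - i) / (n - i)] differs from [k / n] by at most [i / (n - i)]. *)
Lemma ffact_ratio j (e : R) : 0 < e -> exists N, forall n k, (N <= n)%N ->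
  (k <= n)%N ->
  `|(k ^_ j)%:R / (n ^_ j)%:R - (k%:R / n%:R) ^+ j| <= e.
Proof.
elim: j e => [|j IH] e e0.
  by exists 0 => n k _ _; rewrite !ffactn0 expr0 divr1 subrr normr0 ltW.
have [N HN] := IH _ (divr_gt0 e0 (ltr0Sn _ 1)).
pose K := (Num.truncn (j%:R * 2 / e)).+1.
exists (maxn N (j + K).+1) => n k; rewrite geq_max => /andP[/HN {}HN jKn] kn.
have {}HN := HN _ kn.
have jn : (j < n)%N by apply: leq_trans jKn; rewrite ltnS leq_addr.
have nj0 : 0 < ((n - j)%:R : R) by rewrite ltr0n subn_gt0.
have n0 : 0 < (n%:R : R) by rewrite ltr0n (leq_ltn_trans _ jn).
rewrite !ffactnSr !natrM exprSr -mulf_div.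
set a := _ / _ in HN *; set a' := _ ^+ j in HN *.
set b := _ / (n - j)%:R; set b' := _ / _.
have b01 : 0 <= b <= 1.
  by rewrite /b divr_ge0 //= ler_pdivrMr // mul1r ler_nat leq_sub2r.
have b'01 : 0 <= b' <= 1.
  by rewrite /b' divr_ge0 //= ler_pdivrMr // mul1r ler_nat.
have a'01 : 0 <= a' <= 1.
  by rewrite /a' exprn_ge0 ?exprn_ile1 //; case/andP: b'01.
have bb : `|b - b'| <= j%:R / (n - j)%:R.
  have [jk|kj] := leqP j k.
    have -> : b - b' = - (j%:R * (n - k)%:R / n%:R / (n - j)%:R).
      by rewrite /b /b' !natrB // ?(ltnW jn) //; field; rewrite -natrB ?(ltnW jn) // !gt_eqF.
    rewrite normrN ger0_norm ?divr_ge0 ?mulr_ge0 // ler_pM2r ?invr_gt0 //.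
    by rewrite ler_pdivrMr // ler_wpM2l // ler_nat leq_subr.
  (* Here the truncated difference [k - j] is zero. *)
  rewrite /b /b' (eqP (ltnW kj)) mul0r sub0r normrN ger0_norm ?divr_ge0 //.
  apply: ler_pM; rewrite ?invr_ge0 // ?ler_nat ?(ltnW kj) //.
  by rewrite lef_pV2 // ler_nat leq_subr.
have je : j%:R / (n - j)%:R <= e / 2.
  rewrite ler_pdivrMr // -ler_pdivrMl ?divr_gt0 // invf_div.
  have : K%:R <= (n - j)%:R :> R by rewrite ler_nat leq_subRL ltnW // ltnW.
  apply: le_trans; rewrite mulrC mulrA; apply: ltW.
  by rewrite /K -natr1; apply: truncnS_gt.
clearbody a a' b b'.
have -> : a * b - a' * b' = (a - a') * b + a' * (b - b') by ring.
apply: le_trans (ler_normD _ _) _; rewrite [leRHS](splitr e) !normrM; apply: lerD.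
  case/andP: b01 => b0 b1; rewrite (ger0_norm b0).
  by rewrite -[leRHS]mulr1; apply: ler_pM.
case/andP: a'01 => b0 b1; rewrite (ger0_norm b0).
by rewrite -[leRHS]mul1r; apply: ler_pM => //; apply: le_trans je.
Qed.

(** Only [x] is confined to the interval; [y] may lie outside. Compactness merges the local moduli
    of continuity into one. *)
Lemma unif_cont (g : R -> R) (a b e : R) : continuous g -> 0 < e ->
  exists2 d, 0 < d & forall x y, a <= x <= b -> `|x - y| < d -> `|g x - g y| < e.
Proof.
move=> cg e0; have /compact_near_coveringP := @segment_compact R a b.
move=> /(_ nat \oo (fun n x => forall y, `|x - y| < n.+1%:R^-1 -> `|g x - g y| < e)).
case.
  move=> x _; have e2 : 0 < e / 2 by rewrite divr_gt0.
  have /cvgrPdist_lt/(_ _ e2)/nbhs_ballP[d /= d0 hd] := cg x.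
  have d2 : 0 < d / 2 by rewrite divr_gt0.
  exists (ball x (d / 2), [set n | n.+1%:R^-1 < d / 2]).
    by split; [exact: nbhsx_ballx|exact: near_infty_natSinv_lt (PosNum d2)].
  move=> [x' n] [/= xx' nd] y xy.
  have h1 : `|g x - g x'| < e / 2.
    by apply: hd; apply: le_ball xx'; lra.
  have h2 : `|g x - g y| < e / 2.
    apply: hd; move: xx'; rewrite /ball /= => xx'.
    rewrite -(subrK x' x) -addrA (le_lt_trans (ler_normD _ _)) //.
    by rewrite [ltRHS](splitr d) ltrD // (lt_trans xy nd).
  rewrite -(subrK (g x) (g x')) -addrA (le_lt_trans (ler_normD _ _)) //.
  by rewrite distrC; lra.
move=> N _ /(_ N (leqnn _)) h; exists N.+1%:R^-1; first by rewrite invr_gt0.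
by move=> x y xab; apply: h; rewrite /= in_itv.
Qed.

End Bernstein.

(** * Uniform approximation by polynomials *)

Section Weierstrass.
Variable R : realType.
Implicit Types (p q : {poly R}) (x : R).

Lemma horner_bern n k x : (bern R n k).[x] = x ^+ k * (1 - x) ^+ (n - k) *+ 'C(n, k).
Proof. by rewrite /bern hornerMn hornerM !horner_exp !hornerE. Qed.

Lemma bern_ge0 n k x : 0 <= x <= 1 -> 0 <= (bern R n k).[x].
Proof.
move=> /andP[x0 x1]; rewrite horner_bern mulrn_wge0 // mulr_ge0 ?exprn_ge0 //.
by rewrite subr_ge0.
Qed.

Lemma sum_bern_ffact n j x :
  \sum_(k < n.+1) (k ^_ j)%:R * (bern R n k).[x] = (n ^_ j)%:R * x ^+ j.
Proof.
have := congr1 (horner^~ x) (bern_ffact R n j).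
rewrite hornerZ hornerXn => <-; rewrite horner_sum.
by apply: eq_bigr => k _; rewrite hornerZ.
Qed.

Lemma sum_bern n x : \sum_(k < n.+1) (bern R n k).[x] = 1.
Proof.
transitivity ((n ^_ 0)%:R * x ^+ 0); last by rewrite ffactn0 expr0 mulr1.
by rewrite -sum_bern_ffact; apply: eq_bigr => k _; rewrite ffactn0 mul1r.
Qed.

Lemma natr_ffact2 n : (n ^_ 2)%:R = n%:R ^+ 2 - n%:R :> R.
Proof.
case: n => [|n]; first by rewrite expr0n subr0.
by rewrite ffactnS ffactn1 natrM /= -natr1; ring.
Qed.

Lemma bern_variance n x : (0 < n)%N ->
  \sum_(k < n.+1) (x - k%:R / n%:R) ^+ 2 * (bern R n k).[x] = x * (1 - x) / n%:R.
Proof.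
move=> n0; have nn : n%:R != 0 :> R by rewrite pnatr_eq0 -lt0n.
have E (k : 'I_n.+1) : (x - k%:R / n%:R) ^+ 2 * (bern R n k).[x] =
    n%:R ^- 2 * ((k ^_ 2)%:R * (bern R n k).[x])
    + (n%:R ^- 2 - 2 * x / n%:R) * ((k ^_ 1)%:R * (bern R n k).[x])
    + x ^+ 2 * ((k ^_ 0)%:R * (bern R n k).[x]).
  by rewrite natr_ffact2 ffactn1 ffactn0; field.
rewrite (eq_bigr _ (fun k _ => E k)) !big_split /= -!mulr_sumr !sum_bern_ffact.
by rewrite natr_ffact2 ffactn1 sum_bern; field.
Qed.

Lemma continuous_bounded (f : R -> R) (r : R) : continuous f -> 0 <= r ->
  exists2 K : R, 0 < K & forall t, `|t| <= r -> `|f t| <= K.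
Proof.
move=> cf r0; have le1 : - r <= r by rewrite ge0_cp.
have [] := @EVT_max R (fun t => `|f t|) _ _ le1.
  by apply: continuous_subspaceT => x; apply: cvg_norm; apply: cf.
move=> c _ hc; exists (`|f c| + 1); first by rewrite ltr_wpDl.
move=> t; rewrite ler_norml => tr; apply: le_trans (hc t _) _; last by rewrite lerDl.
by rewrite in_itv.
Qed.

(** Bernstein's argument: [g x - g y] is at most [e / 2] for close points and at most
    [K (x - y) ^ 2] for distant ones, and the binomial variance [x (1 - x) / n] makes the second
    contribution small. *)
Lemma weierstrass01 (g : R -> R) (e : R) : continuous g -> 0 < e ->
  exists p, forall x, 0 <= x <= 1 -> `|g x - p.[x]| <= e.
Proof.
move=> cg e0; have e2 : 0 < e / 2 by rewrite divr_gt0.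
have [d d0 hd] := unif_cont 0 1 cg e2.
have [c _ hc] : exists2 c : R, c \in `[0, 1]%R & forall t, t \in `[0, 1]%R -> `|g t| <= `|g c|.
  by apply: EVT_max => //; apply: continuous_subspaceT => x; apply: cvg_norm; apply: cg.
pose M : R := `|g c|; have M0 : 0 <= M by exact: normr_ge0.
pose K := 2 * M / d ^+ 2.
have K0 : 0 <= K by apply: divr_ge0; [exact: mulr_ge0|exact: sqr_ge0].
have quad x y : 0 <= x <= 1 -> 0 <= y <= 1 -> `|g x - g y| <= e / 2 + K * (x - y) ^+ 2.
  move=> x01 y01; have [xy|xy] := ltP `|x - y| d.
    rewrite ltW // (lt_le_trans (hd _ _ x01 xy)) // lerDl.
    by rewrite mulr_ge0 ?sqr_ge0.
  apply: le_trans (ler_normB _ _) _; apply: le_trans (_ : 2 * M <= _).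
    by rewrite mulr_natl mulr2n lerD // hc // in_itv.
  apply: le_trans (_ : K * (x - y) ^+ 2 <= _); last by rewrite lerDr ltW.
  rewrite /K mulrAC ler_pdivlMr ?exprn_gt0 // ler_wpM2l ?mulr_ge0 //.
  by rewrite -[leRHS]real_normK ?num_real // ler_sqr ?nnegrE ?(ltW d0).
pose n := (Num.truncn (2 * K / e)).+1.
have n0 : 0 < n%:R :> R by rewrite ltr0n.
exists (\sum_(k < n.+1) g (k%:R / n%:R) *: bern R n k) => x x01.
rewrite horner_sum -[g x]mulr1 -[X in g x * X](sum_bern n x) mulr_sumr -sumrB.
apply: le_trans (ler_norm_sum _ _ _) _.
have hk (k : 'I_n.+1) : 0 <= (k%:R / n%:R : R) <= 1.
  by rewrite divr_ge0 //= ler_pdivrMr // mul1r ler_nat -ltnS.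
apply: le_trans (_ : \sum_(k < n.+1) (e / 2 + K * (x - k%:R / n%:R) ^+ 2) * (bern R n k).[x] <= _).
  apply: ler_sum => k _; rewrite hornerZ -mulrBl normrM.
  rewrite [X in _ * X <= _]ger0_norm ?bern_ge0 //.
  by apply: ler_wpM2r; [exact: bern_ge0|exact: quad (hk k)].
under eq_bigr do rewrite mulrDl -[K * _ * _]mulrA.
rewrite big_split /= -!mulr_sumr bern_variance //.
rewrite sum_bern mulr1 [leRHS](splitr e) lerD2l.
have xx : x * (1 - x) <= 1 by case/andP: x01; nra.
have Ke : K / n%:R <= e / 2.
  have : 2 * K / e < n%:R by exact: truncnS_gt.
  rewrite ltr_pdivrMr // ler_pdivrMr //; move: (n%:R : R) => N; lra.
apply: le_trans Ke; rewrite mulrA ler_pM2r ?invr_gt0 //.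
by rewrite -[leRHS]mulr1 ler_wpM2l.
Qed.

Lemma weierstrass (g : R -> R) (r e : R) : continuous g -> 0 < r -> 0 < e ->
  exists p, forall x, `|x| <= r -> `|g x - p.[x]| <= e.
Proof.
move=> cg r0 e0; have r2 : 0 < 2 * r by rewrite mulr_gt0.
have [|p hp] := @weierstrass01 (fun x => g (2 * r * x - r)) e _ e0.
  move=> x; apply: continuous_comp; last exact: cg.
  apply: cvgB; last exact: cvg_cst.
  by apply: cvgM; [exact: cvg_cst|exact: cvg_id].
exists (p \Po ((2 * r)^-1 *: ('X + r%:P))) => x xr.
rewrite horner_comp hornerZ !hornerE.
have {1}-> : x = 2 * r * ((2 * r)^-1 * (x + r)) - r by field; rewrite gt_eqF.
apply: hp; rewrite ler_norml in xr.
rewrite mulrC divr_ge0 /= ?(ltW r2) ?ler_pdivrMr //; lra.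
Qed.

End Weierstrass.

(** * Functional calculus of a self-adjoint element *)

Section PolyCalculus.
Variables (R : realType) (A : unitalCStarAlg R).
Implicit Types (a c x y : A) (p q : {poly R}).

Definition pev a p : A := horner_alg a (map_poly (real_complex R) p).

HB.instance Definition _ a := GRing.RMorphism.copy (pev a)
  (horner_alg a \o map_poly (real_complex R)).

Lemma pevC a (r : R) : pev a r%:P = r%:C%:A.
Proof. by rewrite /pev map_polyC /= horner_algC. Qed.

Lemma pevX a : pev a 'X = a.
Proof. by rewrite /pev map_polyX horner_algX. Qed.

Lemma pevZ a (r : R) p : pev a (r *: p) = r%:C *: pev a p.
Proof. by rewrite -mul_polyC rmorphM /= pevC -scalerAl mul1r. Qed.

Lemma pev_comp a p q : pev (pev a q) p = pev a (p \Po q).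
Proof.
elim/poly_ind: p => [|p r IH]; first by rewrite comp_poly0 !rmorph0.
by rewrite comp_poly_MXaddC !rmorphD !rmorphM /= IH pevX !pevC.
Qed.

Lemma pev_comm a c p : c * a = a * c -> c * pev a p = pev a p * c.
Proof.
move=> ca; elim/poly_ind: p => [|p r IH]; first by rewrite rmorph0 mulr0 mul0r.
rewrite rmorphD rmorphM /= pevX pevC mulrDl mulrDr -scalerAl -scalerAr mul1r mulr1.
by rewrite mulrA IH -!mulrA ca.
Qed.

Lemma sa_pev a p : sa a -> sa (pev a p).
Proof.
move=> sx; elim/poly_ind: p => [|p r IH]; first by rewrite rmorph0; exact: sa0.
rewrite rmorphD rmorphM /= pevX pevC; apply: saD (sa_scalar _ _).
by apply: saM => //; rewrite (pev_comm _ (erefl (a * a))).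
Qed.

Lemma pos_bern c n k : pos c -> pos (1 - c) -> pos (pev c (bern R n k)).
Proof.
move=> pc pc1; rewrite /bern -scaler_nat pevZ; apply: posZ => //.
rewrite rmorphM !rmorphXn rmorphB rmorph1 /= pevX.
apply: posM; [|exact: posX|exact: posX].
apply/commrX/commr_sym/commrX.
by rewrite /GRing.comm mulrBl mulrBr mul1r mulr1.
Qed.

(** For large [n] the Bernstein coefficients [d k] of [p] are within [e] of the values [p.[k / n]],
    hence bounded by [M + e]. The Bernstein polynomials of [c] are positive and sum to [1], so
    [p(c)] lies between [- (M + e)] and [M + e]. *)
Lemma nrm_pev01 c p (M : R) : pos c -> pos (1 - c) ->
  (forall x : R, 0 <= x <= 1 -> `|p.[x]| <= M) -> nrm (pev c p) <= M.
Proof.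
move=> pc pc1 pM; apply/ler_addgt0Pr => e e0.
pose S := \sum_(j < size p) `|p`_j|.
have S0 : 0 <= S by apply: sumr_ge0.
have S1 : 0 < S + 1 by rewrite ltr_wpDl.
have e'0 : 0 < e / (S + 1) by rewrite divr_gt0.
have [N HN] := choice (fun j => @ffact_ratio R j _ e'0).
pose n := (\max_(j < size p) N j + size p).+1.
have n0 : 0 < n%:R :> R by rewrite ltr0n.
pose d k := \sum_(j < size p) p`_j * ((k ^_ j)%:R / (n ^_ j)%:R).
have pd : p = \sum_(k < n.+1) d k *: bern R n k.
  under eq_bigr do rewrite scaler_suml.
  rewrite exchange_big /= -[LHS]coefK poly_def; apply: eq_bigr => j _.
  have nj : (n ^_ j)%:R != 0 :> R.
    rewrite pnatr_eq0 -lt0n ffact_gt0 (leq_trans (ltnW (ltn_ord j))) //.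
    by rewrite /n leqW ?leq_addl.
  have -> : 'X^j = (n ^_ j)%:R^-1 *: \sum_(k < n.+1) (k ^_ j)%:R *: bern R n k.
    by rewrite bern_ffact scalerA mulVf // scale1r.
  rewrite !scaler_sumr; apply: eq_bigr => k _; rewrite !scalerA.
  by congr (_ *: _); rewrite -mulrA [_^-1 * _]mulrC.
have dM (k : 'I_n.+1) : `|d k| <= M + e.
  have k01 : 0 <= (k%:R / n%:R : R) <= 1.
    by rewrite divr_ge0 //= ler_pdivrMr // mul1r ler_nat -ltnS.
  rewrite -[d k](subrK p.[k%:R / n%:R]) addrC.
  apply: le_trans (ler_normD _ _) _; apply: lerD; first exact: pM.
  rewrite [X in _ - X]horner_coef /d -sumrB.
  apply: le_trans (ler_norm_sum _ _ _) _.
  apply: le_trans (_ : S * (e / (S + 1)) <= _); last first.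
    by rewrite mulrCA -[leRHS]mulr1 ler_wpM2l ?ltW // ltr_pdivrMr // mul1r ltrDl.
  rewrite mulr_suml; apply: ler_sum => j _; rewrite -mulrBr normrM.
  apply: ler_wpM2l => //; apply: HN; last by rewrite -ltnS.
  rewrite /n leqW //; apply: leq_trans (leq_addr _ _).
  exact: (leq_bigmax (F := fun j : 'I_(size p) => N j)).
have M0 : 0 <= M + e by apply: le_trans (dM ord0).
have sc : sa c by case: pc.
have Ee : pev c (\sum_(k < n.+1) bern R n k) = 1.
  have := bern_ffact R n 0.
  under eq_bigr do rewrite ffactn0 scale1r.
  by rewrite ffactn0 scale1r expr0 => ->; rewrite rmorph1.
have Mb : (M + e)%:C%:A = \sum_(k < n.+1) (M + e)%:C *: pev c (bern R n k).
  by rewrite -scaler_sumr; congr (_ *: _); rewrite -[LHS]Ee rmorph_sum.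
have -> : pev c p = \sum_(k < n.+1) (d k)%:C *: pev c (bern R n k).
  by rewrite pd rmorph_sum /=; apply: eq_bigr => k _; rewrite pevZ.
apply: nrm_le_pos => //.
- elim/big_ind: _ => [|x y|k _]; [exact: sa0|exact: saD|].
  exact/saZ/sa_pev.
- rewrite Mb -sumrB; apply: pos_sum => k _; rewrite -scalerBl -rmorphB /=.
  apply: posZ; last exact: pos_bern.
  by have := dM k; rewrite ler_norml subr_ge0 => /andP[].
- rewrite Mb -big_split /=; apply: pos_sum => k _; rewrite -scalerDl -rmorphD /=.
  apply: posZ; last exact: pos_bern.
  by have := dM k; rewrite ler_norml -subr_ge0 opprK addrC => /andP[].
Qed.

Lemma nrm_pev a p (r M : R) : sa a -> 0 < r -> nrm a <= r ->
  (forall x : R, `|x| <= r -> `|p.[x]| <= M) -> nrm (pev a p) <= M.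
Proof.
move=> sx r0 ar pM; have r2 : 0 < 2 * r by rewrite mulr_gt0.
pose s := (2 * r)^-1 *: ('X + r%:P) : {poly R}.
pose t := (2 * r) *: 'X - r%:P : {poly R}.
have ts : t \Po s = 'X.
  rewrite /t /s comp_polyB comp_polyZ comp_polyX comp_polyC scalerA.
  by rewrite mulfV ?gt_eqF // scale1r addrK.
have es : pev a s = ((2 * r)^-1)%:C *: (r%:C%:A + a).
  by rewrite /s pevZ rmorphD /= pevX pevC addrC.
have -> : pev a p = pev (pev a s) (p \Po t).
  by rewrite pev_comp -comp_polyA ts comp_polyXr.
have i0 : 0 <= (2 * r)^-1 by rewrite invr_ge0 ltW.
apply: nrm_pev01.
- rewrite es; apply: posZ => //; rewrite -[a]opprK; apply: pos_scalarB.
    exact: saN.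
  by rewrite nrmN.
- have -> : 1 - pev a s = ((2 * r)^-1)%:C *: (r%:C%:A - a).
    have e1 : 1 = ((2 * r)^-1)%:C *: ((2 * r)%:C *: (1 : A)).
      by rewrite scalerA -rmorphM /= mulVf ?gt_eqF // scale1r.
    rewrite [X in X - _]e1 es -scalerBr; congr (_ *: _).
    by rewrite mulr_natl mulr2n rmorphD scalerDl opprD addrACA subrr add0r.
  by apply: posZ => //; apply: pos_scalarB.
move=> x x01; rewrite horner_comp; apply: pM.
rewrite /t !hornerE ler_norml; nra.
Qed.

End PolyCalculus.

(** * Continuous functions of a self-adjoint element *)

Section FunctionalCalculus.
Variables (R : realType) (A : unitalCStarAlg R).
Implicit Types (a b c d x y : A) (p q : {poly R}) (f g : R -> R).

(** The value [f(a)] is pinned down by all polynomial approximations of [f] on all intervals that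
    contain [[- nrm a, nrm a]]. The radius is kept positive separately, since [nrm a] may be
    zero. *)
Definition fc_spec a f x := forall (r : R), 0 < r -> nrm a <= r ->
  forall p (e : R), (forall t, `|t| <= r -> `|f t - p.[t]| <= e) ->
  nrm (x - pev a p) <= e.

Definition fc a f : A := xget 0 [set x | fc_spec a f x].

Lemma fcP a f : sa a -> continuous f -> fc_spec a f (fc a f).
Proof.
move=> sx cf; suff h : [set x | fc_spec a f x] !=set0.
  by rewrite /fc; case: xgetP => [x _ //|H]; case: h => x /H.
have r0 : 0 < nrm a + 1 by rewrite ltr_wpDl ?nrm_ge0.
have ar : nrm a <= nrm a + 1 by rewrite lerDl.
have inv0 n : 0 < n.+1%:R^-1 :> R by rewrite invr_gt0.
have [P HP] := choice (fun n => weierstrass cf r0 (inv0 n)).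
(* The two polynomials approximate [f] on different intervals; they are compared on the smaller one,
   which still contains [[- nrm a, nrm a]]. *)
have PP (r e : R) p n : 0 < r -> nrm a <= r ->
    (forall t, `|t| <= r -> `|f t - p.[t]| <= e) ->
    nrm (pev a (P n) - pev a p) <= e + n.+1%:R^-1.
  move=> rr ra fp; rewrite -rmorphB.
  apply: (nrm_pev (r := Num.min r (nrm a + 1))) => //.
  - by rewrite lt_min rr.
  - by rewrite le_min ra.
  move=> t; rewrite le_min => /andP[tr ta]; rewrite !hornerE.
  rewrite -[X in `|X|](subrKA (f t)) addrC.
  apply: le_trans (ler_normD _ _) _; apply: lerD; first exact: fp.
  by rewrite distrC; apply: HP.
have H (e : R) k : 0 < e -> (Num.truncn (2 / e) <= k)%N -> k.+1%:R^-1 < e / 2.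
  move=> e0 Nk; rewrite -[e / 2]invrK ltf_pV2 ?posrE ?invr_gt0 ?divr_gt0 //.
  by rewrite invf_div; apply: lt_le_trans (truncnS_gt _) _; rewrite ler_nat ltnS.
have [|x xP] := @nrm_complete R A (fun n => pev a (P n)).
  move=> e e0; exists (Num.truncn (2 / e)) => m n Nm Nn.
  apply: le_lt_trans (PP _ _ _ _ r0 ar (HP n)) _.
  by rewrite [ltRHS](splitr e) ltrD ?H.
exists x => r rr ra p e fp; apply/ler_addgt0Pr => d d0.
have d2 : 0 < d / 2 by rewrite divr_gt0.
have [N HN] := xP _ d2.
pose k := maxn N (Num.truncn (2 / d)).
apply: le_trans (nrm_triangle _ (pev a (P k)) _) _.
rewrite (splitr d) addrA addrC; have := PP _ _ _ k rr ra fp.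
have := HN k (leq_maxl _ _); have := H d k d0 (leq_maxr _ _); rewrite nrmBC.
move: (nrm _) (nrm _) (k.+1%:R^-1) => u v w; lra.
Qed.

Section OneElement.
Variables (a : A) (saa : sa a).

Lemma fc_approx f (r e : R) : continuous f -> 0 < r -> nrm a <= r -> 0 < e ->
  exists2 p, (forall t, `|t| <= r -> `|f t - p.[t]| <= e)
           & nrm (fc a f - pev a p) <= e.
Proof.
move=> cf r0 ar e0; have [p hp] := weierstrass cf r0 e0.
by exists p => //; apply: fcP hp.
Qed.

Lemma fc_unique f x : continuous f ->
  (forall e : R, 0 < e -> exists p, exists r : R, [/\ 0 < r, nrm a <= r,
     forall t, `|t| <= r -> `|f t - p.[t]| <= e & nrm (x - pev a p) <= e]) ->
  x = fc a f.
Proof.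
move=> cf h; apply/eqP; rewrite -subr_eq0; apply/eqP/nrm_small_eq0 => e e0.
have e2 : 0 < e / 2 by rewrite divr_gt0.
have [p [r [r0 ar fp xp]]] := h _ e2.
apply: le_trans (nrm_triangle _ (pev a p) _) _; rewrite (splitr e) lerD //.
by rewrite nrmBC; apply: fcP fp.
Qed.

Lemma nrm_fc f (r M : R) : continuous f -> 0 < r -> nrm a <= r ->
  (forall t, `|t| <= r -> `|f t| <= M) -> nrm (fc a f) <= M.
Proof.
move=> cf r0 ar fM; rewrite -[fc a f]subr0 -(rmorph0 (pev a)).
by apply: fcP ar _ _ _ => // t tr; rewrite horner0 subr0 fM.
Qed.

Let r0 : 0 < nrm a + 1. Proof. by rewrite ltr_wpDl ?nrm_ge0. Qed.
Let ar : nrm a <= nrm a + 1. Proof. by rewrite lerDl. Qed.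

Lemma fc_pev p : fc a (horner p) = pev a p.
Proof.
apply/esym/fc_unique; first exact: continuous_horner.
move=> e e0; exists p, (nrm a + 1); split=> // [t _|]; rewrite subrr ?normr0 ?nrm0 ltW //.
Qed.

Lemma fcC (z : R) : fc a (fun=> z) = z%:C%:A.
Proof.
rewrite -(pevC a) -fc_pev; congr (fc a _); apply/funext => t.
by rewrite hornerC.
Qed.

Lemma fcX : fc a id = a.
Proof.
rewrite -[RHS](pevX a) -fc_pev; congr (fc a _); apply/funext => t.
by rewrite hornerX.
Qed.

Lemma fcD f g : continuous f -> continuous g ->
  fc a (fun t => f t + g t) = fc a f + fc a g.
Proof.
move=> cf cg; apply/esym/fc_unique; first by move=> t; apply: cvgD; [exact: cf|exact: cg].
move=> e e0; have e2 : 0 < e / 2 by rewrite divr_gt0.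
have [p fp ap] := fc_approx cf r0 ar e2.
have [q gq aq] := fc_approx cg r0 ar e2.
exists (p + q), (nrm a + 1); split=> // [t tr|].
  rewrite hornerD opprD addrACA (le_trans (ler_normD _ _)) // [leRHS](splitr e).
  by rewrite lerD ?fp ?gq.
rewrite rmorphD opprD addrACA (le_trans (nrmD _ _)) // [leRHS](splitr e).
by rewrite lerD.
Qed.

Lemma fcM f g : continuous f -> continuous g ->
  fc a (fun t => f t * g t) = fc a f * fc a g.
Proof.
move=> cf cg; apply/esym/fc_unique; first by move=> t; apply: cvgM; [exact: cf|exact: cg].
move=> e e0.
have [K K0 fK] := continuous_bounded cf (ltW r0).
have [L L0 gL] := continuous_bounded cg (ltW r0).
pose D := K + L + 1; have D0 : 0 < D by rewrite /D; lra.
pose u := Num.min 1 (e / D).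
have u0 : 0 < u by rewrite lt_min ltr01 divr_gt0.
have u1 : u <= 1 by rewrite ge_min lexx.
have uD : u * D <= e by rewrite -ler_pdivlMr // ge_min lexx orbT.
have [p fp ap] := fc_approx cf r0 ar u0.
have [q gq aq] := fc_approx cg r0 ar u0.
have nf : nrm (fc a f) <= K by apply: nrm_fc ar _.
have nq : nrm (pev a q) <= L + u.
  have := nrm_triangle (pev a q) (fc a g) 0; rewrite !subr0 nrmBC.
  have : nrm (fc a g) <= L by apply: nrm_fc ar _.
  move: aq; lra.
have fin : K * u + u * (L + u) <= e.
  apply: le_trans uD; rewrite /D; move: u0 u1 K0 L0; nra.
exists (p * q), (nrm a + 1); split=> // [t tr|].
  have -> : f t * g t - (p * q).[t] = f t * (g t - q.[t]) + (f t - p.[t]) * q.[t].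
    by rewrite hornerM; ring.
  apply: le_trans fin; rewrite (le_trans (ler_normD _ _)) // !normrM lerD //.
    by rewrite ler_pM ?fK ?gq.
  rewrite ler_pM ?fp // -[q.[t]](subrK (g t)) addrC (le_trans (ler_normD _ _)) //.
  by rewrite lerD ?gL // distrC gq.
rewrite rmorphM /=.
have -> : fc a f * fc a g - pev a p * pev a q =
    fc a f * (fc a g - pev a q) + (fc a f - pev a p) * pev a q.
  by rewrite mulrBr mulrBl addrA subrK.
apply: le_trans fin; rewrite (le_trans (nrmD _ _)) // lerD //.
  by rewrite (le_trans (nrmM _ _)) // ler_pM ?nrm_ge0.
by rewrite (le_trans (nrmM _ _)) // ler_pM ?nrm_ge0.
Qed.

Lemma fcZ (z : R) f : continuous f -> fc a (fun t => z * f t) = z%:C *: fc a f.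
Proof.
move=> cf; rewrite fcM //; last by move=> ?; exact: cvg_cst.
by rewrite fcC -scalerAl mul1r.
Qed.

Lemma fcN f : continuous f -> fc a (fun t => - f t) = - fc a f.
Proof.
move=> cf; rewrite -scaleN1r -(rmorph1 (real_complex R)) -rmorphN /= -fcZ //.
by congr fc; apply/funext => t; rewrite mulN1r.
Qed.

Lemma fcB f g : continuous f -> continuous g ->
  fc a (fun t => f t - g t) = fc a f - fc a g.
Proof.
by move=> cf cg; rewrite fcD ?fcN // => t; apply: cvgN; exact: cg.
Qed.

Lemma eq_fc f g (r : R) : continuous f -> continuous g -> 0 < r -> nrm a <= r ->
  (forall t, `|t| <= r -> f t = g t) -> fc a f = fc a g.
Proof.
move=> cf cg rr ra fg; apply/eqP; rewrite -subr_eq0 -fcB //; apply/eqP/nrm0_eq0/eqP.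
rewrite eq_le nrm_ge0 andbT; apply: nrm_fc ra _ => //.
  by move=> t; apply: cvgB; [exact: cf|exact: cg].
by move=> t /fg ->; rewrite subrr normr0.
Qed.

Lemma fc_comm c f : continuous f -> c * a = a * c -> c * fc a f = fc a f * c.
Proof.
move=> cf ca; apply/eqP; rewrite -subr_eq0; apply/eqP/nrm_small_eq0 => e e0.
have D0 : 0 < 2 * nrm c + 1 by have := nrm_ge0 c; lra.
have [p fp ap] := fc_approx cf r0 ar (divr_gt0 e0 D0).
have -> : c * fc a f - fc a f * c =
    c * (fc a f - pev a p) - (fc a f - pev a p) * c.
  by rewrite mulrBr mulrBl (pev_comm _ ca) opprB addrA subrK.
apply: le_trans (nrmB _ _) _.
have := nrmM c (fc a f - pev a p); have := nrmM (fc a f - pev a p) c.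
move: ap; rewrite ler_pdivlMr //.
have := nrm_ge0 (fc a f - pev a p); have := nrm_ge0 c; nra.
Qed.

Lemma fc_sa f : continuous f -> sa (fc a f).
Proof.
move=> cf; apply: fc_unique => // e e0.
have [p fp ap] := fc_approx cf r0 ar e0.
exists p, (nrm a + 1); split=> //.
by rewrite -[pev a p](sa_pev _ saa) -starB nrm_star.
Qed.

(** A polynomial in [a] acts on [v] through its constant term alone. *)
Lemma fc_ann f v : continuous f -> a * v = 0 -> fc a f * v = (f 0)%:C *: v.
Proof.
move=> cf av; apply/eqP; rewrite -subr_eq0; apply/eqP/nrm_small_eq0 => e e0.
have D0 : 0 < 2 * nrm v + 1 by have := nrm_ge0 v; lra.
have [p fp ap] := fc_approx cf r0 ar (divr_gt0 e0 D0).
have pv : pev a p * v = (p.[0])%:C *: v.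
  elim/poly_ind: (p) => [|q z _]; first by rewrite rmorph0 mul0r horner0 scale0r.
  rewrite rmorphD rmorphM /= pevX pevC mulrDl -mulrA av mulr0 add0r.
  by rewrite -scalerAl mul1r !hornerE.
have -> : fc a f * v - (f 0)%:C *: v = (fc a f - pev a p) * v - (f 0 - p.[0])%:C *: v.
  by rewrite mulrBl pv rmorphB scalerBl opprB addrA subrK.
apply: le_trans (nrmB _ _) _; rewrite nrmZ.
have := nrmM (fc a f - pev a p) v.
have := fp 0; rewrite normr0 ler_pdivlMr // => /(_ (ltW r0)).
move: ap; rewrite ler_pdivlMr //.
have := nrm_ge0 (fc a f - pev a p); have := nrm_ge0 v; nra.
Qed.

End OneElement.
End FunctionalCalculus.

Section CalculusTheory.
Variables (R : realType) (A : unitalCStarAlg R).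
Implicit Types (a b c d e x y v : A) (p q : {poly R}) (f g : R -> R).

Lemma fc_comp a f g : sa a -> continuous f -> continuous g ->
  fc (fc a f) g = fc a (g \o f).
Proof.
move=> sx cf cg.
have cgf : continuous (g \o f) by move=> t; apply: continuous_comp; [exact: cf|exact: cg].
have r0 : 0 < nrm a + 1 by rewrite ltr_wpDl ?nrm_ge0.
have ar : nrm a <= nrm a + 1 by rewrite lerDl.
have sf := fc_sa sx cf.
have [K K0 fK] := continuous_bounded cf (ltW r0).
have nK : nrm (fc a f) <= K by apply: nrm_fc ar _.
have pf p : pev (fc a f) p = fc a (fun t => p.[f t]).
  elim/poly_ind: p => [|p z IH].
    rewrite rmorph0 -[RHS](_ : fc a (fun=> 0) = _); first by rewrite fcC // scale0r.
    by congr (fc a _); apply/funext => t; rewrite horner0.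
  have cp : continuous (fun t => p.[f t]).
    by move=> t; apply: (continuous_comp (cf t)); exact: continuous_horner.
  rewrite rmorphD rmorphM /= pevX pevC IH -fcM // -(fcC sx) -fcD //.
  - by congr (fc a _); apply/funext => t; rewrite !hornerE.
  - by move=> t; apply: cvgM; [exact: cp|exact: cf].
  - by move=> t; exact: cvg_cst.
apply/esym; apply: fc_unique => // e e0.
have [p gp gq] := fc_approx sf cg K0 nK e0.
exists p, K; split=> //; rewrite pf -fcB //; last first.
  by move=> t; apply: (continuous_comp (cf t)); exact: continuous_horner.
apply: nrm_fc ar _ => //; last by move=> t tr; apply/gp/fK.
move=> t; apply: cvgB; first exact: cgf.
by apply: (continuous_comp (cf t)); exact: continuous_horner.
Qed.

Lemma fc_annr a f v : sa a -> continuous f -> v * a = 0 -> v * fc a f = (f 0)%:C *: v.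
Proof.
move=> sx cf va; rewrite -[LHS]starK starM (fc_sa sx cf) fc_ann //.
  by rewrite starZr starK.
by rewrite -{1}sx -starM va star0.
Qed.

(** Mixed products of [d] and [e] vanish, so polynomials without constant term are additive; the
    constant term, counted twice by the sum, is removed once. *)
Lemma fc_orth d e f : sa d -> sa e -> d * e = 0 -> continuous f ->
  fc (d + e) f = fc d f + fc e f - (f 0)%:C%:A.
Proof.
move=> sd se de cf; have ed : e * d = 0 by rewrite -[LHS]starK starM sd se de star0.
have E p : pev (d + e) p = pev d p + pev e p - (p.[0])%:C%:A.
  have pe x y q : x * y = 0 -> pev x q * y = (q.[0])%:C *: y.
    move=> xy; elim/poly_ind: q => [|q z _]; first by rewrite rmorph0 mul0r horner0 scale0r.
    rewrite rmorphD rmorphM /= pevX pevC mulrDl -mulrA xy mulr0 add0r.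
    by rewrite -scalerAl mul1r !hornerE.
  elim/poly_ind: p => [|p z IH]; first by rewrite !rmorph0 horner0 scale0r subr0 addr0.
  pose s0 := (p.[0])%:C.
  have H : (pev d p + pev e p - s0%:A) * (d + e) =
      pev d p * d + s0 *: d + (s0 *: e + pev e p * e) - (s0 *: d + s0 *: e).
    by rewrite mulrBl mulrDr !mulrDl (pe e d) // (pe d e) // -scalerAl mul1r scalerDr.
  rewrite !rmorphD !rmorphM /= !pevX !pevC IH H hornerMXaddC mulr0 add0r.
  have aux (u P Q w s : A) : u + P + (Q + w) - (P + Q) + s = u + s + (w + s) - s.
    by rewrite [Q + w]addrC addrACA addrK [u + s + (w + s)]addrA addrK addrAC.
  exact: aux.
have s2 : sa (d + e) by exact: saD.
apply/esym; apply: fc_unique => // eps e0.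
pose r := Num.max (nrm (d + e)) (Num.max (nrm d) (nrm e)) + 1.
have [h1 [h2 h3]] : [/\ nrm (d + e) <= r, nrm d <= r & nrm e <= r].
  by rewrite /r; split; rewrite ler_wpDr // !le_max lexx ?orbT.
have r0 : 0 < r by rewrite ltr_wpDl // !le_max nrm_ge0.
have e3 : 0 < eps / 3 by rewrite divr_gt0.
have [p fp] := weierstrass cf r0 e3.
exists p, r; split=> //.
  by move=> t /fp/le_trans; apply; rewrite ler_pdivrMr // ler_peMr ?(ltW e0) // ler1n.
rewrite E; have -> : fc d f + fc e f - (f 0)%:C%:A - (pev d p + pev e p - (p.[0])%:C%:A)
    = (fc d f - pev d p) + (fc e f - pev e p) - (f 0 - p.[0])%:C%:A.
  have aux (x y s u w t : A) : x + y - s - (u + w - t) = (x - u) + (y - w) - (s - t).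
    by rewrite [in RHS]addrACA -opprD !opprB addrACA [RHS]addrACA [- s - _]addrC.
  by rewrite rmorphB scalerBl; exact: aux.
have n1 : nrm (fc d f - pev d p) <= eps / 3 by apply: (fcP sd cf r0).
have n2 : nrm (fc e f - pev e p) <= eps / 3 by apply: (fcP se cf r0).
have n3 : nrm ((f 0 - p.[0])%:C%:A : A) <= eps / 3.
  by rewrite nrm_scalar fp // normr0 ltW.
have := nrmB (fc d f - pev d p + (fc e f - pev e p)) (f 0 - p.[0])%:C%:A.
have := nrmD (fc d f - pev d p) (fc e f - pev e p).
lra.
Qed.

Lemma pev_lip p (r : R) : exists2 C : R, 0 <= C & forall a b, nrm a <= r -> nrm b <= r ->
  nrm (pev a p) <= C /\ nrm (pev a p - pev b p) <= C * nrm (a - b).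
Proof.
elim/poly_ind: p => [|p z [C C0 IH]].
  exists 0 => // a b _ _; rewrite !rmorph0 subr0 nrm0 mul0r; by split.
exists (C * `|r| + `|z| + C * `|r| + C); first by rewrite !addr_ge0 ?mulr_ge0.
move=> a b na nb; have [h1 h2] := IH a b na nb; have [h3 _] := IH b a nb na.
have r1 := ler_norm r; have z0 := normr_ge0 z; have a0 := nrm_ge0 a.
rewrite !rmorphD !rmorphM /= !pevX !pevC; split.
  have := nrmD (pev a p * a) z%:C%:A; rewrite nrm_scalar.
  have := nrmM (pev a p) a; have := nrm_ge0 (pev a p); nra.
rewrite opprD addrACA subrr addr0.
have -> : pev a p * a - pev b p * b = (pev a p - pev b p) * a + pev b p * (a - b).
  by rewrite mulrBl mulrBr addrA subrK.
have := nrmD ((pev a p - pev b p) * a) (pev b p * (a - b)).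
have := nrmM (pev a p - pev b p) a; have := nrmM (pev b p) (a - b).
have u0 := nrm_ge0 (a - b).
have sk : nrm (pev a p - pev b p) * nrm a <= C * nrm (a - b) * `|r|.
  by apply: ler_pM; rewrite ?nrm_ge0 // (le_trans na).
have lu : nrm (pev b p) * nrm (a - b) <= C * nrm (a - b) by apply: ler_wpM2r.
have zu : 0 <= `|z| * nrm (a - b) by apply: mulr_ge0.
have cru : 0 <= C * nrm (a - b) * `|r| by rewrite !mulr_ge0.
lra.
Qed.

(** One polynomial approximates [f] for all [b] within distance one of [a], and polynomials are
    Lipschitz on norm balls by [pev_lip]. *)
Lemma fc_cont a f (e : R) : sa a -> continuous f -> 0 < e ->
  exists2 d : R, 0 < d & forall b, sa b -> nrm (b - a) < d -> nrm (fc b f - fc a f) < e.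
Proof.
move=> sx cf e0; have e4 : 0 < e / 4 by rewrite divr_gt0.
have r0 : 0 < nrm a + 1 by rewrite ltr_wpDl ?nrm_ge0.
have ar : nrm a <= nrm a + 1 by rewrite lerDl.
have [p fp] := weierstrass cf r0 e4.
have [C C0 hC] := pev_lip p (nrm a + 1).
have C1 : 0 < C + 1 by rewrite ltr_wpDl.
exists (Num.min 1 (e / 4 / (C + 1))); first by rewrite lt_min ltr01 divr_gt0.
move=> b sb; rewrite lt_min => /andP[b1 bd].
have br : nrm b <= nrm a + 1.
  have := nrm_triangle b a 0; rewrite !subr0; lra.
have [_ hb] := hC b a br ar.
have h1 : nrm (fc b f - pev b p) <= e / 4 by apply: fcP br _ _ _.
have h2 : nrm (fc a f - pev a p) <= e / 4 by apply: fcP ar _ _ _.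
have h3 := nrm_triangle (fc b f) (pev b p) (fc a f).
have h4 := nrm_triangle (pev b p) (pev a p) (fc a f).
move: bd; rewrite ltr_pdivlMr // => bd; have := nrm_ge0 (b - a).
rewrite nrmBC in h2; nra.
Qed.

Lemma fc_pos a f (r : R) : sa a -> continuous f -> 0 < r -> nrm a <= r ->
  (forall t, `|t| <= r -> 0 <= f t) -> pos (fc a f).
Proof.
move=> sx cf r0 ar f0.
have cs : continuous (fun t => Num.sqrt (f t)).
  by move=> t; apply: (continuous_comp (cf t)); exact: sqrt_continuous.
have -> : fc a f = fc a (fun t => Num.sqrt (f t)) * fc a (fun t => Num.sqrt (f t)).
  rewrite -fcM //; apply: eq_fc ar _ => //.
    by move=> t; apply: cvgM; exact: cs.
  by move=> t tr; rewrite -expr2 sqr_sqrtr // f0.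
by apply: pos_sqr; exact: fc_sa.
Qed.

End CalculusTheory.

(** * Positive functionals *)

Section Clamp.
Variable R : realType.
Implicit Types (f g : R -> R) (t x : R).

Lemma cont_id : continuous (fun x : R => x). Proof. by move=> x; exact: cvg_id. Qed.
Lemma cont_cst (z : R) : continuous (fun _ : R => z).
Proof. by move=> x; exact: cvg_cst. Qed.
Lemma contD f g : continuous f -> continuous g -> continuous (fun x => f x + g x).
Proof. by move=> cf cg x; apply: cvgD; [exact: cf|exact: cg]. Qed.
Lemma contN f : continuous f -> continuous (fun x => - f x).
Proof. by move=> cf x; apply: cvgN; exact: cf. Qed.
Lemma contB f g : continuous f -> continuous g -> continuous (fun x => f x - g x).
Proof. by move=> cf cg; apply: contD => //; exact: contN. Qed.
Lemma contM f g : continuous f -> continuous g -> continuous (fun x => f x * g x).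
Proof. by move=> cf cg x; apply: cvgM; [exact: cf|exact: cg]. Qed.
Lemma cont_comp f g : continuous f -> continuous g -> continuous (fun x => g (f x)).
Proof. by move=> cf cg x; apply: continuous_comp; [exact: cf|exact: cg]. Qed.
Lemma cont_norm f : continuous f -> continuous (fun x => `|f x|).
Proof. by move=> cf x; apply: cvg_norm; exact: cf. Qed.
Lemma cont_max f g : continuous f -> continuous g ->
  continuous (fun x => Num.max (f x) (g x)).
Proof. by move=> cf cg x; apply: continuous_max; [exact: cf|exact: cg]. Qed.
Lemma cont_min f g : continuous f -> continuous g ->
  continuous (fun x => Num.min (f x) (g x)).
Proof. by move=> cf cg x; apply: continuous_min; [exact: cf|exact: cg]. Qed.
Lemma cont_sqrt f : continuous f -> continuous (fun x => Num.sqrt (f x)).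
Proof. by move=> cf; apply: cont_comp => //; exact: sqrt_continuous. Qed.

Definition clamp x : R := Num.max 0 (Num.min 1 x).

Lemma cont_clamp f : continuous f -> continuous (fun x => clamp (f x)).
Proof.
move=> cf; apply: cont_comp => //; apply: cont_max; first exact: cont_cst.
by apply: cont_min; [exact: cont_cst|exact: cont_id].
Qed.

Lemma clamp_ge0 x : 0 <= clamp x. Proof. by rewrite le_max lexx. Qed.
Lemma clamp_le1 x : clamp x <= 1. Proof. by rewrite ge_max ler01 ge_min lexx. Qed.
Lemma clamp_eq1 x : 1 <= x -> clamp x = 1.
Proof. by move=> x1; rewrite /clamp min_l // max_r. Qed.
Lemma clamp_eq0 x : x <= 0 -> clamp x = 0.
Proof. by move=> x0; rewrite /clamp max_l // ge_min x0 orbT. Qed.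
Lemma clamp_norm x : `|clamp x| <= 1.
Proof. by rewrite ger0_norm ?clamp_ge0 ?clamp_le1. Qed.

(** For [N > 0], a trapezoid equal to [1] up to distance [1 / N] from [t] and to [0] from distance
    [2 / N] on. Doubling [N] therefore gives a function supported where the previous one is [1],
    which is [plateauM]. *)
Definition plateau t (N : R) x := clamp (2 - N * `|x - t|).

Lemma cont_plateau t N : continuous (plateau t N).
Proof.
apply: cont_clamp; apply: contB; first exact: cont_cst.
apply: contM; first exact: cont_cst.
by apply: cont_norm; apply: contB; [exact: cont_id|exact: cont_cst].
Qed.

Lemma plateauM t N x : 0 <= N -> plateau t N x * plateau t (2 * N) x = plateau t (2 * N) x.
Proof.
move=> N0; have [h|h] := leP (2 * N * `|x - t|) 2.
  by rewrite [plateau t N x]clamp_eq1 ?mul1r // ; move: h; rewrite -mulrA; lra.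
by rewrite [plateau t (2 * N) x]clamp_eq0 ?mulr0 // subr_le0 ltW.
Qed.

End Clamp.

Section PositiveFunctional.
Variables (R : realType) (A : unitalCStarAlg R).
Variables (phi : {scalar A}) (phi_pos : positive_functional phi).
Implicit Types (a b x y : A) (f g : R -> R).

Definition refun x : R := complex.Re (phi x).
Local Notation rphi := refun.

Lemma rphiD x y : rphi (x + y) = rphi x + rphi y.
Proof. by rewrite /refun !raddfD. Qed.

Lemma rphiN x : rphi (- x) = - rphi x.
Proof. by rewrite /refun !raddfN. Qed.

Lemma rphiB x y : rphi (x - y) = rphi x - rphi y.
Proof. by rewrite rphiD rphiN. Qed.

Lemma rphiZ (r : R) x : rphi (r%:C *: x) = r * rphi x.
Proof. by rewrite /refun linearZ /=; case: (phi x) => u v; simpc. Qed.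

Lemma rphi_cstar_ge0 x : 0 <= rphi (star x * x).
Proof.
have : 0 <= phi (star x * x) by apply: phi_pos; exists x.
by rewrite lecE => /andP[].
Qed.

Lemma phi_cstar x : phi (star x * x) = (rphi (star x * x))%:C.
Proof.
have : 0 <= phi (star x * x) by apply: phi_pos; exists x.
by move=> h; rewrite /refun RRe_real // ger0_real.
Qed.

Lemma phi_pos_elt x : pos x -> 0 <= rphi x /\ phi x = (rphi x)%:C.
Proof.
move=> /pos_sqrt[y [sy <- _]]; have -> : y * y = star y * y by rewrite sy.
by split; [exact: rphi_cstar_ge0|exact: phi_cstar].
Qed.

Lemma rphi_pos x : pos x -> 0 <= rphi x. Proof. by case/phi_pos_elt. Qed.

(** Positivity only speaks of elements [star b * b]; a self-adjoint [x] is the difference of the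
    positive elements [nrm x + x] and [nrm x]. *)
Lemma phi_sa x : sa x -> phi x = (rphi x)%:C.
Proof.
move=> sx; have p1 : pos ((nrm x)%:C%:A + x : A).
  by rewrite -[x in _ + x]opprK; apply: pos_scalarB; [exact: saN|rewrite nrmN].
have p2 : pos ((nrm x)%:C%:A : A).
  rewrite -[_%:A]subr0; apply: pos_scalarB; first exact: sa0.
  by rewrite nrm0 nrm_ge0.
case: (phi_pos_elt p1) => _; case: (phi_pos_elt p2) => _ e2.
by rewrite rphiD rmorphD /= linearD e2 => /addrI.
Qed.

Lemma phi_star x : phi (star x) = Num.conj (phi x).
Proof.
pose u := x + star x; pose v := 'i *: (star x - x).
have su : sa u by rewrite /sa starD starK addrC.
have sv : sa v by rewrite /sa starZ starB starK conjCi scaleNr -scalerN opprB.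
have iv : 'i *: v = x - star x.
  by rewrite /v scalerA -expr2 sqrCi scaleN1r opprB.
have ex : x + x = u + 'i *: v by rewrite iv /u addrACA subrr addr0.
have es : star x + star x = u - 'i *: v.
  by rewrite iv /u opprB [RHS]addrC addrA subrK.
have e2 : phi x + phi x = phi u + 'i * phi v by rewrite -linearD ex linearD linearZ.
have : phi (star x) + phi (star x) = Num.conj (phi x + phi x).
  rewrite e2 -linearD es linearB linearZ /= rmorphD rmorphM /= conjCi mulNr.
  by rewrite !phi_sa // !conj_Creal //; apply/complex_realP; eexists.
rewrite rmorphD -!mulr2n => /eqP; rewrite eqrMn2r //.
by move/eqP.
Qed.

Lemma rphi_star x : rphi (star x) = rphi x.
Proof. by rewrite /refun phi_star; case: (phi x). Qed.

Lemma rphi_le_nrm x (t : R) : sa x -> nrm x <= t -> `|rphi x| <= t * rphi 1.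
Proof.
move=> sx xt; rewrite ler_norml -subr_ge0 -[X in _ && X]subr_ge0 opprK addrC.
rewrite -rphiZ -rphiD -rphiB !rphi_pos //; first exact: pos_scalarB.
rewrite -[x]opprK; apply: pos_scalarB; [exact: saN|by rewrite nrmN].
Qed.

Lemma rphi_fc_le a f g (r : R) : sa a -> continuous f -> continuous g -> 0 < r -> nrm a <= r ->
  (forall t, `|t| <= r -> f t <= g t) -> rphi (fc a f) <= rphi (fc a g).
Proof.
move=> sx cf cg r0 ar fg; rewrite -subr_ge0 -rphiB -fcB //; apply: rphi_pos.
by apply: fc_pos ar _ => //; [exact: contB|move=> t /fg; rewrite subr_ge0].
Qed.

End PositiveFunctional.

(** * Splitting a functional in a hereditary subalgebra *)

Section Parts.
Variables (R : realType) (A : unitalCStarAlg R).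
Implicit Types (e h w x y v : A) (f g : R -> R).

(** Membership in the part of the algebra on which [e] acts as a unit. For a bump [e] this is a
    convenient substitute for the hereditary subalgebra it generates. *)
Definition her e x := e * x = x /\ x * e = x.

Definition ppart x := fc x (fun t => Num.max 0 t).
Definition npart x := fc x (fun t => Num.max 0 (- t)).

Lemma cont_pos : continuous (fun t : R => Num.max 0 t).
Proof. by apply: cont_max; [exact: cont_cst|exact: cont_id]. Qed.

Lemma cont_neg : continuous (fun t : R => Num.max 0 (- t)).
Proof. by apply: cont_max; [exact: cont_cst|apply: contN; exact: cont_id]. Qed.

Lemma sa_pos x : pos x -> sa x. Proof. by case. Qed.

Lemma fc_pos_ext x f g : pos x -> continuous f -> continuous g ->
  (forall t, 0 <= t -> f t = g t) -> fc x f = fc x g.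
Proof.
move=> /pos_sqrt[u [su <- _]] cf cg fg.
have <- : fc u (fun t => t * t) = u * u.
  by rewrite (fcM su) ?fcX //; exact: cont_id.
have cs : continuous (fun t : R => t * t) by apply: contM; exact: cont_id.
rewrite !fc_comp //; congr fc; apply/funext => t /=.
by apply: fg; rewrite -expr2 sqr_ge0.
Qed.

Lemma fc_opp x f : sa x -> continuous f -> fc (- x) f = fc x (fun t => f (- t)).
Proof.
move=> sx cf; have -> : - x = fc x (fun t => - t).
  by rewrite (fcN sx) ?fcX //; exact: cont_id.
by rewrite fc_comp //; apply: contN; exact: cont_id.
Qed.

(** By [fc_orth] the calculus of [x - y] is computed on [x] and on [- y] separately, where the two
    parts are the identity or zero. *)
Lemma parts_orth x y : pos x -> pos y -> x * y = 0 ->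
  ppart (x - y) = x /\ npart (x - y) = y.
Proof.
move=> px py xy; have [sx sy] := (sa_pos px, sa_pos py).
have xy' : x * - y = 0 by rewrite mulrN xy oppr0.
have sy' := saN sy.
have c0 := @cont_cst R 0; have ci := @cont_id R.
have [cp cn] := (cont_pos, cont_neg).
have cpN : continuous (fun t : R => Num.max 0 (- - t)).
  by apply: cont_max => //; apply: contN; apply: contN.
rewrite /ppart /npart !fc_orth // oppr0 maxxx scale0r !subr0 !(fc_opp sy) //.
rewrite (fc_pos_ext (f := fun t => Num.max 0 t) (g := id) px) //; last first.
  by move=> t t0; rewrite max_r.
rewrite (fc_pos_ext (f := fun t => Num.max 0 (- t)) (g := fun=> 0) py) //; last first.
  by move=> t t0; rewrite max_l // oppr_le0.
rewrite (fc_pos_ext (f := fun t => Num.max 0 (- t)) (g := fun=> 0) px) //; last first.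
  by move=> t t0; rewrite max_l // oppr_le0.
rewrite (fc_pos_ext (f := fun t => Num.max 0 (- - t)) (g := id) py) //; last first.
  by move=> t t0; rewrite opprK max_r.
by rewrite !fcX // !fcC // scale0r addr0 add0r.
Qed.

Lemma parts_sub x : sa x -> ppart x - npart x = x.
Proof.
move=> sx; rewrite -fcB //; [|exact: cont_pos|exact: cont_neg].
rewrite -[RHS](fcX sx); congr fc; apply/funext => t.
have [t0|t0] := leP 0 t; first by rewrite max_l ?subr0 // oppr_le0.
by rewrite max_r ?sub0r ?opprK // oppr_ge0 ltW.
Qed.

Lemma her_fc e w f : sa w -> continuous f -> f 0 = 0 -> her e w -> her e (fc w f).
Proof.
move=> sw cf f0 [ew we].
have h1 : (1 - e) * w = 0 by rewrite mulrBl mul1r ew subrr.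
have h2 : w * (1 - e) = 0 by rewrite mulrBr mulr1 we subrr.
have := fc_annr sw cf h1; have := fc_ann sw cf h2.
rewrite f0 !scale0r mulrBr mulrBl mulr1 mul1r => /eqP + /eqP.
by rewrite !subr_eq0 => /eqP h3 /eqP h4; split; exact/esym.
Qed.

Lemma herB e x y : her e x -> her e y -> her e (x - y).
Proof. by move=> [ex xe] [ey ye]; split; rewrite ?mulrBr ?mulrBl ?ex ?xe ?ey ?ye. Qed.

Lemma herZ e (z : R[i]) x : her e x -> her e (z *: x).
Proof. by move=> [ex xe]; split; rewrite -?scalerAr -?scalerAl ?ex ?xe. Qed.

Lemma her_trans e e' x : sa e -> sa e' -> e * e' = e' -> her e' x -> her e x.
Proof.
move=> se se' ee [ex xe]; have e'e : e' * e = e' by rewrite -[LHS]starK starM se se' ee.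
by split; [rewrite -ex mulrA ee|rewrite -xe -mulrA e'e].
Qed.

End Parts.

Lemma unimodular_phase (R : realType) (p : R[i]) :
  exists2 o : R[i], Num.conj o * o = 1 & complex.Re (o * p) = 0.
Proof.
have [->|p0] := eqVneq p 0; first by exists 1; rewrite ?mulr0 // rmorph1 mulr1.
have n0 : `|p| != 0 by rewrite normr_eq0.
exists ('i * (Num.conj p / `|p|)).
  rewrite rmorphM rmorphM fmorphV /= conjCK conjCi conj_Creal //.
  rewrite mulrACA mulNr -expr2 sqrCi opprK mul1r mulrACA -normCK -invfM -expr2.
  by rewrite mulfV // expf_neq0.
rewrite -mulrA mulrAC [_ * p]mulrC -normCK expr2 mulfK //.
by rewrite nrmE; simpc.
Qed.

(** * Mass moved by simplicity *)

Section Core.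
Variables (R : realType) (A : unitalCStarAlg R) (simpleA : simple_cstar A).
Variables (phi : {scalar A}) (phi_pos : positive_functional phi).
Implicit Types (e h w x y v : A) (c m : R).
Local Notation rphi := (refun phi).

(** Quantifies how far [phi] is from being a point evaluation below [e]: both signs of some
    self-adjoint contraction there carry mass at least [c]. *)
Definition splits c e := exists h,
  [/\ sa h, her e h, nrm h <= 1, c <= rphi (ppart h) & c <= rphi (npart h)].

Let Q x := rphi (star x * x).

Let Q_ge0 x : 0 <= Q x. Proof. exact: rphi_cstar_ge0. Qed.

Let QD x y : Q (x + y) <= 2 * Q x + 2 * Q y.
Proof.
have := Q_ge0 (x - y); rewrite /Q starB starD !mulrBl !mulrBr !mulrDl !mulrDr.
rewrite !(rphiD, rphiN); lra.
Qed.

Lemma rphi_conj_ge0 x y : pos x -> 0 <= rphi (star y * x * y).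
Proof.
move=> /pos_sqrt[u [su <- _]]; have := rphi_cstar_ge0 phi_pos (u * y).
by rewrite starM su !mulrA.
Qed.

Let QM x y : Q (x * y) <= nrm x ^+ 2 * Q y.
Proof.
rewrite -subr_ge0 /Q -rphiZ -rphiB.
have -> : (nrm x ^+ 2)%:C *: (star y * y) - star (x * y) * (x * y) =
    star y * ((nrm x ^+ 2)%:C%:A - star x * x) * y.
  by rewrite starM mulrBr mulrBl -scalerAr mulr1 -scalerAl !mulrA.
apply: rphi_conj_ge0; apply: pos_scalarB; first exact: sa_cstar.
by rewrite nrm_cstar.
Qed.

Let Q_le x : Q x <= nrm x ^+ 2 * rphi 1.
Proof. by have := QM x 1; rewrite mulr1 {2}/Q star1 mulr1. Qed.

(* The functional [x |-> lim phi (f_k x f_k)] does not vanish, so that the     *)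
(* elements annihilated by all its translates form a proper ideal.            *)
Lemma simple_push (f : nat -> A) v (m : R) : 0 < m -> v <> 0 ->
  (forall k, pos (f k)) -> (forall k, nrm (f k) <= 1) ->
  (forall k, f k * f k.+1 = f k.+1) -> (forall k, m <= rphi (f k)) ->
  exists b, exists2 d : R, 0 < d &
    forall N, exists2 k, (N <= k)%N & d <= rphi (star (v * b * f k) * (v * b * f k)).
Proof.
move=> m0 v0 fp f1 ff fm.
pose I := [set x : A | forall b (e : R), 0 < e -> exists N, forall k, (N <= k)%N ->
  Q (x * b * f k) < e].
have idI : closed_ideal I.
  have IMl a b : I b -> I (a * b).
    move=> Ib c e e0; have D0 : 0 < nrm a ^+ 2 + 1 by rewrite ltr_wpDl ?sqr_ge0.
    have [N HN] := Ib c _ (divr_gt0 e0 D0); exists N => k /HN.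
    rewrite ltr_pdivlMr // -!mulrA; have := QM a (b * (c * f k)).
    have := Q_ge0 (b * (c * f k)); lra.
  split.
  - move=> x clx b e e0.
    pose D := nrm b ^+ 2 * rphi 1 + 1.
    have r1 : 0 <= rphi 1 by have := Q_ge0 1; rewrite /Q star1 mulr1.
    have D0 : 0 < D by rewrite ltr_wpDl // mulr_ge0 ?sqr_ge0.
    pose d := Num.min 1 (e / 4 / D).
    have d0 : 0 < d by rewrite lt_min ltr01 !divr_gt0.
    have d1 : d <= 1 by rewrite ge_min lexx.
    have dD : d * D <= e / 4 by rewrite -ler_pdivlMr // ge_min lexx orbT.
    have dC : 0 < d%:C by rewrite ltcR.
    have [y [Iy /(nrm_ball _ _ dC) /= xy]] := clx _ (nbhsx_ballx x _ dC).
    have e4 : 0 < e / 4 by rewrite divr_gt0.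
    have [N HN] := Iy b _ e4; exists N => k /HN Hk.
    have -> : x * b * f k = y * b * f k + (x - y) * (b * f k).
      by rewrite mulrBl !mulrA addrC subrK.
    apply: le_lt_trans (QD _ _) _.
    have h1 := QM (x - y) (b * f k).
    have h2 : Q (b * f k) <= nrm b ^+ 2 * rphi 1.
      apply: le_trans (Q_le _) _; apply: ler_wpM2r => //.
      rewrite ler_sqr ?nnegrE ?nrm_ge0 //; apply: le_trans (nrmM _ _) _.
      by rewrite -[leRHS]mulr1 ler_wpM2l ?nrm_ge0.
    have h3 : nrm (x - y) ^+ 2 <= d.
      have := nrm_ge0 (x - y); nra.
    have h4 : nrm (x - y) ^+ 2 * Q (b * f k) <= d * (nrm b ^+ 2 * rphi 1).
      by apply: ler_pM; rewrite ?sqr_ge0.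
    move: dD; rewrite /D; lra.
  - move=> b e e0; exists 0 => k _.
    by rewrite !mul0r /Q mulr0 -(scale0r (0 : A)) (rphiZ phi 0) mul0r.
  - move=> x y Ix Iy b e e0; have e4 : 0 < e / 4 by rewrite divr_gt0.
    have [N1 H1] := Ix b _ e4; have [N2 H2] := Iy b _ e4.
    exists (maxn N1 N2) => k; rewrite geq_max => /andP[/H1 {}H1 /H2 {}H2].
    rewrite !mulrDl; apply: le_lt_trans (QD _ _) _; lra.
  - by move=> z x Ix; rewrite -mulr_algl; exact: IMl.
  - exact: IMl.
  - move=> a b Ia c e e0; have [N HN] := Ia (b * c) _ e0.
    by exists N => k /HN; rewrite !mulrA.
(* The square of [f N] dominates [f N.+1], their difference being [f N (1 - f N.+1) f N]; so along
   [f N] the unit keeps mass at least [m]. *)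
have I1 : ~ I 1.
  move=> /(_ 1 _ m0)[N /(_ N (leqnn _))]; rewrite !mul1r /Q (sa_pos (fp N)).
  apply/negP; rewrite -leNgt; apply: le_trans (fm N.+1) _; rewrite -subr_ge0 -rphiB.
  have -> : f N * f N - f N.+1 = star (f N) * (1 - f N.+1) * f N.
    rewrite mulrBr mulrBl mulr1 (sa_pos (fp N)); congr (_ - _).
    rewrite ff -[RHS]starK starM (sa_pos (fp N)) (sa_pos (fp N.+1)) ff.
    by rewrite (sa_pos (fp N.+1)).
  apply: rphi_conj_ge0; rewrite -[X in X - _]scale1r -(rmorph1 (real_complex R)).
  by apply: pos_scalarB; [exact: sa_pos|exact: f1].
have Iv : ~ I v.
  case: (simpleA idI) => [I0|IT]; first by rewrite I0.
  by move: I1; rewrite IT.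
have [b /existsNP[d /not_implyP[d0 /forallNP H]]] : exists b, ~ (forall e : R, 0 < e ->
    exists N, forall k, (N <= k)%N -> Q (v * b * f k) < e) by apply/existsNP.
exists b, d => // N; have /existsNP[k /not_implyP[Nk /negP]] := H N.
by rewrite -leNgt; exists k.
Qed.

End Core.

Section CoreLemma.
Variables (R : realType) (A : unitalCStarAlg R) (simpleA : simple_cstar A).
Variables (phi : {scalar A}) (phi_pos : positive_functional phi).
Implicit Types (e h w x y v : A) (c m : R).
Local Notation rphi := (refun phi).

Lemma splits_her c e e' : sa e -> sa e' -> e * e' = e' -> splits phi c e' -> splits phi c e.
Proof.
move=> se se' ee [h [sh hh h1 hp hn]]; exists h; split=> //.
exact: her_trans hh.
Qed.

Lemma rphi_corner_ge0 w e (g : R -> R) : sa w -> nrm w <= 1 -> pos e -> her e w ->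
  continuous g -> (forall t, `|t| <= 1 -> 0 <= g t) -> 0 <= rphi (e * fc w g).
Proof.
move=> sw w1 pe [ew we] cg g0; apply: (rphi_pos phi_pos); apply: posM => //.
  by apply: fc_comm => //; rewrite ew we.
by apply: fc_pos w1 _ => //.
Qed.

(* A square-zero [z] gives the self-adjoint [h = (z + z^* ) / 2], which can be *)
(* rotated so that [phi h = 0], while [phi (h ^ 2) >= phi (z^* z) / 4].       *)
Lemma splits_nilpotent e z m : sa e -> her e z -> nrm z <= 1 -> z * z = 0 ->
  m <= rphi (star z * z) -> splits phi (m / 8) e.
Proof.
move=> se [ez ze] z1 zz mz; have [tau tt1 tp] := unimodular_phase (phi z).
pose u := tau *: z; pose h := (2^-1)%:C *: (u + star u).
have eu : her e u by exact: herZ.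
have esu : her e (star u).
  by case: eu => h1 h2; split; rewrite -[e]se -starM ?h1 ?h2.
have sh : sa h by apply: saZ; rewrite /sa starD starK addrC.
have uu : star u * u = star z * z.
  by rewrite starZ -scalerAl -scalerAr scalerA tt1 scale1r.
have nu : nrm u <= 1.
  by rewrite -ler_sqr ?nnegrE ?nrm_ge0 // -nrm_cstar uu nrm_cstar ler_sqr ?nnegrE ?nrm_ge0.
have h1 : nrm h <= 1.
  rewrite nrmZ ger0_norm ?invr_ge0 //; have := nrmD u (star u); rewrite nrm_star; lra.
have u2 : u * u = 0 by rewrite -scalerAl -scalerAr zz !scaler0.
have su2 : star u * star u = 0 by rewrite -starM u2 star0.
have ph : rphi h = 0.
  rewrite rphiZ rphiD (rphi_star phi_pos) /refun linearZ /= tp; lra.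
have hh : h * h = (4^-1)%:C *: (star u * u + u * star u).
  rewrite -scalerAl -scalerAr scalerA -rmorphM /= mulrDl !mulrDr u2 su2 addr0 add0r.
  rewrite [u * star u + _]addrC; congr (_%:C *: _); lra.
have h2 : m / 4 <= rphi (h * h).
  rewrite hh rphiZ rphiD uu.
  have := rphi_cstar_ge0 phi_pos (star u); rewrite starK; lra.
have sub := parts_sub sh.
(* As [h] is a contraction, [h ^ 2] lies below the absolute value of [h]; the two parts have equal
   mass, so each gets at least half of [m / 4]. *)
have habs : rphi (h * h) <= rphi (ppart h) + rphi (npart h).
  have cc := contM (@cont_id R) (@cont_id R).
  have -> : h * h = fc h (fun t => t * t) by rewrite fcM ?fcX //; exact: cont_id.
  rewrite -rphiD -fcD //; [|exact: cont_pos|exact: cont_neg].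
  apply: (rphi_fc_le phi_pos) h1 _ => //.
    by apply: contD; [exact: cont_pos|exact: cont_neg].
  move=> t; rewrite ler_norml => /andP[t1 t2]; have [t0|t0] := leP 0 t.
    by rewrite [Num.max 0 (- t)]max_l ?oppr_le0 // addr0; nra.
  by rewrite max_r ?oppr_ge0 ?(ltW t0) // add0r; nra.
have eqp : rphi (ppart h) = rphi (npart h).
  by apply/eqP; rewrite -subr_eq0 -rphiB sub ph.
exists h; split=> //; first by apply: herZ; case: eu esu => ? ? [? ?]; split;
  rewrite ?mulrDr ?mulrDl; congr (_ + _).
- lra.
- lra.
Qed.

(** A rescaled [z = v b] from [simple_push] gives [w = f_k z^* z f_k] below [f_n], of mass at least
    [kap]. Cutting at level [s1], the part of [w] above [s1] and the complement of [chi(w)] in [f_n]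
    are orthogonal. The first keeps mass, so without a split the second has little, and [chi(w)]
    carries most of [m]. Then [z f_k] is normalised to [z'] with [star z' * z' = chi(w)]. Its square
    vanishes since [v] is orthogonal to [f_k], so [z'] splits [phi] below [e]. *)
Lemma core (f : nat -> A) e v m : 0 < m -> sa e -> v <> 0 -> e * v = v -> sa v ->
  (forall k, pos (f k)) -> (forall k, nrm (f k) <= 1) ->
  (forall k, f k * f k.+1 = f k.+1) -> (forall k, m <= rphi (f k) <= 2 * m) ->
  (forall k, e * f k = f k) -> v * f 0 = 0 ->
  (forall c, 0 < c -> exists k, ~ splits phi c (f k)) ->
  splits phi (m / 16) e.
Proof.
move=> m0 se v0 ev sv fp f1 ff fm ef vf nsp.
have sf k := sa_pos (fp k).
have nest j k : (j < k)%N -> f j * f k = f k /\ f k * f j = f k.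
  move=> jk; suff h : f j * f k = f k by split=> //; rewrite -[LHS]starK starM !sf h sf.
  elim: k jk => [//|k IH]; rewrite ltnS leq_eqVlt => /orP[/eqP ->|/IH h]; first exact: ff.
  by rewrite -ff mulrA h.
have [b [d0 d00 Hd]] := simple_push simpleA phi_pos m0 v0 fp f1 ff
  (fun k => proj1 (andP (fm k))).
pose s := (nrm (v * b) + 1)^-1.
have s0 : 0 < s by rewrite invr_gt0 ltr_wpDl ?nrm_ge0.
pose z := s%:C *: (v * b).
have z1 : nrm z <= 1.
  rewrite nrmZ ger0_norm ?(ltW s0) // mulrC ler_pdivrMr ?mul1r ?lerDl //.
  by rewrite ltr_wpDl ?nrm_ge0.
pose kap := s * (s * d0); have kap0 : 0 < kap by rewrite !mulr_gt0.
have Hk N : exists2 k, (N <= k)%N & kap <= rphi (star (z * f k) * (z * f k)).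
  have [k Nk dk] := Hd N; exists k => //.
  rewrite /z -!scalerAl starZr -scalerAl -scalerAr !rphiZ /kap.
  by rewrite !ler_pM2l.
(* With mass at most [2 m] on [f n], cutting [w] at level [s1] costs at most [kap / 2]. *)
pose s1 := kap / (4 * m); have s10 : 0 < s1 by rewrite divr_gt0 ?mulr_gt0.
have s1m : s1 * (4 * m) = kap by rewrite /s1 divfK // gt_eqF ?mulr_gt0.
(* The masses of [X / 2] and [Y / 2] in the forbidden split below; halving makes [X / 2 - Y / 2] a
   contraction. *)
pose c := Num.min (kap / 4) (m / 8).
have c0 : 0 < c by rewrite lt_min !divr_gt0.
have ck : c <= kap / 4 by rewrite ge_min lexx.
have cm : c <= m / 8 by rewrite ge_min lexx orbT.
(* One step further, so that [f n'] is a unit for [f n] itself and hence for [Y]. *)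
have [n' Hn'] := nsp c c0; pose n := n'.+1.
have [k nk Hw] := Hk n.+1.
have [fnk fkn] := nest n k nk.
pose w := star (z * f k) * (z * f k).
have sw : sa w by exact: sa_cstar.
have w1 : nrm w <= 1.
  rewrite nrm_cstar exprn_ile1 ?nrm_ge0 //; apply: le_trans (nrmM _ _) _.
  by rewrite -[leRHS]mulr1; apply: ler_pM; rewrite ?nrm_ge0.
have hw j : (j < k)%N -> her (f j) w.
  move=> /nest[h1 h2]; rewrite /w; split.
    by rewrite starM sf !mulrA h1.
  by rewrite -!mulrA h2.
have hnw := hw _ nk.
pose chi (t : R) := clamp (2 / s1 * t - 1).
have cchi : continuous chi.
  apply: cont_clamp; apply: contB; last exact: cont_cst.
  by apply: contM; [exact: cont_cst|exact: cont_id].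
have chi0 t : t <= s1 / 2 -> chi t = 0.
  move=> ts; apply: clamp_eq0; rewrite subr_le0 mulrAC ler_pdivrMr //; lra.
have chi1 t : s1 <= t -> chi t = 1.
  move=> ts; apply: clamp_eq1; rewrite lerBrDr mulrAC ler_pdivlMr //; lra.
have chi00 : chi 0 = 0 by apply: chi0; rewrite divr_ge0 ?(ltW s10).
pose th (t : R) := Num.max 0 (t - s1).
have cth : continuous th.
  by apply: cont_max; [exact: cont_cst|apply: contB; [exact: cont_id|exact: cont_cst]].
have th0 : th 0 = 0 by rewrite /th max_l // sub0r oppr_le0 ltW.
pose X := fc w th; pose Y := f n - fc w chi.
have pX : pos X by apply: fc_pos w1 _ => // t _; rewrite le_max lexx.
have hX : her (f n) X by exact: her_fc.
have hchi : her (f n) (fc w chi) by exact: her_fc.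
have c1chi : continuous (fun t => 1 - chi t) by apply: contB => //; exact: cont_cst.
have eY : Y = f n * fc w (fun t => 1 - chi t).
  rewrite fcB //; last exact: cont_cst.
  by rewrite fcC // scale1r mulrBr mulr1 (proj1 hchi).
have pY : pos Y.
  rewrite eY; apply: posM => //.
    by apply: fc_comm => //; rewrite (proj1 hnw) (proj2 hnw).
  by apply: fc_pos w1 _ => // t _; rewrite subr_ge0 clamp_le1.
have XY : X * Y = 0.
  rewrite mulrBr (proj2 hX) -fcM // -fcB //; last exact: contM.
  rewrite (_ : (fun t => _) = fun=> 0); first by rewrite fcC // scale0r.
  apply/funext => t; have [ts|ts] := leP t s1.
    by rewrite /th max_l ?mul0r ?subr0 // subr_le0.
  by rewrite chi1 ?(ltW ts) // mulr1 subrr.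
have nX : nrm X <= 1.
  apply: nrm_fc w1 _ => // t; rewrite ler_norml => /andP[t1 t2].
  rewrite ger0_norm ?le_max ?lexx // ge_max ler01 /=; lra.
have nY : nrm Y <= 1.
  rewrite eY; apply: le_trans (nrmM _ _) _; rewrite -[leRHS]mulr1.
  apply: ler_pM; rewrite ?nrm_ge0 //; apply: nrm_fc w1 _ => // t _.
  have := clamp_ge0 (2 / s1 * t - 1); have := clamp_le1 (2 / s1 * t - 1).
  by move=> h2 h1; rewrite ger0_norm ?subr_ge0 // gerBl.
have kX : kap / 2 <= rphi X.
  have cg : continuous (fun t => s1 + th t - t).
    by apply: contB; [apply: contD => //; exact: cont_cst|exact: cont_id].
  have := rphi_corner_ge0 sw w1 (fp n) hnw cg.
  rewrite fcB //; [|by apply: contD => //; exact: cont_cst|exact: cont_id].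
  rewrite fcD //; last exact: cont_cst.
  rewrite fcC // fcX // mulrBr mulrDr -scalerAr mulr1 (proj1 hX) (proj1 hnw).
  rewrite rphiB rphiD rphiZ => h; have {}h : 0 <= s1 * rphi (f n) + rphi X - rphi w.
    apply: h => t _; rewrite /th subr_ge0 addrC -lerBlDr.
    by rewrite le_max lexx orbT.
  have /andP[_ fn2] := fm n.
  have : s1 * rphi (f n) <= s1 * (2 * m) by rewrite ler_pM2l.
  move: Hw; rewrite -/w; lra.
have rY : rphi Y < m / 4.
  rewrite ltNge; apply/negP => mY; apply: Hn'.
  pose X2 := (2^-1)%:C *: X; pose Y2 := (2^-1)%:C *: Y.
  have i2 : 0 <= 2^-1 :> R by rewrite invr_ge0.
  have XY2 : X2 * Y2 = 0 by rewrite -scalerAl -scalerAr XY !scaler0.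
  have [e1 e2] := parts_orth (posZ i2 pX) (posZ i2 pY) XY2.
  have fnn := ff n'.
  exists (X2 - Y2); split.
  - by apply: saB; apply: saZ; exact: sa_pos.
  - apply: herB; apply: herZ; first exact: her_trans hX.
    apply: herB; last exact: her_trans hchi.
    by split=> //; case: (nest n' n (leqnn _)).
  - apply: le_trans (nrmB _ _) _; rewrite !nrmZ ger0_norm //; lra.
  - rewrite e1 rphiZ; lra.
  - rewrite e2 rphiZ; lra.
have rchi : 3 * m / 4 <= rphi (fc w chi).
  move: rY; rewrite rphiB; have /andP[fn1 _] := fm n; lra.
have sq0 t : 0 < Num.sqrt (Num.max t (s1 / 2)).
  by rewrite sqrtr_gt0 lt_max divr_gt0 ?orbT.
(* A continuous version of the square root of [chi t / t]: since [chi] vanishes up to [s1 / 2], the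
   maximum in the denominator changes nothing and keeps it away from zero. *)
pose g (t : R) := Num.sqrt (chi t) / Num.sqrt (Num.max t (s1 / 2)).
have cden : continuous (fun t : R => Num.sqrt (Num.max t (s1 / 2))).
  by apply: cont_sqrt; apply: cont_max; [exact: cont_id|exact: cont_cst].
have cg : continuous g.
  apply: contM; first exact: cont_sqrt.
  by move=> t; apply: cvgV; [rewrite gt_eqF|exact: cden].
have g0 : g 0 = 0 by rewrite /g chi00 sqrtr0 mul0r.
have gtg t : g t * t * g t = chi t.
  have [ts|ts] := leP t (s1 / 2); first by rewrite /g chi0 // sqrtr0 !mul0r.
  have t0 : 0 < t by apply: lt_trans ts; rewrite divr_gt0.
  rewrite /g max_l ?(ltW ts) // mulrAC -expr2 expr_div_n !sqr_sqrtr ?(ltW t0) ?clamp_ge0 //.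
  by rewrite divfK // gt_eqF.
pose z' := z * f k * fc w g.
have zz' : star z' * z' = fc w chi.
  rewrite starM (fc_sa sw cg) mulrA -[fc w g * _ * _]mulrA -/w.
  rewrite -{2}(fcX sw) -!fcM //; [|by apply: contM => //; exact: cont_id|exact: cont_id].
  by congr (fc w _); apply/funext => t; rewrite gtg.
have n0k : (0 < k)%N by apply: leq_trans nk.
have fkv : f k * v = 0.
  have [h1 h2] := nest 0 k n0k.
  by rewrite -h2 -mulrA -[f 0 * v]starK starM sf sv vf star0 mulr0.
have wv : w * v = 0 by rewrite /w -!mulrA fkv !mulr0.
have gv : fc w g * v = 0 by rewrite fc_ann // g0 scale0r.
have hew : her e w.
  split; first by rewrite /w starM sf !mulrA ef.
  by rewrite /w -!mulrA -[f k * e]starK starM sf se ef sf.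
(* [chi(w)] has mass at least [3 m / 4]; half of [m] is enough here. *)
rewrite (_ : m / 16 = (m / 2) / 8); last by lra.
apply: (@splits_nilpotent e z') => //.
- split; last by rewrite /z' -[LHS]mulrA (proj2 (her_fc sw cg g0 hew)).
  by rewrite /z' /z -!scalerAl -scalerAr !mulrA ev.
- rewrite -ler_sqr ?nnegrE ?nrm_ge0 // -nrm_cstar zz' expr1n.
  by apply: nrm_fc w1 _ => // t _; exact: clamp_norm.
- rewrite /z' /z -!scalerAl -!scalerAr -!mulrA [fc w g * (v * _)]mulrA gv.
  by rewrite mul0r !mulr0 !scaler0.
- rewrite zz'; lra.
Qed.

End CoreLemma.

(** * Splitting below a projection *)

Section SplitProjection.
Variables (R : realType) (A : unitalCStarAlg R) (simpleA : simple_cstar A).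
Variables (phi : {scalar A}) (phi_pos : positive_functional phi).
Implicit Types (a e h p v : A) (t c m : R).
Local Notation rphi := (refun phi).

Lemma plateau_le t (N M x : R) : N <= M -> plateau t M x <= plateau t N x.
Proof.
move=> NM; rewrite /plateau /clamp ge_max le_max lexx /= le_max; apply/orP; right.
rewrite le_min ge_min lexx /= ge_min lerD2l lerN2; apply/orP; right.
exact: ler_wpM2r.
Qed.

(* If [phi] does not split below the projection [p], then [h - phi(h)/phi(p)] *)
(* has a null eigenspace carrying [phi], yet is nonzero.                      *)
Lemma projection_splits p h m : 0 < m -> sa p -> p * p = p -> rphi p = m ->
  sa h -> her p h -> (forall l : R, h <> l%:C *: p) ->
  exists2 c, 0 < c & splits phi c p.
Proof.
move=> m0 sp pp pm sh hh hl; apply/not_exists2P => nsp0.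
have nsp c : 0 < c -> ~ splits phi c p by move=> c0; case: (nsp0 c).
have np : nrm p <= 1.
  have : nrm p ^+ 2 <= nrm p by rewrite -nrm_sqr // pp.
  have := nrm_ge0 p; nra.
have ppos : pos p by rewrite -pp; exact: pos_sqr.
pose h1 := h - (rphi h / m)%:C *: p.
have h10 : h1 != 0 by apply/eqP => /eqP; rewrite subr_eq0 => /eqP; exact: hl.
have sh1 : sa h1 by apply: saB => //; exact: saZ.
have hp : her p p by [].
have hh1 : her p h1 by apply: herB => //; exact: herZ.
have rh1 : rphi h1 = 0 by rewrite rphiB rphiZ pm divfK ?subrr // gt_eqF.
have n0 : 0 < nrm h1 by rewrite lt0r nrm_ge0 andbT; apply: contra h10 => /eqP/nrm0_eq0 ->.
pose k := ((nrm h1)^-1)%:C *: h1.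
have sk : sa k by exact: saZ.
have hk : her p k by exact: herZ.
have k1 : nrm k <= 1 by rewrite nrmZ ger0_norm ?invr_ge0 ?(ltW n0) // mulVf // gt_eqF.
have k0 : nrm k = 1 by rewrite nrmZ ger0_norm ?invr_ge0 ?(ltW n0) // mulVf // gt_eqF.
have rk : rphi k = 0 by rewrite rphiZ rh1 mulr0.
have eqp : rphi (ppart k) = rphi (npart k).
  by apply/eqP; rewrite -subr_eq0 -rphiB parts_sub // rk.
(* The two parts of [k] have equal mass, so a positive mass would make [k] itself a splitting
   element. *)
have pp0 : rphi (ppart k) = 0.
  have : 0 <= rphi (ppart k).
    apply: (rphi_pos phi_pos); apply: fc_pos k1 _ => //; first exact: cont_pos.
    by move=> t _; rewrite le_max lexx.
  rewrite le_eqVlt => /orP[/eqP //|c0]; case: (nsp _ c0).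
  by exists k; split; rewrite -?eqp.
have cabs : continuous (fun t : R => `|t|) by apply: cont_norm; exact: cont_id.
have rabs : rphi (fc k (fun t => `|t|)) = 0.
  rewrite (_ : fc k _ = ppart k + npart k); first by rewrite rphiD -eqp pp0 addr0.
  rewrite -fcD //; [|exact: cont_pos|exact: cont_neg].
  congr fc; apply/funext => t; have [t0|t0] := leP 0 t.
    by rewrite ger0_norm // [X in _ = _ + X]max_l ?oppr_le0 // addr0.
  by rewrite ltr0_norm // [X in _ = _ + X]max_r ?oppr_ge0 ?(ltW t0) // add0r.
pose pl j := plateau 0 (2 ^+ j : R).
have cpl j : continuous (pl j) by exact: cont_plateau.
have c1pl j : continuous (fun t => 1 - pl j t) by apply: contB => //; exact: cont_cst.
pose th j (t : R) := t * (1 - pl j t).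
have cth j : continuous (th j) by apply: contM => //; exact: cont_id.
have th0 j : th j 0 = 0 by rewrite /th mul0r.
(* Otherwise [k] would equal [k] times its plateau with parameter [4], which vanishes from distance
   [1 / 2] on; its norm would be at most [1 / 2] instead of [1]. *)
have [j vj] : exists j, fc k (th j) <> 0.
  apply/not_existsP => H; have : nrm k <= 2^-1.
    have h0 : fc k (th 2) = 0 by apply: contrapT; exact: H.
    rewrite -[k](fcX sk) -[fc k id]subr0 -h0 -fcB //; last exact: cont_id.
    apply: nrm_fc k1 _ => //; first by apply: contB => //; exact: cont_id.
    move=> t _; rewrite /th mulrBr mulr1 opprB addrC subrK normrM.
    rewrite [`|pl _ _|]ger0_norm ?clamp_ge0 //.
    have [h2|h2] := leP (2^-1) `|t|.
      by rewrite /pl /plateau clamp_eq0 ?mulr0 ?invr_ge0 // subr0; lra.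
    have := clamp_le1 (2 - 2 ^+ 2 * `|t - 0|); have := clamp_ge0 (2 - 2 ^+ 2 * `|t - 0|).
    rewrite /pl /plateau; have := normr_ge0 t; nra.
  rewrite k0; lra.
have pk : p * k = k * p by case: hk => -> ->.
have pc (g : R -> R) : continuous g -> p * fc k g = fc k g * p.
  by move=> cg; apply: fc_comm.
pose F i := p * fc k (pl (j.+1 + i)%N).
have hv : her p (fc k (th j)) by exact: her_fc.
suff : splits phi (m / 16) p by apply: nsp; rewrite divr_gt0.
apply: (core simpleA phi_pos (f := F) (v := fc k (th j)) m0 sp vj).
- exact: (proj1 hv).
- exact: fc_sa.
- move=> i; apply: posM => //; first exact: pc.
  by apply: fc_pos k1 _ => // t _; exact: clamp_ge0.
- move=> i; apply: le_trans (nrmM _ _) _; rewrite -[leRHS]mulr1.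
  apply: ler_pM; rewrite ?nrm_ge0 //.
  by apply: nrm_fc k1 _ => // t _; exact: clamp_norm.
- move=> i; rewrite /F -mulrA [fc k _ * (p * _)]mulrA -pc // -mulrA -fcM //.
  rewrite mulrA pp addnS; congr (_ * fc k _); apply/funext => t.
  by rewrite /pl exprS plateauM // exprn_ge0.
- move=> i; have H (g : R -> R) : continuous g -> (forall t, `|t| <= 1 -> 0 <= g t) ->
    0 <= rphi (p * fc k g) by move=> cg; exact: rphi_corner_ge0 k1 _ _ cg.
  have Fe : F i = p - p * fc k (fun t => 1 - pl (j.+1 + i)%N t).
    rewrite fcB //; last exact: cont_cst.
    by rewrite fcC // scale1r mulrBr mulr1 opprB addrC subrK.
  set N : R := 2 ^+ (j.+1 + i).
  have N0 : 0 <= N by rewrite exprn_ge0.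
  have h2 := H _ (c1pl (j.+1 + i)%N).
  have cN : continuous (fun t : R => N * `|t|) by apply: contM => //; exact: cont_cst.
  (* The complement of the plateau is at most [N] times the absolute value, which has mass zero on
     [k]; so every [F i] carries the full mass [m]. *)
  have h3 := H _ (contB cN (c1pl (j.+1 + i)%N)).
  rewrite fcB // fcZ // mulrBr -scalerAr rphiB rphiZ in h3.
  have e1 : p * fc k (fun t => `|t|) = fc k (fun t => `|t|).
    by case: (her_fc (e := p) sk cabs (normr0 _) hk).
  rewrite e1 rabs mulr0 in h3.
  rewrite Fe rphiB pm; apply/andP; split.
    rewrite -subr_ge0 addrAC subrr sub0r -sub0r; apply: h3 => t _.
    rewrite subr_ge0 /pl /plateau subr0 -/N.
    have [h4|h4] := leP (N * `|t|) 1; last first.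
      by have := clamp_ge0 (2 - N * `|t|); lra.
    rewrite clamp_eq1; last by lra.
    by rewrite subrr mulr_ge0.
  have {}h2 : 0 <= rphi (p * fc k (fun t => 1 - pl (j.+1 + i)%N t)).
    by apply: h2 => t _; rewrite subr_ge0 clamp_le1.
  lra.
- by move=> i; rewrite /F mulrA pp.
- rewrite /F mulrA (proj2 hv) -fcM // (_ : (fun t => _) = fun=> 0).
    by rewrite fcC // scale0r.
  apply/funext => t; have pm2 : pl j t * pl j.+1 t = pl j.+1 t.
    by rewrite /pl exprS plateauM // exprn_ge0.
  by rewrite /th addn0 -mulrA mulrBl mul1r pm2 subrr mulr0.
- move=> c c0; exists 0 => /(splits_her sp _ _) H; apply: (nsp _ c0); apply: H.
    by apply: saM; [exact: pc|exact: sp|exact: fc_sa].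
  by rewrite mulrA pp.
Qed.

End SplitProjection.

(** * Splitting around an atom *)

Section SplitAtom.
Variables (R : realType) (A : unitalCStarAlg R) (simpleA : simple_cstar A).
Variables (phi : {scalar A}) (phi_pos : positive_functional phi).
Implicit Types (a e h p v : A) (t c m : R).
Local Notation rphi := (refun phi).

Hypothesis noproj : forall p, sa p -> p * p = p -> 0 < rphi p ->
  exists h, [/\ sa h, her p h & forall l : R, h <> l%:C *: p].

(** The hypotheses say that [m] is the mass of the atom at [t]. If no constant serves all bumps,
    then every constant fails for all late bumps, which is the non-splitting assumption of [core].
    Either two late bumps differ, and their difference serves as [v], or the bumps stabilise at a
    projection. *)
Lemma split_atom a t m : sa a -> 0 < m ->
  (forall n, m <= rphi (fc a (plateau t (2 ^+ n)))) ->
  (forall d, 0 < d -> exists n, rphi (fc a (plateau t (2 ^+ n))) <= m + d) ->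
  exists2 c, 0 < c & forall n, splits phi c (fc a (plateau t (2 ^+ n))).
Proof.
move=> sx m0 ml mu; pose f n := fc a (plateau t (2 ^+ n)).
apply: contrapT => nosp.
have cpl n : continuous (plateau t (2 ^+ n)) by exact: cont_plateau.
have r0 : 0 < nrm a + 1 by rewrite ltr_wpDl ?nrm_ge0.
have ar : nrm a <= nrm a + 1 by rewrite lerDl.
have fp n : pos (f n) by apply: fc_pos ar _ => // x _; exact: clamp_ge0.
have f1 n : nrm (f n) <= 1 by apply: nrm_fc ar _ => // x _; exact: clamp_norm.
have sf n := sa_pos (fp n).
have ff n : f n * f n.+1 = f n.+1.
  rewrite -fcM //; congr (fc a _); apply/funext => x.
  by rewrite exprS plateauM // exprn_ge0.
have nest j k : (j < k)%N -> f j * f k = f k.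
  elim: k => [//|k IH]; rewrite ltnS leq_eqVlt => /orP[/eqP ->|/IH h]; first exact: ff.
  by rewrite -ff mulrA h.
have fdec j k : (j <= k)%N -> rphi (f k) <= rphi (f j).
  move=> jk; apply: (rphi_fc_le phi_pos) ar _ => // x _; apply: plateau_le.
  by rewrite ler_weXn2l // ler1n.
have fsub c j k : (j <= k)%N -> splits phi c (f k) -> splits phi c (f j).
  rewrite leq_eqVlt => /orP[/eqP -> //|jk]; apply: splits_her => //; exact: nest.
have nsp c N : 0 < c -> exists2 n, (N <= n)%N & ~ splits phi c (f n).
  move=> c0; apply: contrapT => H; apply: nosp; exists c => // n.
  apply: (fsub _ _ (maxn n N)); first exact: leq_maxl.
  by apply: contrapT => H2; apply: H; exists (maxn n N) => //; exact: leq_maxr.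
have [n0 Hn0] := mu m m0.
have m16 : 0 < m / 16 by rewrite divr_gt0.
have [n1 n01 Hn1] := nsp _ n0 m16.
(* The index [n1] is late enough that all further bumps have mass at most [2 m]; [core] would split
   [phi] below [f n1] with constant [m / 16], contrary to the choice of [n1]. *)
have [|alln] := pselect (exists2 j, (n1.+1 < j)%N & f n1.+1 <> f j).
  move=> [j nj fj]; apply: Hn1.
  apply: (core simpleA phi_pos (f := fun k => f (j.+1 + k)%N) (v := f n1.+1 - f j) m0) => //.
  - by move/eqP; rewrite subr_eq0 => /eqP.
  - by rewrite mulrBr ff nest // ltnW.
  - exact: saB.
  - by move=> k; rewrite addnS.
  - move=> k; rewrite ml /=; apply: le_trans (_ : rphi (f n0) <= _).
      apply: fdec; apply: leq_trans n01 _; apply: leq_trans (leq_addr _ _).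
      by rewrite ltnW // ltnW // ltnW.
    by rewrite mulr_natl mulr2n.
  - by move=> k; apply: nest; apply: leq_trans (leq_addr _ _); rewrite ltnW // ltnW.
  - by rewrite addn0 mulrBl !nest ?subrr // ltnW.
  - move=> c c0; have [n jn Hn] := nsp c j.+1 c0; exists (n - j.+1)%N.
    by rewrite subnKC.
pose p := f n1.+1.
have pE j : (n1.+1 < j)%N -> p = f j by move=> nj; apply: contrapT => H; apply: alln; exists j.
(* The bumps are constant from here on, so [f n * f n.+1 = f n.+1] becomes idempotence. *)
have pp : p * p = p by rewrite {2}(pE n1.+2) // ff -pE.
have rp : rphi p = m.
  apply/eqP; rewrite eq_le ml andbT; apply/ler_addgt0Pr => d /mu[n Hn].
  rewrite (pE (maxn n1.+2 n)); last exact: leq_maxl.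
  by apply: le_trans Hn; apply: fdec; exact: leq_maxr.
have p0 : 0 < rphi p by rewrite rp.
have [h [sh hh hl]] := noproj (sf _) pp p0.
have [c c0 sc] := projection_splits simpleA phi_pos m0 (sf _) pp rp sh hh hl.
have [n nn Hn] := nsp c n1.+2 c0.
by apply: Hn; rewrite -pE.
Qed.

End SplitAtom.

(** * A self-adjoint element with diffuse distribution *)

Section Baire.
Variables (R : realType) (A : unitalCStarAlg R).
Implicit Types (a x y : A).

Lemma geom_small (e : R) : 0 < e -> exists n, 2 ^- n < e.
Proof.
move=> e0; exists (Num.truncn e^-1).
rewrite -[X in _ < X]invrK ltf_pV2 ?posrE ?exprn_gt0 ?invr_gt0 //.
apply: lt_le_trans (truncnS_gt _) _; rewrite -natrX ler_nat.
exact: ltn_expl.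
Qed.

(* Baire category on the real Banach space of self-adjoint elements: a generic *)
(* point lies outside the boundary of each of countably many open sets.       *)
Lemma baire_sa (O : nat -> A -> Prop) :
  (forall n x, sa x -> O n x ->
    exists2 d : R, 0 < d & forall y, sa y -> nrm (y - x) < d -> O n y) ->
  exists2 a, sa a & forall n, O n a \/
    exists2 d : R, 0 < d & forall y, sa y -> nrm (y - a) < d -> ~ O n y.
Proof.
move=> Oop.
(* A pair is a ball, centre and radius. The ball [q] sits inside the ball about the centre of [p]
   with half its radius, and membership in [O n] is constant on it. *)
pose good n (p q : A * R) := sa p.1 -> 0 < p.2 ->
  [/\ sa q.1, 0 < q.2, nrm (q.1 - p.1) + q.2 <= p.2 / 2
    & (forall y, sa y -> nrm (y - q.1) < q.2 -> O n y) \/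
      (forall y, sa y -> nrm (y - q.1) < q.2 -> ~ O n y)].
have /choice[S HS] : forall np : nat * (A * R), exists q, good np.1 np.2 q.
  move=> [n [x r]]; rewrite /good /=.
  have [[y [sy yx Oy]]|H] := pselect (exists y, [/\ sa y, nrm (y - x) <= r / 4 & O n y]).
    have [d d0 Hd] := Oop n y sy Oy; exists (y, Num.min d (r / 4)) => /= sx r0.
    split=> //; first by rewrite lt_min d0 divr_gt0.
      have : Num.min d (r / 4) <= r / 4 by rewrite ge_min lexx orbT.
      lra.
    by left=> z sz; rewrite lt_min => /andP[zd _]; apply: Hd.
  exists (x, r / 4) => /= sx r0; split=> //; first by rewrite divr_gt0.
    by rewrite subrr nrm0; lra.
  by right=> y sy yx Oy; apply: H; exists y; split=> //; exact: ltW.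
pose fix s n : A * R := if n is m.+1 then S (m, s m) else (0, 1).
have Hs n : sa (s n).1 /\ 0 < (s n).2.
  elim: n => [|n [IH1 IH2]]; first by split=> //=; exact: sa0.
  by have [] := HS (n, s n) IH1 IH2.
have HS' n := HS (n, s n) (proj1 (Hs n)) (proj2 (Hs n)).
have step n : nrm ((s n.+1).1 - (s n).1) + (s n.+1).2 <= (s n).2 / 2 by have [] := HS' n.
have s2 n : 0 < (s n).2 := proj2 (Hs n).
have far m n : (n <= m)%N -> nrm ((s m).1 - (s n).1) + (s m).2 <= (s n).2.
  elim: m => [|m IH]; first by rewrite leqn0 => /eqP ->; rewrite subrr nrm0 add0r.
  rewrite leq_eqVlt ltnS => /orP[/eqP ->|/IH h]; first by rewrite subrr nrm0 add0r.
  have := step m; have := s2 m; have := nrm_triangle (s m.+1).1 (s m).1 (s n).1; lra.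
have far2 m n : (n < m)%N -> nrm ((s m).1 - (s n).1) <= (s n).2 / 2.
  move=> /far h; have := step n; have := s2 m.
  have := nrm_triangle (s m).1 (s n.+1).1 (s n).1; lra.
have small n : (s n).2 <= 2 ^- n.
  elim: n => [|n IH]; first by rewrite expr0 invr1.
  have := step n; have := nrm_ge0 ((s n.+1).1 - (s n).1).
  rewrite exprS invfM; lra.
have [|a aP] := @nrm_complete R A (fun n => (s n).1).
  move=> e e0; have [N HN] := geom_small e0; exists N => m n Nm Nn.
  have h1 := far m N Nm; have h2 := far n N Nn.
  have h3 k : (N <= k)%N -> nrm ((s k).1 - (s N).1) <= (s N).2 / 2.
    rewrite leq_eqVlt => /orP[/eqP <-|/far2 //].
    by rewrite subrr nrm0 divr_ge0 // ltW.
  have := nrm_triangle (s m).1 (s N).1 (s n).1; rewrite [nrm ((s N).1 - _)]nrmBC.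
  have := h3 m Nm; have := h3 n Nn; have := small N; lra.
have ta : tends (fun n => (s n).1) a by [].
have sx : sa a.
  apply: tends_unique (tends_star ta) _.
  by rewrite (_ : (fun n => _) = fun n => (s n).1) //; apply/funext => n; case: (Hs n).
have near n : nrm (a - (s n).1) <= (s n).2 / 2.
  apply/ler_addgt0Pr => e /aP[N HN].
  have := HN _ (leq_maxl N n.+1); have := far2 _ _ (leq_maxr N n.+1).
  have := nrm_triangle a (s (maxn N n.+1)).1 (s n).1; rewrite (nrmBC a (s (maxn N n.+1)).1); lra.
exists a => // n; have [s1 r1 _] := HS' n; rewrite -[S _]/(s n.+1) in s1 r1 *.
have an := near n.+1; case=> H; [left|right].
  by apply: H => //; lra.
exists ((s n.+1).2 / 2); first by rewrite divr_gt0.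
by move=> y sy ya; apply: H => //; have := nrm_triangle y a (s n.+1).1; lra.
Qed.

End Baire.

(** * Mass in a window around an atom *)

Section NoAtoms.
Variables (R : realType) (A : unitalCStarAlg R).
Variables (phi : {scalar A}) (phi_pos : positive_functional phi).
Implicit Types (a b e h p v : A) (t c m : R).
Local Notation rphi := (refun phi).

(** These are the open sets of the Baire argument: two separated functions under the window [W],
    each of mass more than [q]. *)
Definition bumps (W : R -> R) (q : R) a := exists f g : R -> R,
  [/\ continuous f, continuous g & [/\ forall t, 0 <= f t <= W t,
    forall t, 0 <= g t <= W t, forall t, f t * g t = 0,
    q < rphi (fc a f) & q < rphi (fc a g)]].

Lemma rphi1_ge0 : 0 <= rphi 1.
Proof. by have := rphi_cstar_ge0 phi_pos 1; rewrite star1 mulr1. Qed.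

Lemma rphi_fc_open a (f : R -> R) (q : R) : sa a -> continuous f -> q < rphi (fc a f) ->
  exists2 d : R, 0 < d & forall b, sa b -> nrm (b - a) < d -> q < rphi (fc b f).
Proof.
move=> sx cf qf; have r1 := rphi1_ge0.
pose g := (rphi (fc a f) - q) / (rphi 1 + 1).
have D0 : 0 < rphi 1 + 1 by rewrite ltr_wpDl.
have g0 : 0 < g by rewrite divr_gt0 ?subr_gt0.
have [d d0 Hd] := fc_cont sx cf g0; exists d => // b sb /(Hd b sb) bd.
have sd : sa (fc b f - fc a f) by apply: saB; exact: fc_sa.
have := rphi_le_nrm phi_pos sd (lexx _); rewrite rphiB ler_norml => /andP[h _].
have gD : g * (rphi 1 + 1) = rphi (fc a f) - q by rewrite divfK // gt_eqF.
have := nrm_ge0 (fc b f - fc a f); nra.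
Qed.

Lemma bumps_open W q a : sa a -> bumps W q a ->
  exists2 d : R, 0 < d & forall b, sa b -> nrm (b - a) < d -> bumps W q b.
Proof.
move=> sx [f [g [cf cg [f0 g0 fg qf qg]]]].
have [d d0 Hd] := rphi_fc_open sx cf qf; have [d' d'0 Hd'] := rphi_fc_open sx cg qg.
exists (Num.min d d'); first by rewrite lt_min d0.
move=> b sb; rewrite lt_min => /andP[b1 b2]; exists f, g; split=> //; split=> //.
  exact: Hd.
exact: Hd'.
Qed.

(** A narrow plateau at [t] has mass at least [m] and, because [f] vanishes at [t], fits under [W]
    together with [f] up to an arbitrarily small constant. So [f] gets only the excess of [W] over
    the atom. *)
Lemma bump_vanishing a t m q (W f : R -> R) (r : R) : sa a ->
  (forall n, m <= rphi (fc a (plateau t (2 ^+ n)))) ->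
  continuous W -> continuous f -> (forall x, 0 <= f x <= W x) -> f t = 0 ->
  0 < r -> (forall x, `|x - t| <= r -> W x = 1) ->
  rphi (fc a W) <= m + q -> rphi (fc a f) <= q.
Proof.
move=> sx ml cW cf fW ft r0 W1 Wq; have r1 := rphi1_ge0.
apply/ler_addgt0Pr => e e0; have D0 : 0 < rphi 1 + 1 by rewrite ltr_wpDl.
pose g := e / (rphi 1 + 1); have g0 : 0 < g by rewrite divr_gt0.
have gD : g * (rphi 1 + 1) = e by rewrite divfK // gt_eqF.
have /cvgrPdist_lt/(_ _ g0)/nbhs_ballP[d /= d0 hd] := cf t.
have [k hk] : exists k, 2 ^- k < Num.min d r / 2.
  by apply: geom_small; rewrite divr_gt0 // lt_min d0.
have cp := @cont_plateau R t (2 ^+ k).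
have ar : nrm a <= nrm a + 1 by rewrite lerDl.
have n1 : 0 < nrm a + 1 by rewrite ltr_wpDl ?nrm_ge0.
have : rphi (fc a (fun x => f x + plateau t (2 ^+ k) x)) <= rphi (fc a (fun x => W x + g)).
  apply: (rphi_fc_le phi_pos) ar _ => //; [exact: contD|by apply: contD => //; exact: cont_cst|].
  move=> x _; have := fW x; have [h|h] := ltP `|x - t| (Num.min d r).
    move: h; rewrite lt_min => /andP[xd xr] _; rewrite W1 ?(ltW xr) //.
    have : `|f t - f x| < g by apply: hd; rewrite /ball /= distrC.
    rewrite ft sub0r normrN => /(le_lt_trans (ler_norm _)) h.
    have := clamp_le1 (2 - 2 ^+ k * `|x - t|); rewrite /plateau; lra.
  rewrite /plateau clamp_eq0; first by lra.
  have h2 : 2 ^- k < `|x - t| / 2 by lra.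
  rewrite subr_le0; move: h2; rewrite -div1r ltr_pdivrMr ?exprn_gt0 // mulrC.
  lra.
rewrite !fcD //; last exact: cont_cst.
rewrite fcC // !rphiD rphiZ; have := ml k; nra.
Qed.

End NoAtoms.

(** * Perturbing an element near an atom *)

Section Perturbation.
Variables (R : realType) (A : unitalCStarAlg R).
Variables (phi : {scalar A}) (phi_pos : positive_functional phi).
Implicit Types (a b e h p v : A) (t c m : R).
Local Notation rphi := (refun phi).

(** A tent on [[0, 2]] with peak at [1]: it computes the positive part on [[-1, 1]] but has bounded
    support, so that it fits under a window. *)
Definition hat (y : R) := Num.max 0 (Num.min y (2 - y)).

Lemma cont_hat : continuous hat.
Proof.
apply: cont_max; first exact: cont_cst.
by apply: cont_min; [exact: cont_id|apply: contB; [exact: cont_cst|exact: cont_id]].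
Qed.

Lemma hat_ge0 y : 0 <= hat y. Proof. by rewrite le_max lexx. Qed.

Lemma hat_le1 y : hat y <= 1.
Proof. by rewrite ge_max ler01 ge_min; case: (leP y 1) => //= h; lra. Qed.

Lemma hat_eq0 y : y <= 0 \/ 2 <= y -> hat y = 0.
Proof. by move=> h; rewrite /hat max_l // ge_min; apply/orP; lra. Qed.

Lemma hat_id y : `|y| <= 1 -> hat y = Num.max 0 y.
Proof. by rewrite ler_norml => /andP[h1 h2]; rewrite /hat [Num.min _ _]min_l //; lra. Qed.

(** Soft thresholding: values up to [k] become zero and none moves by more than [k]. *)
Definition flatten (k y : R) := y - Num.max (- k) (Num.min k y).

Lemma cont_flatten k : continuous (flatten k).
Proof.
apply: contB; first exact: cont_id.
apply: cont_max; first exact: cont_cst.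
by apply: cont_min; [exact: cont_cst|exact: cont_id].
Qed.

Lemma flatten_eq0 k y : `|y| <= k -> flatten k y = 0.
Proof.
by rewrite ler_norml => /andP[h1 h2]; rewrite /flatten min_r // max_r // subrr.
Qed.

Lemma flatten_close k y : 0 <= k -> `|flatten k y - y| <= k.
Proof.
move=> k0; rewrite /flatten addrAC subrr sub0r normrN ler_norml.
by rewrite le_max lexx ge_max ge0_cp //= ge_min lexx.
Qed.

(** Take [b = t + flatten(a - t) + d h]. The last two terms are orthogonal, so functions of [b - t]
    vanishing at zero are computed on each separately, and the two tents at scale [d] inherit the
    masses of the two parts of [h]. *)
Lemma split_perturb a t c n (d q : R) (W : R -> R) : sa a ->
  splits phi c (fc a (plateau t (2 ^+ n))) -> 0 < d -> q < c ->
  (forall x, 0 <= W x) -> (forall x, `|x - t| <= 2 * d -> W x = 1) ->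
  exists2 b, sa b & nrm (b - a) <= 2 * 2 ^- n + d /\ bumps phi W q b.
Proof.
move=> sx [h [sh hh h1 hp hn]] d0 qc W0 W1.
pose k : R := 2 * 2 ^- n.
have k0 : 0 <= k by rewrite mulr_ge0 ?invr_ge0 ?exprn_ge0.
have cft : continuous (fun x => flatten k (x - t)).
  apply: (cont_comp (f := fun x => x - t)); last exact: cont_flatten.
  by apply: contB; [exact: cont_id|exact: cont_cst].
pose d1 := fc a (fun x => flatten k (x - t)).
pose e1 := d%:C *: h.
have sd1 : sa d1 by exact: fc_sa.
have se1 : sa e1 by exact: saZ.
(* The bump acts as a unit on [h] and vanishes from distance [k] on, while the flattened function
   vanishes up to distance [k]. *)
have de1 : d1 * e1 = 0.
  case: hh => fh _; rewrite /e1 -scalerAr -fh mulrA -fcM //; last exact: cont_plateau.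
  rewrite (_ : (fun x => _) = fun=> 0); first by rewrite fcC // scale0r mul0r scaler0.
  apply/funext => x; have [xk|xk] := leP `|x - t| k; first by rewrite flatten_eq0 ?mul0r.
  rewrite /plateau clamp_eq0 ?mulr0 // subr_le0.
  by move: xk; rewrite /k ltr_pdivrMr ?exprn_gt0 // mulrC => /ltW.
pose b := t%:C%:A + (d1 + e1).
have sde : sa (d1 + e1) by exact: saD.
have sb : sa b by apply: saD => //; exact: sa_scalar.
exists b => //.
have ar : nrm a <= nrm a + 1 by rewrite lerDl.
have r0 : 0 < nrm a + 1 by rewrite ltr_wpDl ?nrm_ge0.
have e1n : nrm e1 <= d.
  by rewrite nrmZ gtr0_norm // -[leRHS]mulr1 ler_wpM2l // ltW.
split.
  have -> : b - a = fc a (fun x => t + flatten k (x - t) - x) + e1.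
    rewrite fcB //; [|by apply: contD => //; exact: cont_cst|exact: cont_id].
    rewrite fcD //; last exact: cont_cst.
    rewrite fcC // fcX //.
    by rewrite /b addrA [LHS]addrAC.
  apply: le_trans (nrmD _ _) _; apply: lerD => //.
  apply: nrm_fc ar _ => //.
    by apply: contB; [apply: contD => //; exact: cont_cst|exact: cont_id].
  move=> x _; have := flatten_close (x - t) k0.
  by rewrite opprB addrCA addrA.
(* The sign [s] is [1] or [-1] and selects the positive or the negative part of [h]. *)
have key (s : R) (f : R -> R) : s ^+ 2 = 1 -> f = (fun x => hat (s * ((x - t) / d))) ->
    c <= rphi (fc h (fun y => Num.max 0 (s * y))) ->
    [/\ continuous f, forall x, 0 <= f x <= W x & q < rphi (fc b f)].
  move=> s2 -> cs; pose G (y : R) := hat (s * (y / d)).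
  have cG : continuous G.
    apply: cont_comp; last exact: cont_hat.
    apply: contM; first exact: cont_cst.
    by apply: contM; [exact: cont_id|exact: cont_cst].
  have cGt : continuous (fun x => G (x - t)).
    by apply: cont_comp => //; apply: contB; [exact: cont_id|exact: cont_cst].
  have G0 : G 0 = 0 by rewrite /G mul0r mulr0 hat_eq0 //; left.
  have ns : `|s| = 1.
    by apply/eqP; rewrite -sqrp_eq1 // real_normK ?num_real // s2.
  split=> //.
    move=> x; rewrite hat_ge0 /=; have [h2|h2] := leP `|x - t| (2 * d).
      by rewrite W1 // hat_le1.
    rewrite hat_eq0 ?W0 //.
    have : 2 < `|s * ((x - t) / d)|.
      by rewrite normrM ns mul1r normrM normfV (gtr0_norm d0) ltr_pdivlMr.
    by case: (leP 0 (s * ((x - t) / d))) => h3;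
      [rewrite ger0_norm // => /ltW; right|left; exact: ltW].
  have eb : b = fc (d1 + e1) (fun y => t + y).
    rewrite fcD //; [|exact: cont_cst|exact: cont_id].
    by rewrite fcC // fcX.
  have -> : fc b (fun x => hat (s * ((x - t) / d))) = fc (d1 + e1) G.
    rewrite eb fc_comp //; last by apply: contD; [exact: cont_cst|exact: cont_id].
    by congr fc; apply/funext => y /=; rewrite [t + y]addrC addrK.
  rewrite fc_orth // G0 scale0r subr0 rphiD.
  have h2 : 0 <= rphi (fc d1 G).
    apply: (rphi_pos phi_pos); apply: (fc_pos (r := nrm d1 + 1)) => //.
    - by rewrite ltr_wpDl ?nrm_ge0.
    - by rewrite lerDl.
    - by move=> y _; exact: hat_ge0.
  have h3 : fc e1 G = fc h (fun y => Num.max 0 (s * y)).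
    have cd : continuous (fun y : R => d * y) by apply: contM; [exact: cont_cst|exact: cont_id].
    have -> : e1 = fc h (fun y => d * y) by rewrite fcZ ?fcX //; exact: cont_id.
    rewrite fc_comp //; apply: eq_fc h1 _ => //.
    - exact: (cont_comp cd cG).
    - apply: cont_max; first exact: cont_cst.
      by apply: contM; [exact: cont_cst|exact: cont_id].
    move=> y y1; rewrite /G /= [d * y]mulrC mulfK ?gt_eqF // hat_id //.
    by rewrite normrM ns mul1r.
  rewrite h3; lra.
have [|cf f0 qf] := key 1 _ (expr1n _ _) erefl.
  by rewrite (_ : (fun y => _) = fun y => Num.max 0 y) //; apply/funext => y; rewrite mul1r.
have [||cg g0 qg] := key (- 1) _ _ erefl.
- by rewrite sqrrN expr1n.
- rewrite (_ : (fun y => _) = fun y => Num.max 0 (- y)) //.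
  by apply/funext => y; rewrite mulN1r.
exists (fun x => hat (1 * ((x - t) / d))), (fun x => hat (- 1 * ((x - t) / d))).
split=> //; split=> // x; have [h2|h2] := leP 0 ((x - t) / d).
  by rewrite [X in _ * X]hat_eq0 ?mulr0 //; left; rewrite mulN1r oppr_le0.
by rewrite hat_eq0 ?mul0r //; left; rewrite mul1r ltW.
Qed.

End Perturbation.

(** * Existence of an atomless element *)

Section Diffuse.
Variables (R : realType) (A : unitalCStarAlg R) (simpleA : simple_cstar A).
Variables (phi : {scalar A}) (phi_pos : positive_functional phi).
Implicit Types (a b e h p v : A) (t c m : R).
Local Notation rphi := (refun phi).

Hypothesis noproj : forall p, sa p -> p * p = p -> 0 < rphi p ->
  exists h, [/\ sa h, her p h & forall l : R, h <> l%:C *: p].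

(** Baire's theorem allows countably many conditions: rational centres, dyadic widths and thresholds
    [1 / (j + 1)], enumerated through [unpickle]. *)
Definition window (n : nat) : option ((R -> R) * R) :=
  if unpickle n is Some (s, i, j) then
    Some (plateau (ratr (s : rat)) (2 ^+ i), (j : nat).+1%:R^-1) else None.

Lemma exists_diffuse : exists2 a, sa a &
  forall t (e : R), 0 < e -> exists n, rphi (fc a (plateau t (2 ^+ n))) < e.
Proof.
pose O n a := if window n is Some (W, q) then bumps phi W q a else False.
have [|a sx Ha] := @baire_sa R A O.
  by move=> n a sx; rewrite /O; case: (window n) => // -[W q]; exact: bumps_open.
exists a => // t e e0; apply: contrapT => /forallNP Hn.
have ar : nrm a <= nrm a + 1 by rewrite lerDl.
have r0 : 0 < nrm a + 1 by rewrite ltr_wpDl ?nrm_ge0.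
pose u n := rphi (fc a (plateau t (2 ^+ n))).
have ue n : e <= u n by rewrite leNgt; apply/negP/Hn.
have hinf : has_inf (range u) by split; [exists (u 0), 0|exists e => _ [n _ <-]].
pose m := inf (range u).
have m0 : 0 < m by apply: lt_le_trans e0 _; apply: lb_le_inf; [case: hinf|move=> _ [n _ <-]].
have ml n : m <= u n by apply: ge_inf; [case: hinf|exists n].
have mu d : 0 < d -> exists n, u n <= m + d.
  by move=> d0; have [_ [n _ <-] h] := inf_adherent d0 hinf; exists n; exact: ltW.
have [c c0 Hc] := split_atom simpleA phi_pos noproj sx m0 ml mu.
have [j Hj] := geom_small c0.
have qc : (2 ^ j).+1%:R^-1 < c.
  apply: le_lt_trans Hj; rewrite -natrX lef_pV2 ?posrE ?ltr0n ?expn_gt0 //.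
  by rewrite ler_nat.
set q : R := (2 ^ j).+1%:R^-1 in qc.
have q0 : 0 < q by rewrite invr_gt0 ltr0n.
have [N HN] := mu q q0.
have i0 : 0 < 2 ^- N.+3 :> R by rewrite invr_gt0 exprn_gt0.
(* Close enough to [t] that the window of parameter [2 ^ (N + 2)] at [s] lies under the bump of
   parameter [2 ^ N] at [t] and is still [1] near [t]. *)
have [s Hs] : exists s : rat, `|ratr s - t| < 2 ^- N.+3.
  have [|s] := @rat_in_itvoo R (t - 2 ^- N.+3) (t + 2 ^- N.+3).
    lra.
  rewrite in_itv /= => /andP[h1 h2]; exists s; rewrite ltr_norml; lra.
pose W := plateau (ratr s) (2 ^+ N.+2 : R).
have p3 : 2 ^- N.+2 = 2 * 2 ^- N.+3 :> R by rewrite [in RHS]exprS; field; rewrite expf_neq0.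
have p2 : 2 ^- N = 8 * 2 ^- N.+3 :> R.
  by rewrite !exprS; field; rewrite expf_neq0.
have W1 x : `|x - t| <= 2 ^- N.+3 -> W x = 1.
  move=> xt; apply: clamp_eq1; rewrite lerBrDl -lerBrDr.
  have : `|x - ratr s| <= 2 ^- N.+2.
    by have := ler_distD t x (ratr s); rewrite [`|t - _|]distrC p3; lra.
  rewrite -div1r ler_pdivlMr ?exprn_gt0 // mulrC; lra.
have Wt x : W x <= plateau t (2 ^+ N) x.
  have [h|h] := leP `|x - ratr s| (2 * 2 ^- N.+2); last first.
    rewrite /W /plateau clamp_eq0 ?clamp_ge0 // subr_le0.
    by move: h; rewrite ltr_pdivrMr ?exprn_gt0 // mulrC => /ltW.
  rewrite [leRHS]clamp_eq1; first exact: clamp_le1.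
  have : `|x - t| <= 2 ^- N.
    by have := ler_distD (ratr s) x t; rewrite p2; rewrite p3 in h; lra.
  rewrite -div1r ler_pdivlMr ?exprn_gt0 // mulrC; lra.
have rW : rphi (fc a W) <= m + q.
  apply: le_trans HN; apply: (rphi_fc_le phi_pos) ar _ => //; exact: cont_plateau.
pose n := pickle (s, N.+2, 2 ^ j)%N.
have wn : window n = Some (W, q) by rewrite /window /n pickleK.
(* If [a] is in the open set, one of the two disjoint bumps vanishes at the atom and has mass at
   most [q]. If [a] is exterior to it, [split_perturb] finds a nearby element inside. *)
have := Ha n; rewrite /O wn => -[[f [g [cf cg [f0 g0 fg qf qg]]]]|[d d0 Hd]].
  have bv (h : R -> R) : continuous h -> (forall x, 0 <= h x <= W x) -> h t = 0 ->
      rphi (fc a h) <= q.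
    move=> ch h0 ht; apply: (bump_vanishing (m := m) phi_pos sx ml) W1 rW => //.
    exact: cont_plateau.
  have /eqP := fg t; rewrite mulf_eq0 => /orP[/eqP ft|/eqP gt].
    by have := bv f cf f0 ft; rewrite leNgt qf.
  by have := bv g cg g0 gt; rewrite leNgt qg.
pose dd := Num.min (d / 2) (2 ^- N.+3 / 2).
have dd0 : 0 < dd by rewrite lt_min !divr_gt0.
have [k Hk] := geom_small (divr_gt0 d0 (ltr0Sn R 3)).
have [||b sb [ba Ob]] := @split_perturb R A phi phi_pos a t c k dd q W sx (Hc k) dd0 qc.
- by move=> x; exact: clamp_ge0.
- move=> x xt; apply: W1; apply: le_trans xt _.
  have : dd <= 2 ^- N.+3 / 2 by rewrite ge_min lexx orbT.
  lra.
apply: (Hd b) => //; apply: le_lt_trans ba _.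
have : dd <= d / 2 by rewrite ge_min lexx.
lra.
Qed.

End Diffuse.

(** * From a diffuse distribution to a Haar unitary *)

Section Distribution.
Variables (R : realType) (A : unitalCStarAlg R).
Variables (phi : {scalar A}) (phi_pos : positive_functional phi).
Variables (a : A) (saa : sa a).
Local Notation rphi := (refun phi).
Hypothesis diffuse : forall t e : R, 0 < e ->
  exists n, rphi (fc a (plateau t (2 ^+ n))) < e.
Let M := rphi 1.
Hypothesis M0 : 0 < M.
Implicit Types (s t u v x y : R) (n : nat).

Let r0 : 0 < nrm a + 1. Proof. by rewrite ltr_wpDl ?nrm_ge0. Qed.
Let ar : nrm a <= nrm a + 1. Proof. by rewrite lerDl. Qed.

Definition ramp s n x := clamp (1 - 2 ^+ n * (x - s)).

Lemma cont_ramp s n : continuous (ramp s n).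
Proof.
apply: cont_clamp; apply: contB; first exact: cont_cst.
apply: contM; first exact: cont_cst.
by apply: contB; [exact: cont_id|exact: cont_cst].
Qed.

Lemma ramp1 s n x : x <= s -> ramp s n x = 1.
Proof.
by move=> xs; apply: clamp_eq1; rewrite lerBrDr gerDl mulr_ge0_le0 ?exprn_ge0 ?subr_le0.
Qed.

Lemma ramp0 s n x : s + 2 ^- n <= x -> ramp s n x = 0.
Proof.
move=> sx; apply: clamp_eq0; rewrite subr_le0.
have p : 0 < 2 ^+ n :> R by rewrite exprn_gt0.
by rewrite mulrC -ler_pdivrMr // div1r; lra.
Qed.

(** The mass of the half-line up to and including [s], over the total mass. The ramps approximate
    its indicator from above. *)
Definition dfun s := inf (range (fun n => rphi (fc a (ramp s n)))) / M.

Let le_fc (f g : R -> R) : continuous f -> continuous g -> (forall x, f x <= g x) ->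
  rphi (fc a f) <= rphi (fc a g).
Proof. by move=> cf cg fg; apply: (rphi_fc_le phi_pos) ar _ => // x _. Qed.

Let fc1 : rphi (fc a (fun=> 1)) = M. Proof. by rewrite fcC // scale1r. Qed.

Let rramp_ge0 s n : 0 <= rphi (fc a (ramp s n)).
Proof.
apply: (rphi_pos phi_pos); apply: fc_pos ar _ => //; first exact: cont_ramp.
by move=> x _; exact: clamp_ge0.
Qed.

Let has_inf_ramp s : has_inf (range (fun n => rphi (fc a (ramp s n)))).
Proof. by split; [exists (rphi (fc a (ramp s 0))), 0|exists 0 => _ [n _ <-]]. Qed.

Lemma dfun_le_ramp s n : M * dfun s <= rphi (fc a (ramp s n)).
Proof.
rewrite /dfun mulrC divfK ?gt_eqF //; apply: ge_inf; last by exists n.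
by case: (has_inf_ramp s).
Qed.

Lemma ramp_le_dfun s t n : s + 2 ^- n <= t -> rphi (fc a (ramp s n)) <= M * dfun t.
Proof.
move=> st; rewrite /dfun mulrC divfK ?gt_eqF //.
apply: lb_le_inf; first by case: (has_inf_ramp t).
move=> _ [k _ <-]; apply: le_fc; [exact: cont_ramp|exact: cont_ramp|move=> x].
have [xt|xt] := leP x t; first by rewrite (ramp1 _ xt) clamp_le1.
by rewrite ramp0 ?clamp_ge0 // (le_trans st) // ltW.
Qed.

Lemma dfun_approx s e : 0 < e -> exists n, rphi (fc a (ramp s n)) < M * dfun s + e.
Proof.
move=> e0; have [_ [n _ <-] h] := inf_adherent e0 (has_inf_ramp s).
by exists n; rewrite /dfun mulrC divfK ?gt_eqF.
Qed.

Lemma dfun_nd s t : s <= t -> dfun s <= dfun t.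
Proof.
move=> st; rewrite /dfun ler_pM2r ?invr_gt0 //.
apply: lb_le_inf; first by case: (has_inf_ramp t).
move=> _ [n _ <-]; apply: le_trans (_ : rphi (fc a (ramp s n)) <= _).
  by apply: ge_inf; [case: (has_inf_ramp s)|exists n].
apply: le_fc; [exact: cont_ramp|exact: cont_ramp|move=> x].
have [xt|xt] := leP x s; first by rewrite !ramp1 // (le_trans xt).
rewrite /ramp /clamp ge_max le_max lexx /= le_max; apply/orP; right.
rewrite le_min ge_min lexx /= ge_min lerD2l lerN2; apply/orP; right.
by rewrite ler_pM2l ?exprn_gt0 // lerD2l lerN2.
Qed.

Lemma dfun_ge0 s : 0 <= dfun s.
Proof.
rewrite divr_ge0 ?(ltW M0) //; apply: lb_le_inf; first by case: (has_inf_ramp s).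
by move=> _ [n _ <-].
Qed.

Lemma dfun_le1 s : dfun s <= 1.
Proof.
rewrite -(ler_pM2l M0) mulr1; apply: le_trans (dfun_le_ramp s 0) _.
by rewrite -fc1; apply: le_fc; [exact: cont_ramp|exact: cont_cst|move=> x; exact: clamp_le1].
Qed.

(** The comparison runs over radius [nrm a + 1], and [ramp _ 0] descends over a length of one; the
    margin [3] leaves room for both. *)
Lemma dfun_bot : dfun (- (nrm a + 3)) = 0.
Proof.
apply/eqP; rewrite eq_le dfun_ge0 andbT -(ler_pM2l M0) mulr0.
apply: le_trans (dfun_le_ramp _ 0) _.
have <- : rphi (fc a (fun=> 0)) = 0 by rewrite fcC // rphiZ mul0r.
apply: (rphi_fc_le phi_pos) ar _ => //; [exact: cont_ramp|exact: cont_cst|move=> x].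
by rewrite ler_norml => /andP[h _]; rewrite ramp0 // expr0 invr1; lra.
Qed.

Lemma dfun_top : dfun (nrm a + 3) = 1.
Proof.
apply/eqP; rewrite eq_le dfun_le1 -(ler_pM2l M0) mulr1 /=.
rewrite /dfun [leRHS]mulrC divfK ?gt_eqF //.
apply: lb_le_inf; first by case: (has_inf_ramp (nrm a + 3)).
move=> _ [n _ <-]; rewrite -fc1.
apply: (rphi_fc_le phi_pos) ar _ => //; [exact: cont_cst|exact: cont_ramp|move=> x].
by rewrite ler_norml => /andP[_ h]; rewrite ramp1 //; lra.
Qed.

(** The increment around [s] is dominated by a plateau at [s], which has small mass by [diffuse].
    This is where atomlessness gives continuity. *)
Lemma dfun_modulus s e : 0 < e -> exists2 d, 0 < d & dfun (s + d) - dfun (s - d) < e.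
Proof.
move=> e0; have [n Hn] := diffuse s (mulr_gt0 M0 e0).
have i0 : 0 < 2 ^- n :> R by rewrite invr_gt0 exprn_gt0.
pose d : R := 2 ^- n / 2; have d0 : 0 < d by rewrite divr_gt0.
exists (d / 2); first by rewrite divr_gt0.
have [k Hk] := geom_small (divr_gt0 d0 (ltr0Sn R 1)).
rewrite -(ltr_pM2l M0) mulrBr; apply: le_lt_trans Hn.
have h1 := dfun_le_ramp (s + d / 2) k.
have h2 : rphi (fc a (ramp (s - d) k)) <= M * dfun (s - d / 2).
  by apply: ramp_le_dfun; rewrite /= in Hk; lra.
suff : rphi (fc a (ramp (s + d / 2) k)) <=
    rphi (fc a (fun x => ramp (s - d) k x + plateau s (2 ^+ n) x)).
  rewrite fcD //; [|exact: cont_ramp|exact: cont_plateau].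
  rewrite rphiD; lra.
have cp := @cont_plateau R s (2 ^+ n).
apply: le_fc; [exact: cont_ramp|by apply: contD => //; exact: cont_ramp|move=> x].
have [h|h] := leP `|x - s| (2 ^- n).
  rewrite [plateau _ _ _]clamp_eq1; first by rewrite ler_wpDl ?clamp_le1 ?clamp_ge0.
  have : 2 ^+ n * `|x - s| <= 1.
    by rewrite mulrC -ler_pdivlMr ?exprn_gt0 // div1r.
  lra.
have p0 := clamp_ge0 (2 - 2 ^+ n * `|x - s|); rewrite -/(plateau s (2 ^+ n) x) in p0.
have [xs|xs] := leP x s.
  rewrite [ramp (s - d) k x]ramp1; first by rewrite ler_wpDr ?clamp_le1.
  by move: h; rewrite ler0_norm ?subr_le0 // /d; lra.
rewrite [ramp (s + _) _ _]ramp0 ?addr_ge0 ?clamp_ge0 //.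
by move: h; rewrite gtr0_norm ?subr_gt0 // /d; rewrite /d in Hk; lra.
Qed.

Lemma cont_dfun : continuous dfun.
Proof.
move=> s; apply/cvgrPdist_lt => e /(dfun_modulus s)[d d0 Hd].
apply/nbhs_ballP; exists d => //= x; rewrite /ball /= ltr_norml => /andP[h1 h2].
have k1 : dfun (s - d) <= dfun x by apply: dfun_nd; lra.
have k2 : dfun x <= dfun (s + d) by apply: dfun_nd; lra.
have k3 : dfun (s - d) <= dfun s by apply: dfun_nd; lra.
have k4 : dfun s <= dfun (s + d) by apply: dfun_nd; lra.
move: Hd k1 k2 k3 k4; move: (dfun (s - d)) (dfun (s + d)) (dfun x) (dfun s) => p q r w.
by move=> *; rewrite ltr_norml; apply/andP; split; lra.
Qed.

Lemma dfun_onto u : 0 <= u <= 1 -> exists s, dfun s = u.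
Proof.
move=> u01; have b := nrm_ge0 a.
have [|||s _ hs] := @IVT R dfun (- (nrm a + 3)) (nrm a + 3) u.
- lra.
- by apply: continuous_subspaceT; exact: cont_dfun.
- by rewrite dfun_bot dfun_top min_l ?max_r.
by exists s.
Qed.

End Distribution.

(** Telescoping over [n] equal steps leaves [n K / n ^ 2], which tends to zero. *)
Lemma quadratic_const (R : realType) (D : R -> R) (K : R) :
  (forall u v, 0 <= u -> u < v -> v <= 1 -> `|D v - D u| <= K * (v - u) ^+ 2) -> D 1 = D 0.
Proof.
move=> H; apply/eqP; rewrite -subr_eq0 -normr_le0; apply/ler_addgt0Pl => e e0.
rewrite addr0; pose n := (Num.truncn (K / e)).+1.
have n0 : 0 < n%:R :> R by rewrite ltr0n.
have step k : (k <= n)%N -> `|D (k%:R / n%:R) - D 0| <= k%:R * (K / n%:R ^+ 2).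
  elim: k => [|k IH] kn; first by rewrite !mul0r subrr normr0.
  have h := IH (ltnW kn).
  have := H (k%:R / n%:R) (k.+1%:R / n%:R); rewrite -mulrBl -natrB // subSnn mul1r.
  rewrite divr_ge0 // ltr_pM2r ?invr_gt0 // ltr_nat ltnSn ler_pdivrMr // mul1r ler_nat kn.
  move=> /(_ isT isT isT); rewrite exprVn => h2.
  have := ler_distD (D (k%:R / n%:R)) (D (k.+1%:R / n%:R)) (D 0).
  move=> h3; apply: le_trans h3 _; apply: le_trans (lerD h2 h) _.
  by rewrite -natr1 mulrDl mul1r addrC.
have := step n (leqnn n); rewrite divff ?gt_eqF // => h; apply: le_trans h _.
have : K / e < n%:R by exact: truncnS_gt.
rewrite ltr_pdivrMr // => Kn.
have -> : n%:R * (K / n%:R ^+ 2) = K / n%:R by field; rewrite gt_eqF.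
by rewrite ler_pdivrMr // mulrC ltW.
Qed.

(** * Uniform distribution of the distribution function *)

Section Integral.
Variables (R : realType) (A : unitalCStarAlg R).
Variables (phi : {scalar A}) (phi_pos : positive_functional phi).
Variables (a : A) (saa : sa a).
Local Notation rphi := (refun phi).
Hypothesis diffuse : forall t e : R, 0 < e ->
  exists n, rphi (fc a (plateau t (2 ^+ n))) < e.
Hypothesis M0 : 0 < rphi 1.
Local Notation M := (rphi 1).
Local Notation F := (dfun phi a).
Implicit Types (s t u v x y : R) (n : nat).

Let r0 : 0 < nrm a + 1. Proof. by rewrite ltr_wpDl ?nrm_ge0. Qed.
Let ar : nrm a <= nrm a + 1. Proof. by rewrite lerDl. Qed.

Let cF : continuous F. Proof. exact: cont_dfun. Qed.

(** [B] dominates the indicator of the band where [F] climbs from [u] to [v]. The band itself has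
    mass [M (v - u)]; the slack at either end costs at most as much again, whence the factor [3]. *)
Let band u v : 0 <= u -> u < v -> v <= 1 -> exists s, exists t, exists n, exists B : R -> R,
  [/\ F s = u, F t = v, s + 2 ^- n <= t, continuous B &
   [/\ forall x, 0 <= B x, forall x, s <= x <= t -> 1 <= B x & rphi (fc a B) <= 3 * M * (v - u)]].
Proof.
move=> u0 uv v1.
have [|s Fs] := @dfun_onto R A phi phi_pos a saa diffuse M0 u.
  by rewrite u0 ltW // (lt_le_trans uv).
have [|t Ft] := @dfun_onto R A phi phi_pos a saa diffuse M0 v.
  by rewrite v1 andbT (le_trans u0) // ltW.
have st : s < t.
  by rewrite ltNge; apply/negP => /(dfun_nd phi_pos saa M0); rewrite Fs Ft leNgt uv.
have [n Hn] : exists n, 2 ^- n < t - s by apply: geom_small; rewrite subr_gt0.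
have [d d0 Hd] : exists2 d, 0 < d & F (s + d) - F (s - d) < v - u.
  by apply: dfun_modulus => //; rewrite subr_gt0.
have hs : F (s - d) > u - (v - u).
  have : F s <= F (s + d) by apply: dfun_nd => //; lra.
  lra.
have [k Hk] := geom_small d0.
have vu0 : 0 < M * (v - u) by rewrite mulr_gt0 ?subr_gt0.
have [j Hj] := dfun_approx phi_pos saa M0 t vu0.
have h1 := dfun_le_ramp phi_pos saa M0 (s - d) k.
have [cr1 cr2] := (@cont_ramp R t j, @cont_ramp R (s - d) k).
exists s, t, n, (fun x => ramp t j x - ramp (s - d) k x); split=> //; first lra.
  exact: contB.
split.
- move=> x; rewrite subr_ge0; have [xt|xt] := leP x t.
    by rewrite [ramp t j x]ramp1 // clamp_le1.
  rewrite [ramp (s - d) k x]ramp0; [exact: clamp_ge0|lra].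
- move=> x /andP[sx xt]; rewrite ramp1 // ramp0 ?subr0 //; lra.
rewrite fcB // rphiB; rewrite Ft in Hj.
have : M * (u - (v - u)) <= M * F (s - d) by rewrite ler_pM2l // ltW.
move: h1 Hj; move: (F _) (rphi (fc _ _)) (rphi (fc _ _)) => *; lra.
Qed.

(* The functional [f |-> phi (f (F a))] is integration over [[0, 1]]: compare  *)
(* [f (min (F a) u)] with [f u (1 - u) + \int_0^u f], up to quadratic errors.  *)
Lemma dfun_integral (th Th : R -> R) (C : R) : continuous th -> 0 <= C ->
  (forall x y, `|th x - th y| <= C * `|x - y|) ->
  (forall u v, u < v -> `|Th v - Th u - th v * (v - u)| <= C * (v - u) ^+ 2) ->
  rphi (fc a (fun x => th (F x))) = M * (Th 1 - Th 0).
Proof.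
move=> cth C0 lth hTh.
have cmin u : continuous (fun x => th (Num.min (F x) u)).
  by apply: cont_comp => //; apply: cont_min => //; exact: cont_cst.
pose D u := rphi (fc a (fun x => th (Num.min (F x) u))) - M * (th u * (1 - u) + Th u).
(* The constant is [6 C M] for the band, where the error is at most [2 C (v - u)] on mass
   [3 M (v - u)], plus [C M] for the mass of [rho] and [C M] for the Taylor error of [Th]. *)
have : D 1 = D 0.
  apply: (quadratic_const (K := 8 * C * M)) => u v u0 uv v1.
  have [s [t [n [B [Fs Ft stn cB [B0 B1 rB]]]]]] := band u0 uv v1.
  have cr := @cont_ramp R s n.
  pose rho x := 1 - ramp s n x.
  have crho : continuous rho by apply: contB => //; exact: cont_cst.
  pose w := th v - th u.
  have wC : `|w| <= C * (v - u).
    by apply: le_trans (lth _ _) _; rewrite gtr0_norm ?subr_gt0.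
  (* The increment is zero before [s] and [w] after [t]; subtracting [w * rho] leaves a function
     supported in the band. *)
  pose g x := th (Num.min (F x) v) - th (Num.min (F x) u) - w * rho x.
  have cw : continuous (fun x => w * rho x) by apply: contM => //; exact: cont_cst.
  have cg : continuous g by apply: contB => //; exact: contB.
  pose K := 2 * C * (v - u).
  have K0 : 0 <= K by rewrite !mulr_ge0 ?subr_ge0 ?(ltW uv).
  have gB x : `|g x| <= K * B x.
    have [xs|sx] := leP x s.
      have Fx : F x <= u by rewrite -Fs; exact: dfun_nd.
      have Fxv : F x <= v by rewrite (le_trans Fx) // ltW.
      by rewrite /g /rho ramp1 // subrr mulr0 subr0 (min_l Fx) (min_l Fxv) subrr normr0 mulr_ge0.
    have [tx|xt] := leP t x.
      have Fx : v <= F x by rewrite -Ft; exact: dfun_nd.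
      have Fxu : u <= F x by rewrite (le_trans _ Fx) // ltW.
      rewrite /g /rho ramp0 ?(le_trans stn) // subr0 mulr1 (min_r Fx) (min_r Fxu).
      by rewrite subrr normr0 mulr_ge0.
    apply: le_trans (_ : K <= _); last first.
      by rewrite -[leLHS]mulr1 ler_wpM2l // B1 // !ltW.
    apply: le_trans (ler_normB _ _) _.
    have -> : K = C * (v - u) + C * (v - u) by rewrite /K; ring.
    apply: lerD.
      apply: le_trans (lth _ _) _; rewrite ler_wpM2l //.
      have Fxu : u <= F x by rewrite -Fs; apply: dfun_nd => //; exact: ltW.
      have Fxv : F x <= v by rewrite -Ft; apply: dfun_nd => //; exact: ltW.
      by rewrite min_l // min_r // ger0_norm ?subr_ge0 // lerD2r.
    rewrite normrM -[leRHS]mulr1; apply: ler_pM => //.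
    have := clamp_ge0 (1 - 2 ^+ n * (x - s)); have := clamp_le1 (1 - 2 ^+ n * (x - s)).
    by rewrite /rho /ramp => h1 h2; rewrite ger0_norm ?subr_ge0 // gerBl.
  have cKB : continuous (fun x => K * B x) by apply: contM => //; exact: cont_cst.
  have rg : `|rphi (fc a g)| <= K * (3 * M * (v - u)).
    have h1 : rphi (fc a (fun x => K * B x)) <= K * (3 * M * (v - u)).
      by rewrite fcZ // rphiZ ler_wpM2l.
    rewrite ler_norml; apply/andP; split.
      rewrite lerNl -rphiN -fcN //; apply: le_trans h1.
      apply: (rphi_fc_le phi_pos) ar _ => //; first exact: contN.
      by move=> x _; have := gB x; rewrite ler_norml => /andP[]; rewrite lerNl.
    apply: le_trans h1; apply: (rphi_fc_le phi_pos) ar _ => //.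
    by move=> x _; have := gB x; rewrite ler_norml => /andP[].
  have er : rphi (fc a rho) = M - rphi (fc a (ramp s n)).
    by rewrite fcB //; [rewrite fcC // scale1r rphiB|exact: cont_cst].
  have r1 : M * u <= rphi (fc a (ramp s n)) by rewrite -Fs; exact: dfun_le_ramp.
  have r2 : rphi (fc a (ramp s n)) <= M * v by rewrite -Ft; exact: ramp_le_dfun.
  have rr : `|rphi (fc a rho) - M * (1 - u)| <= M * (v - u).
    rewrite er ler_norml; apply/andP; split; lra.
  have eg : rphi (fc a g) = rphi (fc a (fun x => th (Num.min (F x) v))) -
      rphi (fc a (fun x => th (Num.min (F x) u))) - w * rphi (fc a rho).
    by rewrite fcB //; [rewrite fcB // fcZ // !rphiB rphiZ|exact: contB].
  have -> : D v - D u = rphi (fc a g) + w * (rphi (fc a rho) - M * (1 - u)) -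
      M * (Th v - Th u - th v * (v - u)).
    by rewrite eg /D /w; ring.
  have h3 : `|w * (rphi (fc a rho) - M * (1 - u))| <= C * (v - u) * (M * (v - u)).
    by rewrite normrM; apply: ler_pM.
  have h4 : `|M * (Th v - Th u - th v * (v - u))| <= M * (C * (v - u) ^+ 2).
    by rewrite normrM (gtr0_norm M0) ler_pM2l // hTh.
  apply: le_trans (ler_normB _ _) _; apply: le_trans (lerD (ler_normD _ _) (lexx _)) _.
  apply: le_trans (lerD (lerD rg h3) h4) _.
  by rewrite le_eqVlt; apply/orP; left; apply/eqP; rewrite /K; ring.
rewrite /D subrr mulr0 add0r subr0 mulr1.
have -> : fc a (fun x => th (Num.min (F x) 1)) = fc a (fun x => th (F x)).
  by congr fc; apply/funext => x; rewrite min_l // dfun_le1.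
have -> : fc a (fun x => th (Num.min (F x) 0)) = (th 0)%:C%:A.
  rewrite -(fcC saa); congr fc; apply/funext => x; rewrite min_r // dfun_ge0 //.
rewrite rphiZ => h; move: h; move: (rphi _) (rphi _) => p q; lra.
Qed.

End Integral.

Section Trigonometry.
Variable R : realType.
Implicit Types x y w : R.

Lemma norm_cos_le1 x : `|cos x| <= 1. Proof. by rewrite ler_norml cos_geN1 cos_le1. Qed.
Lemma norm_sin_le1 x : `|sin x| <= 1. Proof. by rewrite ler_norml sin_geN1 sin_le1. Qed.

Lemma mvt_trig (f df : R -> R) x y : (forall z : R, is_derive z (1 : R) f (df z)) -> x < y ->
  exists2 c, x < c < y & f y - f x = df c * (y - x).
Proof.
move=> fd xy; have fc : {within `[x, y], continuous f}.
  apply: continuous_subspaceT => z; apply: differentiable_continuous.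
  exact/derivable1_diffP/ex_derive.
have [c] := MVT xy (fun z _ => fd z) fc.
by rewrite in_itv; exists c.
Qed.

Lemma lipschitz_trig (f df : R -> R) x y : (forall z : R, is_derive z (1 : R) f (df z)) ->
  (forall z, `|df z| <= 1) -> `|f x - f y| <= `|x - y|.
Proof.
move=> fd df1; wlog xy : x y / x < y.
  move=> H; have [/H //|yx|->] := ltgtP x y; last by rewrite subrr normr0.
  by rewrite distrC [leRHS]distrC; exact: H.
have [c _ E] := mvt_trig fd xy; rewrite distrC E normrM [leRHS]distrC.
by rewrite -[leRHS]mul1r ler_wpM2r.
Qed.

Lemma taylor_trig (f df ddf : R -> R) x y : (forall z : R, is_derive z (1 : R) f (df z)) ->
  (forall z : R, is_derive z (1 : R) df (ddf z)) -> (forall z, `|ddf z| <= 1) -> x < y ->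
  `|f y - f x - df y * (y - x)| <= (y - x) ^+ 2.
Proof.
move=> fd dfd d1 xy; have [c /andP[xc cy] ->] := mvt_trig fd xy.
rewrite -mulrBl normrM (gtr0_norm (_ : 0 < y - x)) ?subr_gt0 // expr2.
rewrite ler_wpM2r ?subr_ge0 ?(ltW xy) //; apply: le_trans (lipschitz_trig c y dfd d1) _.
by rewrite distrC gtr0_norm ?subr_gt0 // lerD2l lerN2 ltW.
Qed.

End Trigonometry.

(** * Cosines and sines of the distribution function *)

Section Haar.
Variables (R : realType) (A : unitalCStarAlg R).
Variables (phi : {scalar A}) (phi_pos : positive_functional phi).
Variables (a : A) (saa : sa a).
Local Notation rphi := (refun phi).
Hypothesis diffuse : forall t e : R, 0 < e ->
  exists n, rphi (fc a (plateau t (2 ^+ n))) < e.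
Hypothesis M0 : 0 < rphi 1.
Local Notation F := (dfun phi a).

Let om k : R := k%:R * (pi *+ 2).
Let Ck k := fc a (fun x => cos (om k * F x)).
Let Sk k := fc a (fun x => sin (om k * F x)).
Let cc k : continuous (fun x => cos (om k * F x)).
Proof.
apply: cont_comp; last exact: continuous_cos.
by apply: contM; [exact: cont_cst|exact: cont_dfun].
Qed.
Let cs k : continuous (fun x => sin (om k * F x)).
Proof.
apply: cont_comp; last exact: continuous_sin.
by apply: contM; [exact: cont_cst|exact: cont_dfun].
Qed.

Let om_gt0 k : 0 < om k.+1.
Proof. by rewrite mulr_gt0 ?ltr0n // pmulrn_lgt0 // pi_gt0. Qed.

Let cos_om k : cos (om k) = 1.
Proof. by rewrite /om mulr_natl -[X in cos X]add0r (periodicn (@cosD2pi R)) cos0. Qed.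

Let sin_om k : sin (om k) = 0.
Proof. by rewrite /om mulr_natl -[X in sin X]add0r (periodicn (@sinD2pi R)) sin0. Qed.

(** [dfun_integral] with antiderivative [f (w x) / w], which takes equal values at [0] and [1]
    because [w] is a multiple of the period. *)
Let trig_integral k (f df ddf : R -> R) : (forall z : R, is_derive z (1 : R) f (df z)) ->
  (forall z : R, is_derive z (1 : R) df (ddf z)) -> (forall z, `|ddf z| <= 1) ->
  f (om k.+1) = f 0 -> continuous df ->
  rphi (fc a (fun x => df (om k.+1 * F x))) = 0.
Proof.
move=> fd dfd d1 f01 cdf; have w0 := om_gt0 k; set w := om k.+1 in w0 f01 *.
rewrite (dfun_integral phi_pos saa diffuse M0 (th := fun x => df (w * x))
  (Th := fun x => f (w * x) / w) (C := w)).
- by rewrite mulr1 mulr0 f01 subrr mulr0.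
- by apply: cont_comp => //; apply: contM; [exact: cont_cst|exact: cont_id].
- exact: ltW.
- move=> x y; apply: le_trans (lipschitz_trig _ _ dfd d1) _.
  by rewrite -mulrBr normrM (gtr0_norm w0).
move=> u v uv.
have h : w * u < w * v by rewrite ltr_pM2l.
have -> : f (w * v) / w - f (w * u) / w - df (w * v) * (v - u) =
    (f (w * v) - f (w * u) - df (w * v) * (w * v - w * u)) / w.
  by field; rewrite gt_eqF.
rewrite normrM normfV (gtr0_norm w0) ler_pdivrMr //.
apply: le_trans (taylor_trig fd dfd d1 h) _.
by rewrite le_eqVlt; apply/orP; left; apply/eqP; ring.
Qed.

Let rphi_Ck k : rphi (Ck k.+1) = 0.
Proof.
apply: (trig_integral (f := sin) (df := cos) (ddf := fun x => - sin x)).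
- by move=> z; rewrite normrN norm_sin_le1.
- by rewrite sin_om sin0.
- exact: continuous_cos.
Qed.

Let rphi_Sk k : rphi (Sk k.+1) = 0.
Proof.
apply: (trig_integral (f := fun x => - cos x) (df := sin) (ddf := cos)).
- by move=> z; rewrite -[sin z]opprK; apply: is_deriveN; exact: is_derive_cos.
- by move=> z; exact: norm_cos_le1.
- by rewrite cos_om cos0.
- exact: continuous_sin.
Qed.

Lemma haar_of_diffuse : exists u : A, haar_unitary phi u.
Proof.
pose E k := Ck k + 'i *: Sk k.
have sC k : sa (Ck k) by exact: fc_sa.
have sS k : sa (Sk k) by exact: fc_sa.
have CS k l : Ck k * Sk l = Sk l * Ck k.
  by rewrite -!fcM //; congr fc; apply/funext => x; rewrite mulrC.
have sE k : star (E k) = Ck k - 'i *: Sk k.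
  by rewrite starD starZ sC sS conjCi scaleNr.
have E2 k : Ck k * Ck k + Sk k * Sk k = 1.
  rewrite -!fcM // -fcD //; [|exact: contM|exact: contM].
  rewrite (_ : (fun x => _) = fun=> 1); first by rewrite fcC // scale1r.
  by apply/funext => x; rewrite -!expr2 cos2Dsin2.
have ii x : 'i *: ('i *: x) = - x :> A by rewrite scalerA -expr2 sqrCi scaleN1r.
have EV k : star (E k) * E k = 1 /\ E k * star (E k) = 1.
  rewrite sE /E !mulrDl !mulrDr !mulrN !mulNr -!scalerAl -!scalerAr ii -CS.
  by split; rewrite opprK ?addrA ?subrK ?addrK E2.
have EM k l : E k * E l = E (k + l)%N.
  rewrite /E !mulrDl !mulrDr -!scalerAl -!scalerAr ii.
  have -> : Ck (k + l)%N = Ck k * Ck l - Sk k * Sk l.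
    rewrite -!fcM // -fcB //; [|exact: contM|exact: contM].
    by congr fc; apply/funext => x; rewrite /om natrD mulrDl mulrDl cosD.
  have -> : Sk (k + l)%N = Sk k * Ck l + Ck k * Sk l.
    rewrite -!fcM // -fcD //; [|exact: contM|exact: contM].
    by congr fc; apply/funext => x; rewrite /om natrD mulrDl mulrDl sinD.
  rewrite scalerDr [X in _ + X = _]addrC addrACA.
  by rewrite ['i *: _ + _]addrC.
have E0 : E 0 = 1.
  rewrite /E.
  have -> : Ck 0 = 1.
    rewrite /Ck (_ : (fun x => _) = fun=> 1); first by rewrite fcC // scale1r.
    by apply/funext => x; rewrite /om !mul0r cos0.
  have -> : Sk 0 = 0.
    rewrite /Sk (_ : (fun x => _) = fun=> 0); first by rewrite fcC // scale0r.
    by apply/funext => x; rewrite /om !mul0r sin0.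
  by rewrite scaler0 addr0.
have EX n : E 1 ^+ n = E n.
  by elim: n => [|n IH]; rewrite ?E0 // exprS IH EM.
have pE n : phi (E n.+1) = 0.
  by rewrite linearD linearZ /= !(phi_sa phi_pos) // rphi_Ck rphi_Sk mulr0 addr0.
exists (E 1); split; first exact: EV.
(* Negative powers are adjoints of positive ones, so their values are conjugates of zero. *)
case=> [[//|n] _|n _]; first by rewrite -exprnP EX.
rewrite NegzE -exprnN EX.
have -> : (E n.+1)^-1 = star (E n.+1).
  have [h1 h2] := EV n.+1.
  have uE : E n.+1 \is a GRing.unit by apply/unitrP; exists (star (E n.+1)).
  by apply: (mulIr uE); rewrite h1 mulVr.
by rewrite phi_star // pE rmorph0.
Qed.

End Haar.

(** * Minimal projections in simple algebras *)

Section LeftIdeal.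
Variables (R : realType) (A : unitalCStarAlg R) (p : A).

(** The left ideal [A p], which becomes the Hilbert space on which [A] acts when [p] is minimal. *)
Definition lideal : {pred A} := fun x => x * p == x.

Lemma lideal_submod : submod_closed lideal.
Proof.
split=> [|z x y /eqP xp /eqP yp]; rewrite !unfold_in /= ?mul0r //.
by rewrite mulrDl -scalerAl xp yp.
Qed.

HB.instance Definition _ := GRing.isSubmodClosed.Build R[i] A lideal lideal_submod.

Record lideal_of := LIdeal { lval : A ; _ : lval \in lideal }.

HB.instance Definition _ := [isSub for lval].
HB.instance Definition _ := [Choice of lideal_of by <:].
HB.instance Definition _ := [SubChoice_isSubLmodule of lideal_of by <:].

Lemma lvalP (x : lideal_of) : lval x * p = lval x.
Proof. by case: x => x xp; apply/eqP. Qed.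

Lemma lval_sum (I : Type) (s : seq I) (F : I -> lideal_of) :
  lval (\sum_(i <- s) F i) = \sum_(i <- s) lval (F i).
Proof. exact: (big_morph lval (fun _ _ => erefl) erefl). Qed.

Lemma lnormD (x y : lideal_of) : `|lval (x + y)| <= `|lval x| + `|lval y|.
Proof. exact: ler_normD. Qed.

Lemma lnormZ (z : R[i]) (x : lideal_of) : `|lval (z *: x)| = `|z| * `|lval x|.
Proof. exact: normrZ. Qed.

Lemma lnorm0 (x : lideal_of) : `|lval x| = 0 -> x = 0.
Proof. by move/eqP; rewrite normr_eq0 => /eqP x0; apply: val_inj. Qed.

HB.instance Definition _ := Lmodule_isNormed.Build R[i] lideal_of lnormD lnormZ lnorm0.

Lemma nrm_lval (x : lideal_of) : nrm x = nrm (lval x).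
Proof. by []. Qed.

Lemma lideal_complete (F : set_system lideal_of) : ProperFilter F -> cauchy F -> cvg F.
Proof.
move=> PF /cauchyP Fc.
have Gc : cauchy (lval @ F).
  apply/cauchyP => e e0; have [x Fx] := Fc e e0; exists (lval x).
  change (F (lval @^-1` ball (lval x) e)); apply: filterS Fx => y.
  by move=> /(nrm_ball _ _ e0) h; apply/(nrm_ball _ _ e0).
have /cvg_ex[l Gl] : cvg (lval @ F) by exact: cauchy_cvg Gc.
have near e : 0 < e -> F [set y | nrm (l - lval y) < e].
  move=> e0; have e0C : 0 < e%:C by rewrite ltcR.
  have /cvg_ballP/(_ _ e0C) := Gl; apply: filterS => y.
  by move/nrm_ball => /(_ e0C).
have lp : l * p = l.
  apply/eqP; rewrite -subr_eq0; apply/eqP/nrm_small_eq0 => e e0.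
  have D0 : 0 < nrm p + 1 by rewrite ltr_wpDl ?nrm_ge0.
  have [y /= ly] := filter_ex (near _ (divr_gt0 e0 D0)).
  have -> : l * p - l = (l - lval y) * p - (l - lval y).
    by rewrite mulrBl lvalP opprB addrA subrK.
  apply: le_trans (nrmB _ _) _; have := nrmM (l - lval y) p.
  move: ly; rewrite ltr_pdivlMr //; have := nrm_ge0 (l - lval y); nra.
have lP : l \in lideal by apply/eqP.
apply/cvg_ex; exists (LIdeal lP); apply/cvg_ballP => e e0.
have e0' : 0 < complex.Re e by rewrite -ltcR (RRe_real (gtr0_real e0)).
by apply: filterS (near _ e0') => y ly; apply/(nrm_ball _ _ e0).
Qed.

HB.instance Definition _ := Uniform_isComplete.Build lideal_of lideal_complete.

End LeftIdeal.

(** * Compactness in finite rank *)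

Section FiniteRankCompact.
Variables (R : realType) (V : normedModType R[i]).

Lemma cont_scalel (h : V) : continuous (fun s : R => s%:C *: h).
Proof.
move=> s; apply/cvgrPdist_lt => e e0.
have e0' : 0 < complex.Re e by rewrite -ltcR (RRe_real (gtr0_real e0)).
have D0 : 0 < nrm h + 1 by rewrite ltr_wpDl ?nrm_ge0.
apply/nbhs_ballP; exists (complex.Re e / (nrm h + 1)); first exact: divr_gt0.
move=> t; rewrite /ball /= ltr_pdivlMr // => st.
rewrite -scalerBl -rmorphB /= nrmE -(RRe_real (gtr0_real e0)) ltcR nrmZ.
have := nrm_ge0 h; have := normr_ge0 (s - t); nra.
Qed.

(** Each complex disc is enclosed in a square of real and imaginary parts, so the sums lie in a
    continuous image of a product of compact intervals. *)
Lemma compact_discs (s : seq (V * R)) : exists2 K : set V, compact K &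
  forall z : nat -> R[i], (forall i, (i < size s)%N -> `|z i| <= (nth (0, 0) s i).2%:C) ->
  K (\sum_(i < size s) z i *: (nth (0, 0) s i).1).
Proof.
elim: s => [|[h M] s [K cK HK]].
  exists [set 0]; first exact: compact_set1.
  by move=> z _; rewrite big_ord0.
pose I := `[- M, M]%classic : set R.
have cI : compact I by exact: segment_compact.
exists ((fun u : (R * R) * V => u.1.1%:C *: h + u.1.2%:C *: ('i *: h) + u.2) @` ((I `*` I) `*` K)).
  apply: continuous_compact; last by apply: compact_setX => //; exact: compact_setX.
  have cf : continuous (fun u : (R * R) * V => u.1) by move=> u; exact: cvg_fst.
  have c1 : continuous (fun u : (R * R) * V => u.1.1).
    move=> u; apply: (@continuous_comp _ _ _ (fun u : (R * R) * V => u.1) fst).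
      exact: cf.
    exact: cvg_fst.
  have c2 : continuous (fun u : (R * R) * V => u.1.2).
    move=> u; apply: (@continuous_comp _ _ _ (fun u : (R * R) * V => u.1) snd).
      exact: cf.
    exact: cvg_snd.
  apply: continuous_subspaceT => u; apply: cvgD; last exact: cvg_snd.
  apply: cvgD.
    apply: (@continuous_comp _ _ _ (fun u : (R * R) * V => u.1.1) (fun s : R => s%:C *: h)).
      exact: c1.
    exact: cont_scalel.
  apply: (@continuous_comp _ _ _ (fun u : (R * R) * V => u.1.2)
    (fun s : R => s%:C *: ('i *: h))); first exact: c2.
  exact: cont_scalel.
move=> z Hz; exists ((complex.Re (z 0), complex.Im (z 0)),
  \sum_(i < size s) z i.+1 *: (nth (0, 0) s i).1).
  split; last by apply: (HK (fun i => z i.+1)) => i si; exact: (Hz i.+1).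
  have := Hz 0 isT; rewrite /= normc_def lecR => zM.
  have sq (x y : R) : x ^+ 2 <= y -> Num.sqrt y <= M -> `|x| <= M.
    move=> xy yM; apply: le_trans yM; rewrite -sqrtr_sqr; exact: ler_wsqrtr.
  split; rewrite /I /= in_itv /= -ler_norml; apply: sq zM; rewrite ?lerDl ?lerDr ?sqr_ge0 //.
rewrite /= big_ord_recl /=; congr (_ + _).
by rewrite scalerA -scalerDl; congr (_ *: _); rewrite [RHS]complexE mulrC.
Qed.

End FiniteRankCompact.

(** * A minimal projection makes the algebra elementary *)

Section MinimalProjection.
Variables (R : realType) (A : unitalCStarAlg R) (simpleA : simple_cstar A).
Variables (phi : {scalar A}) (phi_pos : positive_functional phi).
Variable p : A.
Hypotheses (sp : sa p) (pp : p * p = p) (p0 : 0 < refun phi p).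
Hypothesis minp : forall h : A, sa h -> her p h -> exists l : R, h = l%:C *: p.
Local Notation rphi := (refun phi).
Local Notation H := (lideal_of p).
Implicit Types (x y z : A).

Definition span_ideal : set A := [set x | exists s : seq (A * A), x = \sum_(i <- s) i.1 * p * i.2].

Let spanD x y : span_ideal x -> span_ideal y -> span_ideal (x + y).
Proof. by move=> [s ->] [t ->]; exists (s ++ t); rewrite big_cat. Qed.

Let spanMl x y : span_ideal y -> span_ideal (x * y).
Proof.
move=> [s ->]; exists [seq (x * i.1, i.2) | i <- s].
by rewrite big_map mulr_sumr; apply: eq_bigr => i _; rewrite !mulrA.
Qed.

Let spanMr x y : span_ideal x -> span_ideal (x * y).
Proof.
move=> [s ->]; exists [seq (i.1, i.2 * y) | i <- s].
by rewrite big_map mulr_suml; apply: eq_bigr => i _; rewrite !mulrA.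
Qed.

(** By simplicity the closure of the two-sided ideal [A p A] is everything, so it contains some [y]
    near [1]. Then [star y * y] is invertible, and an ideal containing an invertible element
    contains [1]. *)
Lemma span_one : span_ideal 1.
Proof.
pose I := [set x : A | forall e : R, 0 < e -> exists2 y, span_ideal y & nrm (x - y) < e].
have idI : closed_ideal I.
  have IMl a b : I b -> I (a * b).
    move=> Ib e e0; have D0 : 0 < nrm a + 1 by rewrite ltr_wpDl ?nrm_ge0.
    have [y sy] := Ib _ (divr_gt0 e0 D0); rewrite ltr_pdivlMr // => yb.
    exists (a * y); first exact: spanMl.
    rewrite -mulrBr; apply: le_lt_trans (nrmM _ _) _.
    have := nrm_ge0 (b - y); lra.
  split.
  - move=> x clx e e0; have e2 : 0 < e / 2 by rewrite divr_gt0.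
    have eC : 0 < (e / 2)%:C by rewrite ltcR.
    have [y [Iy /(nrm_ball _ _ eC) /= xy]] := clx _ (nbhsx_ballx x _ eC).
    have [z sz yz] := Iy _ e2; exists z => //.
    have := nrm_triangle x y z; lra.
  - by move=> e e0; exists 0; [exists [::]; rewrite big_nil|rewrite subrr nrm0].
  - move=> x y Ix Iy e e0; have e2 : 0 < e / 2 by rewrite divr_gt0.
    have [x' sx' xx'] := Ix _ e2; have [y' sy' yy'] := Iy _ e2.
    exists (x' + y'); first exact: spanD.
    rewrite opprD addrACA; have := nrmD (x - x') (y - y'); lra.
  - by move=> z x Ix; rewrite -mulr_algl; exact: IMl.
  - exact: IMl.
  - move=> a b Ia e e0; have D0 : 0 < nrm b + 1 by rewrite ltr_wpDl ?nrm_ge0.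
    have [y sy] := Ia _ (divr_gt0 e0 D0); rewrite ltr_pdivlMr // => ya.
    exists (y * b); first exact: spanMr.
    rewrite -mulrBl; apply: le_lt_trans (nrmM _ _) _.
    have := nrm_ge0 (a - y); lra.
have Ip : I p.
  move=> e e0; exists p; last by rewrite subrr nrm0.
  by exists [:: (1, 1)]; rewrite big_seq1 mul1r mulr1.
have I1 : I 1.
  case: (simpleA idI) => [I0|->] //; move: Ip p0; rewrite I0 /= => ->.
  by rewrite -(scale0r (0 : A)) (rphiZ phi 0) mul0r ltxx.
have e8 : 0 < 8^-1 :> R by rewrite invr_gt0.
have [y sy y1] := I1 _ e8.
pose w := 1 - star y * y.
have sw : sa w by apply: saB; [exact: sa1|exact: sa_cstar].
have w1 : nrm w <= 2^-1.
  have -> : w = (1 - y) + star (1 - y) * y.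
    by rewrite starB star1 mulrBl mul1r addrA subrK.
  have := nrmD (1 - y) (star (1 - y) * y); have := nrmM (star (1 - y)) y.
  have := nrm_triangle y 1 0; rewrite !subr0 nrm1 nrm_star nrmBC.
  have := nrm_ge0 y; have := nrm_ge0 (1 - y); nra.
(* The inverse of [1 - t], which is needed only for [t] up to [1 / 2]; the maximum makes it
   continuous everywhere. *)
pose g (t : R) := (Num.max (4^-1) (1 - t))^-1.
have gp (t : R) : 0 < Num.max (4^-1) (1 - t) by rewrite lt_max invr_gt0 ltr0n.
have c1 : continuous (fun t : R => 1 - t) by apply: contB; [exact: cont_cst|exact: cont_id].
have cm : continuous (fun t : R => Num.max (4^-1) (1 - t)).
  by apply: cont_max => //; exact: cont_cst.
have cg : continuous g by move=> t; apply: cvgV; [rewrite gt_eqF|exact: cm].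
have e1 : fc w g * (star y * y) = 1.
  have -> : star y * y = fc w (fun t => 1 - t).
    rewrite fcB //; [|exact: cont_cst|exact: cont_id].
    by rewrite fcC // fcX // scale1r opprB addrCA subrr addr0.
  rewrite -fcM // -[RHS]scale1r -(rmorph1 (real_complex R)) -(fcC sw).
  apply: eq_fc w1 _ => //; [exact: contM|exact: cont_cst|].
  move=> t; rewrite ler_norml => /andP[_ t2]; rewrite /g max_r ?mulVf //; last lra.
  by rewrite gt_eqF //; lra.
by rewrite -e1; apply: spanMl; apply: spanMl.
Qed.

Let phip : phi p = (rphi p)%:C. Proof. by rewrite phi_sa. Qed.
Let phip0 : phi p != 0.
Proof. by rewrite phip; apply/eqP => /complexI h; move: p0; rewrite h ltxx. Qed.

(** The scalar by which [p x p] is a multiple of [p], recovered through [phi]; see [coefP]. *)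
Definition coef x : R[i] := phi (p * x * p) / phi p.

Lemma coefP x : p * x * p = coef x *: p.
Proof.
have hp (y : A) : sa y -> exists l : R, p * y * p = l%:C *: p.
  move=> sy; apply: minp; first by rewrite -{1}sp; exact: saJ.
  by split; [rewrite !mulrA pp|rewrite -mulrA pp].
pose u := x + star x; pose v := 'i *: (star x - x).
have su : sa u by rewrite /sa starD starK addrC.
have sv : sa v by rewrite /sa starZ starB starK conjCi scaleNr -scalerN opprB.
have ex : x + x = u + 'i *: v.
  have -> : 'i *: v = x - star x by rewrite /v scalerA -expr2 sqrCi scaleN1r opprB.
  by rewrite /u addrACA subrr addr0.
have [l hl] := hp _ su; have [l' hl'] := hp _ sv.
have [c hc] : exists c : R[i], p * x * p = c *: p.
  exists ((2^-1)%:C * (l%:C + 'i * l'%:C)).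
  have : p * (x + x) * p = (l%:C + 'i * l'%:C) *: p.
    by rewrite ex mulrDr mulrDl hl -scalerAr -scalerAl hl' scalerA scalerDl.
  rewrite -scalerA => <-; rewrite mulrDr mulrDl scalerDr -scalerDl -rmorphD /=.
  by rewrite (_ : _ + _ = 1) ?scale1r //; lra.
by rewrite /coef hc linearZ /= mulfK.
Qed.

(** Since [star y * x] lies in [p A p], it is a multiple of [p], and this multiple is the inner
    product. *)
Definition cdot (x y : H) : R[i] := phi (star (lval y) * lval x) / phi p.

Let lval_star (y : H) : p * star (lval y) = star (lval y).
Proof. by rewrite -{1}sp -starM lvalP. Qed.

Lemma cdotP (x y : H) : star (lval y) * lval x = cdot x y *: p.
Proof.
rewrite /cdot -[in RHS]lval_star -[in RHS](lvalP x) !mulrA.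
rewrite -[p * _ * _]mulrA -/(coef _) -coefP.
by rewrite mulrA lval_star -mulrA lvalP.
Qed.

Let conj_rC (r : R) : Num.conj r%:C = r%:C :> R[i].
Proof. by rewrite conj_Creal //; apply/complex_realP; exists r. Qed.

Let cdotBl (y : H) : zmod_morphism (cdot^~ y).
Proof. by move=> x x'; rewrite /cdot mulrBr linearB /= mulrBl. Qed.
Let cdotBr (x : H) : zmod_morphism (cdot x).
Proof. by move=> y y'; rewrite /cdot starB mulrBl linearB /= mulrBl. Qed.
Let cdotZl (y : H) : scalable_for *%R (cdot^~ y).
Proof. by move=> c x; rewrite /cdot /= -scalerAr linearZ /= mulrA. Qed.
Let cdotZr (x : H) : scalable_for (Num.conj \; *%R) (cdot x).
Proof. by move=> c y; rewrite /cdot /= starZ -scalerAl linearZ /= mulrA. Qed.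

HB.instance Definition _ := isBilinear.Build R[i] H H R[i] *%R (Num.conj \; *%R) cdot
  cdotBl cdotBr cdotZl cdotZr.

Let cdot_herm (x y : H) : cdot x y = (-1) ^+ false * Num.conj (cdot y x).
Proof.
rewrite expr0 mul1r /cdot rmorphM fmorphV /= -(phi_star phi_pos) starM starK.
by rewrite phip conj_rC.
Qed.

HB.instance Definition _ := isHermitianSesquilinear.Build R[i] H false Num.conj cdot cdot_herm.

Let nrm_p : nrm p = 1.
Proof.
have n0 : nrm p != 0.
  apply/eqP => /nrm0_eq0 h; move: p0; rewrite h -(scale0r (0 : A)) (rphiZ phi 0) mul0r.
  by rewrite ltxx.
by apply: (mulfI n0); rewrite -expr2 -nrm_sqr // pp mulr1.
Qed.

Lemma cdot_norm (x : H) : cdot x x = `|x| ^+ 2.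
Proof.
have r : cdot x x = (rphi (star (lval x) * lval x) / rphi p)%:C.
  by rewrite /cdot phi_cstar // phip rmorphM fmorphV.
have r0 : 0 <= rphi (star (lval x) * lval x) / rphi p.
  by apply: divr_ge0; [exact: rphi_cstar_ge0|exact: ltW].
rewrite nrmE -rmorphXn nrm_lval /= -nrm_cstar cdotP r nrmZ nrm_p mulr1.
by rewrite ger0_norm.
Qed.

Let cdot_pos (x : H) : x != 0 -> 0 < cdot x x.
Proof. by move=> x0; rewrite cdot_norm exprn_gt0 // normr_gt0. Qed.

HB.instance Definition _ := isDotProduct.Build R[i] H cdot cdot_pos.

Let act_mem (a : A) (x : H) : a * lval x \in lideal p.
Proof. by apply/eqP; rewrite -mulrA lvalP. Qed.

Definition act (a : A) : H -> H := fun x : H => LIdeal (act_mem a x).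

Let act_linear : linear act.
Proof.
move=> c a b; apply/funext => x; apply: val_inj => /=.
by rewrite mulrDl -scalerAl.
Qed.

HB.instance Definition _ := GRing.isLinear.Build R[i] A (H -> H) *:%R act act_linear.

Let gen_mem (c : A) : c * p \in lideal p.
Proof. by apply/eqP; rewrite -mulrA pp. Qed.

Let coef_act (d : A) (x : H) : p * (d * lval x) = coef (d * lval x) *: p.
Proof. by rewrite -coefP -!mulrA lvalP. Qed.

(** The vectors [i.1 * p] span [A p], with coordinates depending linearly on [x]; so every linear
    map on [A p] has finite rank. *)
Let expand (s : seq (A * A)) (x : H) : 1 = \sum_(i <- s) i.1 * p * i.2 ->
  x = \sum_(i <- s) coef (i.2 * lval x) *: LIdeal (gen_mem i.1).
Proof.
move=> s1; apply: val_inj; rewrite /= lval_sum -[LHS]mul1r s1 mulr_suml.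
by apply: eq_bigr => i _; rewrite -!mulrA coef_act -scalerAr.
Qed.

Let coef_bound (d : A) (x : H) : nrm x <= 1 -> `|coef (d * lval x)| <= (nrm d)%:C.
Proof.
move=> x1; have : nrm (coef (d * lval x) *: p) <= nrm d.
  rewrite -coef_act; apply: le_trans (nrmM _ _) _; rewrite nrm_p mul1r.
  by apply: le_trans (nrmM _ _) _; rewrite -[leRHS]mulr1 ler_wpM2l ?nrm_ge0.
by rewrite -lecR -(nrmE (coef _ *: p)) normrZ (nrmE p) nrm_p mulr1.
Qed.

Lemma elementary_of_minimal : elementary A.
Proof.
have [s s1] := span_one.
exists H, cdot, act; split; first exact: cdot_norm.
- split.
  + move=> a _ /=; split.
      by move=> c x y; apply: val_inj; rewrite /= mulrDr -scalerAr.
    pose t := [seq (act a (LIdeal (gen_mem i.1)), nrm i.2) | i <- s].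
    have [K cK HK] := compact_discs t.
    have clK : closed K by apply: (compact_closed _ cK); exact: norm_hausdorff.
    apply: (subclosed_compact _ cK); first exact: closed_closure.
    rewrite [X in _ `<=` X]((closure_id K).1 clK); apply: closure_subset => _ [x x1 <-].
    have -> : act a x = \sum_(i < size t) coef ((nth (0, 0) s i).2 * lval x) *:
        (nth (0, 0) t i).1.
      rewrite {1}(expand x s1) /t size_map.
      apply: val_inj; rewrite /= lval_sum mulr_sumr (big_nth (0, 0)) big_mkord [in RHS]lval_sum.
      apply: eq_bigr => i _; rewrite (nth_map (0, 0)) //=.
      by rewrite -scalerAr.
    apply: (HK (fun i => coef ((nth (0, 0) s i).2 * lval x))) => i.
    rewrite size_map => si; rewrite (nth_map (0, 0)) //=.
    by apply: coef_bound; rewrite -lecR -nrmE.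
  (* Acting on the spanning vectors [i.1 * p] determines [a], because [a] is the sum of the
     [a * i.1 * p * i.2]. *)
  + move=> a b _ _ ab; rewrite -[a]mulr1 -[b]mulr1 s1 !mulr_sumr.
    apply: eq_bigr => i _; rewrite !mulrA; congr (_ * _).
    have := congr1 (fun f => lval (f (LIdeal (gen_mem i.1)))) ab.
    by rewrite /= !mulrA.
  (* Only linearity of [T] matters: its images of the spanning vectors, multiplied by the [i.2] and
     summed, give an element acting as [T]. *)
  + move=> T [linT _]; pose b i := lval (T (LIdeal (gen_mem i))).
    exists (\sum_(i <- s) b i.1 * p * i.2) => //; apply/funext => x; apply: val_inj.
    rewrite /= mulr_suml [in RHS](expand x s1).
    have T0 : T 0 = 0 by have := linT (-1) 0 0; rewrite scaler0 addr0 scaleN1r addNr.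
    have Tsum : T (\sum_(i <- s) coef (i.2 * lval x) *: LIdeal (gen_mem i.1)) =
        \sum_(i <- s) coef (i.2 * lval x) *: T (LIdeal (gen_mem i.1)).
      elim: (s) => [|i u IH]; first by rewrite !big_nil T0.
      by rewrite !big_cons linT IH.
    rewrite Tsum lval_sum; apply: eq_bigr => i _ /=.
    by rewrite -!mulrA coef_act -scalerAr lvalP.
- by move=> a b; apply/funext => x; apply: val_inj; rewrite /= mulrA.
move=> a x y; suff : cdot (act a x) y = cdot x (act (star a) y) by [].
by rewrite /cdot /= starM starK mulrA.
Qed.

End MinimalProjection.

Theorem corollary4p14 (R : realType) (A : unitalCStarAlg R)
    (simpleA : simple_cstar A) (nonelementaryA : ~ elementary A)
    (phi : {scalar A}) (phi_pos : positive_functional phi) :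
  exists u : A, haar_unitary phi u.
Proof.
(* If [phi 1 = 0], the unit is itself a Haar unitary; otherwise [phi] can be normalised by its total
   mass. *)
have r0 := rphi1_ge0 phi_pos; have [r1|r1] := eqVneq (refun phi 1) 0.
  exists 1; split; first by rewrite /unitary star1 mulr1.
  by move=> k _; rewrite exp1rz (phi_sa phi_pos (sa1 A)) r1.
have M0 : 0 < refun phi 1 by rewrite lt0r r1.
have noproj p : sa p -> p * p = p -> 0 < refun phi p ->
    exists h, [/\ sa h, her p h & forall l : R, h <> l%:C *: p].
  move=> sp pp p0; apply: contrapT => minp; apply: nonelementaryA.
  apply: (elementary_of_minimal simpleA phi_pos sp pp p0) => h sh hh.
  by apply: contrapT => /forallNP hl; apply: minp; exists h.
have [a sx diffuse] := exists_diffuse simpleA phi_pos noproj.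
exact: (haar_of_diffuse phi_pos sx diffuse M0).
Qed.
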